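(* The maps $\lambda:\mathbb{P}_n\to\mathbb{R}_+^n$ (eigenvalue map) and $\widehat{d}:\mathbb{P}_{2n}\to\mathbb{R}_+^{2n}$ (extended symplectic eigenvalue map) are Lipschitz with respect to the Riemannian distance $\delta$. Moreover, for every probability space $(\Omega,\mathbf{P})$, $$\lambda\left(\int_{\Omega}^{(G)}\varphi(\omega)\,d\mathbf{P}(\omega)\right)\prec_{\log}\int_{\Omega}^{(G)}\lambda(\varphi(\omega))\,d\mathbf{P}(\omega),\qquad \varphi\in L^1(\Omega;\mathbb{P}_n),$$ and $$\widehat{d}\left(\int_{\Omega}^{(G)}\varphi(\omega)\,d\mathbf{P}(\omega)\right)\prec_{\log}\int_{\Omega}^{(G)}\widehat{d}(\varphi(\omega))\,d\mathbf{P}(\omega),\qquad \varphi\in L^1(\Omega;\mathbb{P}_{2n}).$$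
   Context: $\mathbb{P}_n$ is the set of $n\times n$ real symmetric positive definite matrices with Riemannian distance $\delta(A,B)=\|\log A^{-1/2}BA^{-1/2}\|_2$, where $\|X\|_2=(\operatorname{tr}X^2)^{1/2}$. $\mathbb{R}_+=(0,\infty)$, and $\mathbb{R}_+^n$ is identified with the diagonal matrices in $\mathbb{P}_n$, so $\delta(a,b)=\|\log a-\log b\|_2$ (componentwise logarithm, Euclidean norm) for $a,b\in\mathbb{R}_+^n$. Eigenvalue map: $\lambda(A)=(\lambda_1(A),\dots,\lambda_n(A))$, the eigenvalues in decreasing order with multiplicity. Symplectic eigenvalues: let $J=\begin{bmatrix}0&I\\-I&0\end{bmatrix}$ and $\mathrm{Sp}(2n,\mathbb{R})=\{M\in M_{2n}(\mathbb{R}):M^TJM=J\}$. By Williamson's theorem, for each $A\in\mathbb{P}_{2n}$ there are a unique diagonal matrix $D=\mathrm{diag}(d_1,\dots,d_n)$ with $0<d_1\le\dots\le d_n$ and some $M\in\mathrm{Sp}(2n,\mathbb{R})$ with $A=M^T\begin{bmatrix}D&0\\0&D\end{bmatrix}M$. The extended symplectic eigenvalue map is $\widehat{d}(A)=(\widehat d_1(A),\dots,\widehat d_{2n}(A))=(d_n,d_n,d_{n-1},d_{n-1},\dots,d_1,d_1)$. Cartan barycenter: for $X=\mathbb{P}_n$ or $X=\mathbb{R}_+^n$ with metric $\delta$, $\mathcal{P}^1(X)$ is the set of Borel probability measures $\mu$ on $X$ with $\int_X\delta(a,x)\,d\mu(a)<\infty$ for some $x\in X$. For $\mu\in\mathcal{P}^1(X)$,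 $G(\mu)\in X$ is the unique minimizer over $z\in X$ of $\int_X[\delta^2(z,a)-\delta^2(y,a)]\,d\mu(a)$, which is independent of the fixed $y\in X$. On $\mathbb{R}_+^n$ this is $G(\mu)=\exp\int\log x\,d\mu(x)$ (componentwise). Geometric integral: $L^1(\Omega;X)$ is the space of measurable $\varphi:\Omega\to X$ with $\int_\Omega\delta(\varphi(\omega),x)\,d\mathbf{P}(\omega)<\infty$ for some $x\in X$; for such $\varphi$, $\int_\Omega^{(G)}\varphi(\omega)\,d\mathbf{P}(\omega):=G(\varphi_*\mathbf{P})$, where $\varphi_*\mathbf{P}$ is the push-forward measure. Log-majorization: for $a,b\in\mathbb{R}_+^n$ arranged in decreasing order, $a\prec_{\log}b$ means $\prod_{i=1}^ka_i\le\prod_{i=1}^kb_i$ for $1\le k\le n$, with equality for $k=n$. *)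

(* Defs.v *)
From HB Require Import structures.
From mathcomp Require Import all_boot all_order all_algebra.
From mathcomp Require Import all_classical all_reals all_analysis.
Set Implicit Arguments.
Unset Strict Implicit.
Unset Printing Implicit Defensive.
Import Order.TTheory GRing.Theory Num.Theory.
Import numFieldNormedType.Exports.
Local Open Scope classical_set_scope.
Local Open Scope ring_scope.

Definition is_posdef (R : realType) (n : nat) (A : 'M[R]_n) : bool :=
  (A^T == A) &&
  `[< forall v : 'cV[R]_n, v != 0 -> 0 < (v^T *m A *m v) 0 0 >].

Record posdefmx (R : realType) (n : nat) := PosDefMx
  { posdefmx_val :> 'M[R]_n; posdefmxP : is_posdef posdefmx_val }.

HB.instance Definition _ (R : realType) (n : nat) :=
  [isSub for @posdefmx_val R n].
HB.instance Definition _ (R : realType) (n : nat) :=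
  [Choice of posdefmx R n by <:].

Lemma is_posdef1 (R : realType) (n : nat) : is_posdef (1%:M : 'M[R]_n).
Proof.
apply/andP; split; first by rewrite trmx1.
apply/asboolP => v v0; rewrite mulmx1 !mxE lt_neqAle; apply/andP; split.
- apply: contra v0 => /eqP/esym h; apply/eqP/matrixP => i j.
  rewrite (ord1 j) [RHS]mxE; apply/eqP; rewrite -sqrf_eq0; apply/eqP.
  have := @psumr_eq0P R 'I_n predT (fun k => v^T 0 k * v k 0).
  move=> /(_ _ h i isT); rewrite mxE -expr2; apply.
  by move=> k _; rewrite mxE -expr2 sqr_ge0.
- by apply: sumr_ge0 => k _; rewrite mxE -expr2 sqr_ge0.
Qed.

HB.instance Definition _ (R : realType) (n : nat) :=
  isPointed.Build (posdefmx R n) (PosDefMx (is_posdef1 R n)).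

Record posrv (R : realType) (n : nat) := PosRv
  { posrv_val :> 'rV[R]_n; posrvP : [forall i, 0 < posrv_val 0 i] }.

HB.instance Definition _ (R : realType) (n : nat) := [isSub for @posrv_val R n].
HB.instance Definition _ (R : realType) (n : nat) :=
  [Choice of posrv R n by <:].

Lemma posrv1_subproof (R : realType) (n : nat) :
  [forall i, 0 < (const_mx 1 : 'rV[R]_n) 0 i].
Proof. by apply/forallP => i; rewrite mxE ltr01. Qed.

HB.instance Definition _ (R : realType) (n : nat) :=
  isPointed.Build (posrv R n) (PosRv (posrv1_subproof R n)).

(* Functional calculus of a symmetric matrix: f(A) = U diag(f(d)) U^T for any
   orthogonal diagonalization A = U diag(d) U^T; the value does not depend on
   the diagonalization. *)
Definition mxfun (R : realType) (n : nat) (f : R -> R) (A : 'M[R]_n) : 'M[R]_n :=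
  get [set B | exists (U : 'M[R]_n) (d : 'rV[R]_n),
    [/\ U *m U^T = 1%:M,
        A = U *m diag_mx d *m U^T &
        B = U *m diag_mx (map_mx f d) *m U^T]].

Definition logmx (R : realType) (n : nat) (A : 'M[R]_n) : 'M[R]_n :=
  mxfun (@ln R) A.

Definition invsqrtmx (R : realType) (n : nat) (A : 'M[R]_n) : 'M[R]_n :=
  mxfun (fun x : R => (Num.sqrt x)^-1) A.

Definition norm2mx (R : realType) (n : nat) (X : 'M[R]_n) : R :=
  Num.sqrt (\tr (X *m X)).

Definition dist_pd (R : realType) (n : nat) (A B : posdefmx R n) : R :=
  norm2mx (logmx (invsqrtmx A *m B *m invsqrtmx A)).

Definition dist_pos (R : realType) (n : nat) (a b : posrv R n) : R :=
  Num.sqrt (\sum_(i < n) (ln (a 0 i) - ln (b 0 i)) ^+ 2).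

Definition dist_lipschitz (R : realType) (S T : Type)
    (dS : S -> S -> R) (dT : T -> T -> R) (f : S -> T) : Prop :=
  exists2 K : R, 0 <= K & forall x y, dT (f x) (f y) <= K * dS x y.

Definition dist_open (R : realType) (T : Type) (dist : T -> T -> R) :
    set (set T) :=
  [set U | forall x, U x -> exists2 r : R, 0 < r & [set y | dist x y < r] `<=` U].

Notation borel dist := (g_sigma_algebraType (dist_open dist)).

Definition L1map (R : realType) (T : pointedType) (dist : T -> T -> R)
    (d : measure_display) (Omega : measurableType d) (P : probability Omega R)
    (phi : Omega -> borel dist) : Prop :=
  measurable_fun setT phi /\
  exists x : T, (\int[P]_w (dist (phi w) x)%:E < +oo)%E.

(* z minimizes the integral of dist^2(z, .) - dist^2(y, .), for every choice of
   the base point y. *)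
Definition is_barycenter (R : realType) (T : pointedType) (dist : T -> T -> R)
    (mu : set (borel dist) -> \bar R) (z : T) : Prop :=
  forall y w : T,
    (\int[mu]_(a in [set: borel dist]) (dist z a ^+ 2 - dist y a ^+ 2)%:E <=
     \int[mu]_(a in [set: borel dist]) (dist w a ^+ 2 - dist y a ^+ 2)%:E)%E.

(* Only meaningful when mu is a probability measure in P^1(X), in which case
   the minimizer exists and is unique for X = P_n and X = R_+^n. *)
Definition barycenter (R : realType) (T : pointedType) (dist : T -> T -> R)
    (mu : set (borel dist) -> \bar R) : T :=
  get [set z | is_barycenter mu z].

Definition geom_integral (R : realType) (T : pointedType) (dist : T -> T -> R)
    (d : measure_display) (Omega : measurableType d) (P : probability Omega R)
    (phi : Omega -> borel dist) : T :=
  barycenter (pushforward P phi).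

Definition rv_nonincreasing (R : realType) (n : nat) (a : 'rV[R]_n) : Prop :=
  forall i j : 'I_n, (i <= j)%N -> a 0 j <= a 0 i.

Definition rv_nondecreasing (R : realType) (n : nat) (a : 'rV[R]_n) : Prop :=
  forall i j : 'I_n, (i <= j)%N -> a 0 i <= a 0 j.

(* Roots of the characteristic polynomial counted with multiplicity, in
   decreasing order. *)
Definition eigvals (R : realType) (n : nat) (A : posdefmx R n) : posrv R n :=
  get [set a : posrv R n | rv_nonincreasing a /\
    char_poly A = \prod_(i < n) ('X - (a 0 i)%:P)].

Definition symplJ (R : realType) (n : nat) : 'M[R]_(n + n) :=
  block_mx 0 1%:M (- 1%:M) 0.

Definition symplectic (R : realType) (n : nat) (M : 'M[R]_(n + n)) : Prop :=
  M^T *m symplJ R n *m M = symplJ R n.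

(* The symplectic eigenvalues d_1 <= ... <= d_n of Williamson's theorem. *)
Definition sympl_eigvals (R : realType) (n : nat) (A : posdefmx R (n + n)) :
    posrv R n :=
  get [set a : posrv R n | rv_nondecreasing a /\
    exists2 M : 'M[R]_(n + n), symplectic M &
      posdefmx_val A = M^T *m block_mx (diag_mx a) 0 0 (diag_mx a) *m M].

Lemma half_ord_subproof (n : nat) (i : 'I_(n + n)) : (i./2 < n)%N.
Proof.
rewrite -ltn_double -addnn addnn -[X in (_ < X)%N]addnn.
by rewrite (leq_ltn_trans _ (ltn_ord i))// -{2}(odd_double_half i) leq_addl.
Qed.

Definition half_ord (n : nat) (i : 'I_(n + n)) : 'I_n :=
  Ordinal (half_ord_subproof i).

Lemma ext_sympl_subproof (R : realType) (n : nat) (a : posrv R n) :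
  [forall i, 0 < (\row_(i < n + n) a 0 (rev_ord (half_ord i))) 0 i].
Proof. by apply/forallP => i; rewrite mxE; apply: (forallP (posrvP a)). Qed.

(* (d_n, d_n, d_(n-1), d_(n-1), ..., d_1, d_1): the entry of 0-based index i is
   the one of a of 0-based index n - 1 - i./2. *)
Definition ext_sympl_eigvals (R : realType) (n : nat) (A : posdefmx R (n + n)) :
    posrv R (n + n) :=
  PosRv (ext_sympl_subproof (sympl_eigvals A)).

(* a and b are required to be arranged in decreasing order. *)
Definition log_majorized (R : realType) (n : nat) (a b : posrv R n) : Prop :=
  [/\ rv_nonincreasing a,
      rv_nonincreasing b,
      forall k : nat, (1 <= k <= n)%N ->
        \prod_(i < n | (i < k)%N) a 0 i <= \prod_(i < n | (i < k)%N) b 0 i &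
      \prod_(i < n) a 0 i = \prod_(i < n) b 0 i].

(* Main.v *)
(* Write A = N^T N. The eigenvalues of A are the singular values of N N^T, and its
   extended symplectic eigenvalues are those of N J N^T; so let E be I or J, put
   K = N E N^T, and let f_k(A) be the logarithm of the product of the k largest
   singular values of K, the maximum of |det (U^T K V)| over orthonormal k-frames.
   If B = N^T C N then f_k(B) is computed from C^(1/2) K C^(1/2), and
   submultiplicativity of the maximum gives |f_k(B) - f_k(A)| <= k dist(A, B), hence
   the Lipschitz property.

   The map t |-> f_k(N^T C^t N) is midpoint convex because (X^T X)(t) for
   X(t) = C^(t/2) K C^(t/2) is similar to K^T X(2t). Its derivative at 0 bounds
   f_k(N^T C N) - f_k(N^T N) from below by a combination of terms u^T (log C) u with
   unit vectors u that depend on K alone. When Z = N^T N is the barycenter, the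
   minimality of Z makes the integral of u^T (log C) u vanish, so integrating gives
   f_k(Z) <= int f_k, which is the majorization. For k = n the subgradient inequality
   is the identity log det C = tr (log C), and equality holds.

   Barycenters exist by coercivity and compactness. *)
Require Import Defs.
From mathcomp Require Import all_boot all_order all_algebra fingroup perm.
From mathcomp Require Import all_classical all_reals all_analysis.
From mathcomp Require Import complex measurable_realfun.
From mathcomp Require Import ring lra.
Set Implicit Arguments.
Unset Strict Implicit.
Unset Printing Implicit Defensive.
Import Order.TTheory GRing.Theory Num.Theory.
Import numFieldNormedType.Exports.
Local Open Scope classical_set_scope.
Local Open Scope ring_scope.

(** * Spectral theorem for real symmetric matrices *)

(** Minimality of the barycenter is used without differentiating the squared distance. The point Z =
    N^T N is moved to N^T (1 + s u u^T)^-2 N, and along this family an upper bound dist(Z_s, A)^2 <=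
    dist(Z, A)^2 + 4 s u^T (log C) u + O(s^2) suffices: integrated against the probability, it gives
    the first-order term a sign. Rank-one directions are enough, because the subgradient of f_k is a
    sum of terms u^T (log C) u over the columns of two optimal frames. Positive s yields the
    inequality for each k, negative s the reverse one for k = n.

    The Lipschitz estimate for singular values serves twice. With E = I it also bounds |dist(A, C) -
    dist(B, C)| by a multiple of dist(A, B), since after a congruence C is the identity and the
    distance to it depends on eigenvalues alone. Measurability, integrability, coercivity and
    continuity all rest on that bound. *)

Lemma mxDE (V : nmodType) (m n : nat) (A B : 'M[V]_(m, n)) i j :
  (A + B) i j = A i j + B i j.
Proof. by rewrite mxE. Qed.

Lemma mxBE (V : zmodType) (m n : nat) (A B : 'M[V]_(m, n)) i j :
  (A - B) i j = A i j - B i j.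
Proof. by rewrite !mxE. Qed.

Lemma mxZE (R : pzRingType) (m n : nat) (a : R) (A : 'M[R]_(m, n)) i j :
  (a *: A) i j = a * A i j.
Proof. by rewrite mxE. Qed.

Lemma mx00_tr (R : pzRingType) (M : 'M[R]_1) : M 0 0 = M^T 0 0.
Proof. by rewrite mxE. Qed.

Lemma rv_sqnorm_ge0 (R : realDomainType) (n : nat) (u : 'rV[R]_n) :
  0 <= (u *m u^T) 0 0.
Proof. by rewrite mxE sumr_ge0// => i _; rewrite mxE -expr2 sqr_ge0. Qed.

Lemma rv_sqnorm_gt0 (R : realDomainType) (n : nat) (u : 'rV[R]_n) :
  u != 0 -> 0 < (u *m u^T) 0 0.
Proof.
move=> u0; rewrite lt_neqAle rv_sqnorm_ge0 andbT; apply: contra u0 => /eqP/esym.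
rewrite mxE => /psumr_eq0P h; apply/eqP/rowP => i; rewrite [RHS]mxE.
apply/eqP; rewrite -sqrf_eq0 expr2; move: (h) => /(_ _ i isT); rewrite mxE => -> //.
by move=> k _; rewrite mxE -expr2 sqr_ge0.
Qed.

(** The characteristic polynomial has a root a + ib over the complex extension, with eigenvector x +
    iy. Symmetry gives x A y^T = y A x^T, that is b (|x|^2 + |y|^2) = 0, so b = 0 and a nonzero one
    of x, y is a real eigenvector. *)
Lemma sym_eigenpair (R : rcfType) (n : nat) (A : 'M[R]_n.+1) :
  A^T = A -> exists (a : R) (u : 'rV[R]_n.+1), u != 0 /\ u *m A = a *: u.
Proof.
move=> sA.
have /closed_rootP [z] : size (char_poly (map_mx (real_complex R) A)) != 1.
  by rewrite size_char_poly.
rewrite -eigenvalue_root_char => /eigenvalueP[v vA v0].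
pose x : 'rV[R]_n.+1 := map_mx (@complex.Re R) v.
pose y : 'rV[R]_n.+1 := map_mx (@complex.Im R) v.
case: z vA => a b vA.
have xA : x *m A = a *: x - b *: y.
  apply/rowP => j; have /rowP/(_ j) := vA; rewrite !mxE => /(congr1 (@complex.Re R)).
  rewrite (raddf_sum (@complex.Re R : {additive _ -> _})) /=.
  case: (v 0 j) => p q /= <-; apply: eq_bigr => k _.
  by rewrite !mxE; case: (v 0 k) => ? ? /=; rewrite mulr0 subr0.
have yA : y *m A = b *: x + a *: y.
  apply/rowP => j; have /rowP/(_ j) := vA; rewrite !mxE => /(congr1 (@complex.Im R)).
  rewrite (raddf_sum (@complex.Im R : {additive _ -> _})) /=.
  case: (v 0 j) => p q /=; rewrite [b * p + _]addrC => <-; apply: eq_bigr => k _.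
  by rewrite !mxE; case: (v 0 k) => ? ? /=; rewrite mulr0 add0r.
have xy0 : (x != 0) || (y != 0).
  apply: contraT; rewrite negb_or !negbK => /andP[/eqP x0 /eqP y0].
  case/eqP: v0; apply/rowP => j; have /rowP/(_ j) := x0; have /rowP/(_ j) := y0.
  by rewrite !mxE; case: (v 0 j) => ? ? /= -> ->.
have b0 : b = 0.
  have : (x *m A *m y^T) 0 0 = (y *m A *m x^T) 0 0.
    by rewrite mx00_tr !trmx_mul trmxK sA mulmxA.
  rewrite xA yA mulmxBl [in RHS]mulmxDl -!scalemxAl.
  have yx : (y *m x^T) 0 0 = (x *m y^T) 0 0 by rewrite mx00_tr trmx_mul trmxK.
  rewrite mxBE mxDE !mxZE yx => h.
  have {}h : b * ((x *m x^T) 0 0 + (y *m y^T) 0 0) = 0 by lra.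
  move/eqP: h; rewrite mulf_eq0 => /orP[/eqP//|].
  have := rv_sqnorm_ge0 x; have := rv_sqnorm_ge0 y.
  by case/orP: xy0 => /rv_sqnorm_gt0; lra.
case/orP: xy0 => ?; exists a; [exists x | exists y]; split=> //.
  by rewrite xA b0 scale0r subr0.
by rewrite yA b0 scale0r add0r.
Qed.

Lemma unit_rv_orthogonal_ext (R : rcfType) (n : nat) (u : 'rV[R]_n.+1) :
  u *m u^T = 1%:M ->
  exists2 U : 'M[R]_n.+1, U *m U^T = 1%:M & row 0 U = u.
Proof.
move=> uu; pose e : 'rV[R]_n.+1 := delta_mx 0 0.
have ee : e *m e^T = 1%:M.
  by apply/matrixP => i j; rewrite /e trmx_delta mul_delta_mx !ord1 !mxE.
have [ue|ne] := eqVneq u e.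
  by exists 1%:M; rewrite ?trmx1 ?mulmx1// row1 ue.
pose v := e - u; pose s := (v *m v^T) 0 0.
have s0 : 0 < s by apply: rv_sqnorm_gt0; rewrite subr_eq0 eq_sym.
have vv : v *m v^T = s%:M.
  by apply/matrixP => i j; rewrite !ord1 [RHS]mxE.
(* The reflection in the hyperplane orthogonal to e - u exchanges e and u. The case u = e was split
   off because e - u would vanish. *)
pose H := 1%:M - (2 / s) *: (v^T *m v).
have HT : H^T = H by rewrite /H linearB /= trmx1 linearZ /= trmx_mul trmxK.
have HH : H *m H = 1%:M.
  rewrite /H mulmxBl mul1mx [((_ *: _) *m (_ - _))]mulmxBr mulmx1 -scalemxAl -scalemxAr.
  rewrite -mulmxA [v *m (_ *m _)]mulmxA vv mul_scalar_mx -scalemxAr !scalerA.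
  have -> : 2 / s * (2 / s * s) = 2 * (2 / s) by field; rewrite gt_eqF.
  rewrite mulr_natl mulr2n scalerDl; apply/matrixP => i j; rewrite !mxE; lra.
exists H; first by rewrite HT.
have eu : (u *m e^T) 0 0 = (e *m u^T) 0 0.
  by rewrite mx00_tr trmx_mul trmxK.
have sE : s = 2 * (1 - (e *m u^T) 0 0).
  rewrite /s /v linearB /= mulmxBl !mulmxBr uu ee.
  by rewrite !mxBE eu [(1%:M) 0 0]mxE eqxx /=; lra.
have ev : e *m v^T = (s / 2)%:M.
  rewrite /v linearB /= mulmxBr ee; apply/matrixP => i j; rewrite !ord1.
  by rewrite sE mxBE !mxE eqxx /=; lra.
have -> : row 0 H = e *m H.
  by rewrite rowE.
rewrite /H mulmxBr mulmx1 -scalemxAr mulmxA ev mul_scalar_mx scalerA.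
have -> : 2 / s * (s / 2) = 1 by field; rewrite gt_eqF.
by rewrite scale1r /v opprB addrC subrK.
Qed.

(* A unit eigenvector is completed to an orthogonal basis by a Householder
   reflection, which splits off a 1x1 block. *)
Lemma sym_spectral (R : rcfType) (n : nat) (A : 'M[R]_n) :
  A^T = A -> exists (U : 'M[R]_n) (d : 'rV[R]_n),
    U *m U^T = 1%:M /\ A = U *m diag_mx d *m U^T.
Proof.
elim: n A => [|n IH] A sA.
  by exists 1%:M, 0; split; apply/matrixP => -[].
have [a [w [w0 wA]]] := sym_eigenpair sA.
pose t := Num.sqrt ((w *m w^T) 0 0).
have t0 : 0 < t by rewrite sqrtr_gt0 rv_sqnorm_gt0.
pose u := t^-1 *: w.
have uA : u *m A = a *: u by rewrite /u -scalemxAl wA !scalerA mulrC.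
have uu : u *m u^T = 1%:M.
  rewrite /u linearZ /= -scalemxAl -scalemxAr scalerA; apply/matrixP => i j.
  rewrite !ord1 [LHS]mxE [RHS]mxE -expr2 exprVn sqr_sqrtr ?rv_sqnorm_ge0//.
  by rewrite mulVf// gt_eqF// rv_sqnorm_gt0.
have [H HH Hu] := unit_rv_orthogonal_ext uu.
have [B BH] : exists B : 'M[R]_(1 + n), B = H *m A *m H^T by exists (H *m A *m H^T).
have sB : B^T = B by rewrite BH !trmx_mul trmxK sA mulmxA.
have rB : row 0 B = a *: delta_mx 0 0.
  have HuE : delta_mx 0 0 *m H = u by rewrite -rowE.
  by rewrite rowE BH !mulmxA HuE uA -scalemxAl -HuE -mulmxA HH mulmx1.
have B0 j : B 0 j = a * (j == 0)%:R.
  by have /rowP/(_ j) := rB; rewrite !mxE eqxx /=.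
have [V [d [VV dE]]] := IH (drsubmx B) ltac:(by rewrite trmx_drsub sB).
have BE : B = block_mx a%:M 0 0 (drsubmx B).
  rewrite -[LHS]submxK; congr block_mx.
  - apply/matrixP => i j; rewrite !ord1 !mxE.
    have -> : lshift n (0 : 'I_1) = 0 :> 'I_n.+1 by exact: val_inj.
    by rewrite B0 eqxx mulr1.
  - apply/matrixP => i j; rewrite !ord1 !mxE.
    have -> : lshift n (0 : 'I_1) = 0 :> 'I_n.+1 by exact: val_inj.
    by rewrite B0 mulr0.
  - apply/matrixP => i j; rewrite -sB !ord1 !mxE.
    have -> : lshift n (0 : 'I_1) = 0 :> 'I_n.+1 by exact: val_inj.
    by rewrite B0 mulr0.
pose W : 'M[R]_(1 + n) := block_mx 1%:M 0 0 V.
have WW : W *m W^T = 1%:M.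
  by rewrite /W tr_block_mx mulmx_block !trmx0 !mulmx0 !mul0mx !addr0 !add0r VV trmx1 mulmx1 -scalar_mx_block.
exists (H^T *m W), (row_mx a%:M d); split.
  by rewrite trmx_mul trmxK mulmxA -[_ *m W *m _]mulmxA WW mulmx1 mulmx1C.
have -> : diag_mx (row_mx a%:M d) = block_mx (a%:M : 'M[R]_1) 0 0 (diag_mx d).
  rewrite diag_mx_row; congr block_mx.
  by apply/matrixP => i j; rewrite !ord1 !mxE.
have -> : A = H^T *m B *m H.
  by rewrite BH !mulmxA (mulmx1C HH) mul1mx -mulmxA (mulmx1C HH) mulmx1.
have -> : B = W *m block_mx (a%:M : 'M[R]_1) 0 0 (diag_mx d) *m W^T.
  rewrite [LHS]BE /W tr_block_mx !mulmx_block !trmx0 !mulmx0 !mul0mx !addr0 !add0r.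
  by rewrite trmx1 mul1mx mulmx1 !mul0mx -dE.
by rewrite trmx_mul trmxK !mulmxA.
Qed.

(** * Functional calculus and the Riemannian distance *)

Lemma rv_sort (R : realDomainType) (n : nat) (d : 'rV[R]_n) :
  exists s : 'S_n, forall i j : 'I_n, (i <= j)%N -> d 0 (s j) <= d 0 (s i).
Proof.
pose r := fun i j : 'I_n => d 0 j <= d 0 i.
have rT : total r by move=> i j; rewrite /r orbC le_total.
have rR : transitive r by move=> j i k; rewrite /r => ij jk; exact: le_trans jk ij.
have rr : reflexive r by move=> i; exact: lexx.
pose t := sort_tuple r (ord_tuple n).
have ut : uniq t by rewrite sort_uniq val_ord_tuple enum_uniq.
have it : injective (tnth t) by apply/tuple_uniqP.
exists (perm it) => i j ij; rewrite !permE.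
have st : sorted r t by apply: sort_sorted.
rewrite !(tnth_nth i).
by apply: (sorted_leq_nth rR rr i st) => //; rewrite inE size_tuple.
Qed.

Lemma orthogonal_row_perm (R : realType) (n : nat) (U : 'M[R]_n) (s : 'S_n) :
  U *m U^T = 1%:M -> col_perm s U *m (col_perm s U)^T = 1%:M.
Proof.
move=> UU; rewrite col_permE trmx_mul -mulmxA [_ *m (_ *m U^T)]mulmxA.
by rewrite tr_perm_mx -perm_mxM mulgV perm_mx1 mul1mx.
Qed.

Lemma diag_col_perm (R : realType) (n : nat) (U : 'M[R]_n) (d : 'rV[R]_n) (s : 'S_n) :
  col_perm s U *m diag_mx (\row_i d 0 (s i)) *m (col_perm s U)^T =
  U *m diag_mx d *m U^T.
Proof.
apply/matrixP => i j; rewrite !mul_mx_diag !mxE.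
rewrite [RHS](reindex_inj (@perm_inj _ s)); apply: eq_bigr => k _.
by rewrite !mxE.
Qed.

Lemma sym_spectral_sorted (R : realType) (n : nat) (A : 'M[R]_n) :
  A^T = A -> exists (U : 'M[R]_n) (d : 'rV[R]_n),
    [/\ U *m U^T = 1%:M, A = U *m diag_mx d *m U^T & rv_nonincreasing d].
Proof.
move=> /sym_spectral[U [d [UU AE]]]; have [s hs] := rv_sort d.
exists (col_perm s U), (\row_i d 0 (s i)); split.
- exact: orthogonal_row_perm.
- by rewrite diag_col_perm.
- by move=> i j /hs; rewrite !mxE.
Qed.

Lemma posdef_sym (R : realType) (n : nat) (A : 'M[R]_n) : is_posdef A -> A^T = A.
Proof. by case/andP => /eqP. Qed.

Lemma posdefP (R : realType) (n : nat) (A : 'M[R]_n) :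
  is_posdef A <-> A^T = A /\ forall v : 'cV[R]_n, v != 0 -> 0 < (v^T *m A *m v) 0 0.
Proof.
split; first by case/andP => /eqP sA /asboolP.
by move=> [sA pA]; apply/andP; split; [apply/eqP | apply/asboolP].
Qed.

Lemma posdef_congr (R : realType) (n : nat) (A N : 'M[R]_n) :
  N \in unitmx -> is_posdef A -> is_posdef (N^T *m A *m N).
Proof.
move=> uN /posdefP[sA pA]; apply/posdefP; split.
  by rewrite !trmx_mul trmxK sA mulmxA.
move=> v v0; have -> : v^T *m (N^T *m A *m N) *m v = (N *m v)^T *m A *m (N *m v).
  by rewrite trmx_mul !mulmxA.
apply: pA; apply: contra v0 => /eqP h.
by rewrite -[v](mulKmx uN) h mulmx0.
Qed.

Lemma posdef_diag (R : realType) (n : nat) (d : 'rV[R]_n) :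
  (forall i, 0 < d 0 i) -> is_posdef (diag_mx d).
Proof.
move=> d0; apply/posdefP; split; first exact: tr_diag_mx.
move=> v v0; rewrite mul_mx_diag mxE.
have [k vk] : exists k, v k 0 != 0.
  apply/existsP; apply: contraT; rewrite negb_exists => /forallP h.
  case/eqP: v0; apply/colP => k; rewrite [RHS]mxE; apply/eqP; rewrite -[_ == _]negbK; exact: h.
have t_ge0 i : 0 <= d 0 i * v i 0 ^+ 2 by rewrite mulr_ge0 ?sqr_ge0// ltW.
rewrite (eq_bigr (fun i => d 0 i * v i 0 ^+ 2)); last first.
  by move=> i _; rewrite !mxE; ring.
rewrite (bigD1 k)//= ltr_pwDl//; last by apply: sumr_ge0.
by rewrite mulr_gt0// lt_neqAle sqr_ge0 eq_sym sqrf_eq0 vk.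
Qed.

Lemma orthogonal_unit (R : comUnitRingType) (n : nat) (U : 'M[R]_n) :
  U *m U^T = 1%:M -> U \in unitmx.
Proof. by case/mulmx1_unit. Qed.

Lemma posdef_spectral (R : realType) (n : nat) (A : 'M[R]_n) :
  is_posdef A -> exists (U : 'M[R]_n) (d : 'rV[R]_n),
    [/\ U *m U^T = 1%:M, A = U *m diag_mx d *m U^T, rv_nonincreasing d &
        forall i, 0 < d 0 i].
Proof.
move=> pA; have [U [d [UU AE sd]]] := sym_spectral_sorted (posdef_sym pA).
exists U, d; split=> // i; have /posdefP[_ pos] := pA.
have -> : d 0 i = ((col i U)^T *m A *m col i U) 0 0.
  have -> : ((col i U)^T *m A *m col i U) 0 0 = (U^T *m A *m U) i i.
    by rewrite tr_col -row_mul !mxE; apply: eq_bigr => k _; rewrite !mxE.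
  rewrite AE !mulmxA (mulmx1C UU) mul1mx -mulmxA (mulmx1C UU) mulmx1.
  by rewrite !mxE eqxx mulr1n.
apply: pos; apply: contraTneq isT => ui0.
have : ((col i U)^T *m col i U) 0 0 = 1.
  have /matrixP/(_ i i) := mulmx1C UU; rewrite !mxE eqxx mulr1n => <-.
  by apply: eq_bigr => k _; rewrite !mxE.
by rewrite ui0 mulmx0 mxE => /eqP; rewrite eq_sym oner_eq0.
Qed.

(** For two diagonalizations with eigenvalues d and e, the matrix W = V^T U intertwines diag d and
    diag e. Hence W i j can be nonzero only if d_j = e_i, and then W also intertwines f(d) and
    f(e). *)
Lemma mxfunE (R : realType) (n : nat) (f : R -> R) (U : 'M[R]_n) (d : 'rV[R]_n) :
  U *m U^T = 1%:M ->
  mxfun f (U *m diag_mx d *m U^T) = U *m diag_mx (map_mx f d) *m U^T.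
Proof.
move=> UU; rewrite /mxfun; case: xgetP => [B _ [V [e [VV AE ->]]]|]; last first.
  by move/(_ (U *m diag_mx (map_mx f d) *m U^T)) => h; exfalso; apply: h; exists U, d.
have [W WE] : exists W, W = V^T *m U by exists (V^T *m U).
have Wde : W *m diag_mx d = diag_mx e *m W.
  have := congr1 (fun X => V^T *m X *m U) AE.
  by rewrite !mulmxA (mulmx1C VV) mul1mx -!mulmxA (mulmx1C UU) mulmx1 WE !mulmxA.
have Wf : W *m diag_mx (map_mx f d) = diag_mx (map_mx f e) *m W.
  apply/matrixP => i j; have /matrixP/(_ i j) := Wde.
  rewrite !mul_mx_diag !mul_diag_mx !mxE => h.
  have [->|w0] := eqVneq (W i j) 0; first by rewrite mul0r mulr0.
  have -> : d 0 j = e 0 i by apply: (mulfI w0); rewrite [RHS]mulrC.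
  by rewrite mulrC.
have := congr1 (fun X => V *m X *m U^T) Wf.
by rewrite WE !mulmxA VV mul1mx -!mulmxA UU mulmx1 => <-.
Qed.

Lemma diag_mxM (R : pzRingType) (n : nat) (d e : 'rV[R]_n) :
  diag_mx d *m diag_mx e = diag_mx (\row_i (d 0 i * e 0 i)).
Proof.
apply/matrixP => i j; rewrite mul_diag_mx !mxE.
by have [->|] := eqVneq; rewrite ?mulr1n// !mulr0n mulr0.
Qed.

Lemma diag_const1 (R : pzRingType) (n : nat) (d : 'rV[R]_n) :
  (forall i, d 0 i = 1) -> diag_mx d = 1%:M.
Proof. by move=> d1; apply/matrixP => i j; rewrite !mxE d1. Qed.

Lemma invsqrtmx_sym (R : realType) (n : nat) (A : 'M[R]_n) :
  is_posdef A -> (invsqrtmx A)^T = invsqrtmx A.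
Proof.
move=> /posdef_spectral[U [d [UU -> _ _]]]; rewrite /invsqrtmx mxfunE//.
by rewrite !trmx_mul trmxK tr_diag_mx mulmxA.
Qed.

Lemma invsqrtmxK (R : realType) (n : nat) (A : 'M[R]_n) :
  is_posdef A -> invsqrtmx A *m A *m invsqrtmx A = 1%:M.
Proof.
move=> /posdef_spectral[U [d [UU -> _ d0]]]; rewrite /invsqrtmx mxfunE//.
set D := diag_mx (map_mx _ d).
have -> : U *m D *m U^T *m (U *m diag_mx d *m U^T) *m (U *m D *m U^T) =
          U *m (D *m diag_mx d *m D) *m U^T.
  rewrite -!mulmxA [U^T *m (U *m _)]mulmxA (mulmx1C UU) mul1mx.
  by rewrite [U^T *m (U *m _)]mulmxA (mulmx1C UU) mul1mx.
rewrite /D !diag_mxM diag_const1 ?mulmx1// => i.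
rewrite !mxE -[X in _ * X * _]sqr_sqrtr ?ltW//; field.
by rewrite gt_eqF// sqrtr_gt0.
Qed.

Definition lnnorm (R : realType) (n : nat) (d : 'rV[R]_n) : R :=
  Num.sqrt (\sum_i ln (d 0 i) ^+ 2).

(** The matrix A^(-1/2) M^T is orthogonal, so A^(-1/2) B A^(-1/2) has eigenvalues d. Distances can
    thus be read off from any congruence that diagonalizes both matrices, without the square root of
    A. *)
Lemma dist_pdE (R : realType) (n : nat) (A B : posdefmx R n) (M : 'M[R]_n) (d : 'rV[R]_n) :
  posdefmx_val A = M^T *m M -> posdefmx_val B = M^T *m diag_mx d *m M ->
  dist_pd A B = lnnorm d.
Proof.
move=> AE BE; pose S := invsqrtmx A.
have [W WE] : exists W, W = S *m M^T by exists (S *m M^T).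
have ST : S^T = S by apply: invsqrtmx_sym; exact: posdefmxP.
have WT : W^T = M *m S by rewrite WE trmx_mul trmxK ST.
have WW : W *m W^T = 1%:M.
  by rewrite WT WE !mulmxA -[S *m _ *m _]mulmxA -AE invsqrtmxK//; exact: posdefmxP.
rewrite /dist_pd -/S BE.
have -> : S *m (M^T *m diag_mx d *m M) *m S = W *m diag_mx d *m W^T.
  by rewrite WT WE !mulmxA.
rewrite /logmx mxfunE// /norm2mx /lnnorm; congr Num.sqrt.
set D := diag_mx _; rewrite -!mulmxA [W^T *m (W *m _)]mulmxA (mulmx1C WW) mul1mx.
rewrite mxtrace_mulC -!mulmxA (mulmx1C WW) mulmx1 /D diag_mxM mxtrace_diag.
by apply: eq_bigr => i _; rewrite !mxE.
Qed.

Lemma posdef_factor (R : realType) (n : nat) (A : 'M[R]_n) :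
  is_posdef A -> exists2 N : 'M[R]_n, N \in unitmx & A = N^T *m N.
Proof.
move=> /posdef_spectral[U [d [UU AE _ d0]]].
exists (diag_mx (map_mx Num.sqrt d) *m U^T).
  rewrite unitmx_mul unitmx_tr (orthogonal_unit UU) andbT unitmxE det_diag unitfE.
  by apply/prodf_neq0 => i _; rewrite mxE gt_eqF// sqrtr_gt0.
rewrite trmx_mul trmxK tr_diag_mx -mulmxA [diag_mx _ *m (_ *m _)]mulmxA diag_mxM mulmxA AE.
congr (_ *m diag_mx _ *m _); apply/rowP => i.
by rewrite !mxE -expr2 sqr_sqrtr// ltW.
Qed.

Lemma posdef_gram (R : realType) (n : nat) (N : 'M[R]_n) :
  N \in unitmx -> is_posdef (N^T *m N).
Proof.
by move=> uN; rewrite -[N^T]mulmx1; apply: posdef_congr => //; exact: is_posdef1.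
Qed.

Lemma posdef_simdiag (R : realType) (n : nat) (B N : 'M[R]_n) :
  N \in unitmx -> is_posdef B ->
  exists (U : 'M[R]_n) (d : 'rV[R]_n), [/\ U *m U^T = 1%:M, forall i, 0 < d 0 i &
    B = N^T *m (U *m diag_mx d *m U^T) *m N].
Proof.
move=> uN pB; have uiN : invmx N \in unitmx by rewrite unitmx_inv.
have [U [d [UU CE _ d0]]] := posdef_spectral (posdef_congr uiN pB).
exists U, d; split=> //; rewrite -CE !mulmxA -trmx_mul mulVmx// trmx1 mul1mx.
by rewrite -mulmxA mulVmx// mulmx1.
Qed.

(** * Products of the largest singular values *)

Lemma det_mulmx_ffun (R : comPzRingType) (k n : nat) (A : 'M[R]_(k, n)) (B : 'M[R]_(n, k)) :
  \det (A *m B) =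
  \sum_(f : {ffun 'I_k -> 'I_n}) (\prod_i A i (f i)) * \det (rowsub f B).
Proof.
rewrite /determinant.
under eq_bigr => s _.
  under eq_bigr => i _ do rewrite mxE.
  rewrite bigA_distr_bigA big_distrr /=.
  over.
rewrite exchange_big /=; apply: eq_bigr => f _; rewrite big_distrr /=.
apply: eq_bigr => s _; rewrite big_split /= mulrCA; congr (_ * (_ * _)).
by apply: eq_bigr => i _; rewrite mxE.
Qed.

(** Summing over all maps instead of k-subsets avoids ordering the subsets: non-injective maps
    contribute 0 and each subset is met k! times. In the proof each permutation in the expansion of
    the first determinant contributes one copy of det (A B), after reindexing f by it. *)
Lemma Cauchy_Binet_ffun (R : comPzRingType) (k n : nat) (A : 'M[R]_(k, n)) (B : 'M[R]_(n, k)) :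
  \sum_(f : {ffun 'I_k -> 'I_n}) \det (colsub f A) * \det (rowsub f B) =
  \det (A *m B) *+ k`!.
Proof.
transitivity (\sum_(s : 'S_k) \det (A *m B)); last first.
  by rewrite sumr_const card_Sn.
transitivity (\sum_(s : 'S_k) \sum_(f : {ffun 'I_k -> 'I_n})
    (-1) ^+ s * (\prod_i A i (f (s i))) * \det (rowsub f B)).
  rewrite exchange_big /=; apply: eq_bigr => f _; rewrite /determinant big_distrl /=.
  by apply: eq_bigr => s _; congr (_ * _ * _); apply: eq_bigr => i _; rewrite mxE.
apply: eq_bigr => s _; rewrite det_mulmx_ffun.
pose h (t : 'S_k) (f : {ffun 'I_k -> 'I_n}) : {ffun 'I_k -> 'I_n} := [ffun i => f (t i)].
have hK : cancel (h s^-1%g) (h s).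
  by move=> f; apply/ffunP => i; rewrite !ffunE permK.
have hK' : cancel (h s) (h s^-1%g).
  by move=> f; apply/ffunP => i; rewrite !ffunE permKV.
rewrite (reindex_inj (can_inj hK)); apply: eq_bigr => f _.
have -> : rowsub (h s^-1%g f) B = row_perm s^-1%g (rowsub f B).
  by apply/matrixP => i j; rewrite !mxE ffunE.
rewrite row_permE det_mulmx det_perm odd_permV.
have -> : \prod_i A i (h s^-1%g f (s i)) = \prod_i A i (f i).
  by apply: eq_bigr => i _; rewrite ffunE permK.
by rewrite mulrACA -signr_addb addbb mul1r.
Qed.

Definition topprod (R : realType) (n k : nat) (d : 'rV[R]_n) : R :=
  \prod_(i < n | (i < k)%N) d 0 i.

Lemma topprod_gt0 (R : realType) (n k : nat) (d : 'rV[R]_n) :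
  (forall i, 0 < d 0 i) -> 0 < topprod k d.
Proof. by move=> d0; apply: prodr_gt0. Qed.

Lemma topprodS (R : realType) (n k : nat) (d : 'rV[R]_n) (kn : (k < n)%N) :
  topprod k.+1 d = topprod k d * d 0 (Ordinal kn).
Proof.
rewrite /topprod (bigD1 (Ordinal kn))//= mulrC; congr (_ * _).
apply: eq_bigl => i; rewrite ltnS andbC -val_eqE /=.
by rewrite [RHS]ltn_neqAle.
Qed.

Lemma topprod_widen (R : realType) (n k : nat) (d : 'rV[R]_n) (kn : (k <= n)%N) :
  topprod k d = \prod_(i < k) d 0 (widen_ord kn i).
Proof. by rewrite /topprod (big_ord_narrow kn). Qed.

Lemma prod_inj_le_topprod (R : realType) (n k : nat) (d : 'rV[R]_n) (f : 'I_k -> 'I_n) :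
  rv_nonincreasing d -> (forall i, 0 < d 0 i) -> injective f ->
  \prod_i d 0 (f i) <= topprod k d.
Proof.
move=> sd d0; elim: k f => [|k IH] f injf.
  by rewrite big_ord0 /topprod big_pred0.
have kn : (k < n)%N by have := leq_card f injf; rewrite !card_ord.
(* Pigeonhole: k + 1 distinct values cannot all be below k. The factor at [i0] is at most the entry
   of index k, and the remaining k factors fall under the induction hypothesis. *)
have [i0 hi0] : exists i0, (k <= f i0)%N.
  apply/existsP; apply: contraT; rewrite negb_exists => /forallP h.
  have fk i : (f i < k)%N by rewrite ltnNge.
  have : injective (fun i => Ordinal (fk i)).
    by move=> i j /(congr1 val)/= /val_inj/injf.
  by move/leq_card; rewrite !card_ord ltnn.
rewrite (bigD1_ord i0)//= (topprodS _ kn) mulrC ler_pM//.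
- by apply: prodr_ge0 => i _; exact: ltW.
- exact: ltW.
- by apply: IH => i j /injf/lift_inj.
- exact: sd.
Qed.

Definition frame (R : realType) (n k : nat) (U : 'M[R]_(n, k)) : Prop :=
  U^T *m U = 1%:M.

(* Cauchy-Binet and [2 x y <= x^2 + y^2] for the minors of [U] and [V], whose
   squares sum to [k!]. *)
Lemma det_frame_diag (R : realType) (n k : nat) (d : 'rV[R]_n) (U V : 'M[R]_(n, k)) :
  rv_nonincreasing d -> (forall i, 0 < d 0 i) -> frame U -> frame V ->
  `|\det (U^T *m diag_mx d *m V)| <= topprod k d.
Proof.
move=> sd d0 fU fV.
have sumsq W : frame W ->
    \sum_(f : {ffun 'I_k -> 'I_n}) \det (rowsub f W) ^+ 2 = (k`!%:R : R).
  move=> fW; have := Cauchy_Binet_ffun W^T W; rewrite fW det1 => <-.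
  by apply: eq_bigr => f _; rewrite expr2 -[X in X * _]det_tr trmx_mxsub.
have fact0 : 0 < (k`!%:R : R) by rewrite ltr0n fact_gt0.
rewrite -(@ler_pM2r _ _ fact0) -{1}[k`!%:R](ger0_norm (ltW fact0)) -normrM mulr_natr -Cauchy_Binet_ffun.
apply: le_trans (ler_norm_sum _ _ _) _.
have -> : topprod k d * k`!%:R = \sum_(f : {ffun 'I_k -> 'I_n})
    topprod k d * ((\det (rowsub f U) ^+ 2 + \det (rowsub f V) ^+ 2) / 2).
  by rewrite -big_distrr -big_distrl big_split /= !sumsq//; field.
apply: ler_sum => f _.
have -> : \det (colsub f (U^T *m diag_mx d)) = \det (rowsub f U) * \prod_i d 0 (f i).
  have -> : colsub f (U^T *m diag_mx d) = (rowsub f U)^T *m diag_mx (\row_i d 0 (f i)).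
    by apply/matrixP => i j; rewrite mul_mx_diag mxE mul_mx_diag !mxE.
  by rewrite det_mulmx det_tr det_diag; congr (_ * _); apply: eq_bigr => i _; rewrite mxE.
have [/injectiveP injf|/injectivePn[i [j ij fij]]] := boolP (injectiveb f); last first.
  rewrite [X in _ * X](determinant_alternate ij); last first.
    by move=> l; rewrite !mxE fij.
  rewrite mulr0 normr0; apply: mulr_ge0; first exact/ltW/topprod_gt0.
  by rewrite divr_ge0// addr_ge0 ?sqr_ge0.
rewrite normrM [in leLHS]normrM mulrAC mulrC ler_pM ?mulr_ge0//.
  rewrite ger0_norm; first exact: prod_inj_le_topprod.
  by apply: prodr_ge0 => i _; exact: ltW.
rewrite -[\det (rowsub f U) ^+ 2]real_normK ?num_real//.
rewrite -[\det (rowsub f V) ^+ 2]real_normK ?num_real//.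
have := sqr_ge0 (`|\det (rowsub f U)| - `|\det (rowsub f V)|); rewrite sqrrB; lra.
Qed.

Lemma frame_mul (R : realType) (n k : nat) (Q : 'M[R]_n) (U : 'M[R]_(n, k)) :
  Q *m Q^T = 1%:M -> frame U -> frame (Q *m U).
Proof.
by move=> QQ fU; rewrite /frame trmx_mul -mulmxA [Q^T *m (_ *m _)]mulmxA (mulmx1C QQ) mul1mx.
Qed.

Definition svd (R : realType) (n : nat) (X : 'M[R]_n) (d : 'rV[R]_n) : Prop :=
  [/\ rv_nonincreasing d, forall i, 0 < d 0 i &
    exists Q1 Q2 : 'M[R]_n, [/\ Q1 *m Q1^T = 1%:M, Q2 *m Q2^T = 1%:M &
      X = Q1 *m diag_mx d *m Q2]].

Lemma posdef_unit (R : realType) (n : nat) (A : 'M[R]_n) : is_posdef A -> A \in unitmx.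
Proof. by case/posdef_factor => N uN ->; rewrite unitmx_mul unitmx_tr uN. Qed.

Lemma diag_unit (R : realType) (n : nat) (d : 'rV[R]_n) :
  (forall i, 0 < d 0 i) -> diag_mx d \in unitmx.
Proof. by move=> d0; apply: posdef_unit; exact: posdef_diag. Qed.

Lemma svd_unit (R : realType) (n : nat) (X : 'M[R]_n) (d : 'rV[R]_n) :
  svd X d -> X \in unitmx.
Proof.
case=> _ d0 [Q1 [Q2 [h1 h2 ->]]].
by rewrite !unitmx_mul diag_unit ?(orthogonal_unit h1) ?(orthogonal_unit h2).
Qed.

Lemma svd_tr (R : realType) (n : nat) (X : 'M[R]_n) (d : 'rV[R]_n) :
  svd X d -> svd X^T d.
Proof.
case=> sd d0 [Q1 [Q2 [h1 h2 ->]]]; split=> //; exists Q2^T, Q1^T.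
rewrite !trmxK !trmx_mul tr_diag_mx mulmxA.
by split; [exact: mulmx1C | exact: mulmx1C | ].
Qed.

Lemma svd_exists (R : realType) (n : nat) (X : 'M[R]_n) :
  X \in unitmx -> exists d, svd X d.
Proof.
move=> uX; have [U [d [UU XX sd d0]]] := posdef_spectral (posdef_gram uX).
pose s := map_mx Num.sqrt d; pose si := map_mx (fun x : R => (Num.sqrt x)^-1) d.
have sq0 i : 0 < Num.sqrt (d 0 i) by rewrite sqrtr_gt0.
have siS : diag_mx si *m diag_mx s = 1%:M.
  by rewrite diag_mxM diag_const1// => i; rewrite !mxE mulVf// gt_eqF.
exists s; split.
- by move=> i j ij; rewrite !mxE ler_wsqrtr// sd.
- by move=> i; rewrite mxE.
(* The left factor X U s^-1 is orthogonal because U^T X^T X U = diag d = s^2. *)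
exists (X *m U *m diag_mx si), U^T; split; last 2 first.
- by rewrite trmxK; exact: mulmx1C.
- by rewrite -[_ *m diag_mx s]mulmxA siS mulmx1 -mulmxA UU mulmx1.
apply: mulmx1C; rewrite !trmx_mul tr_diag_mx -!mulmxA [X^T *m (_ *m _)]mulmxA XX.
rewrite -!mulmxA [U^T *m (_ *m _)]mulmxA (mulmx1C UU) mul1mx.
rewrite [U^T *m (_ *m _)]mulmxA (mulmx1C UU) mul1mx !diag_mxM diag_const1// => i.
rewrite !mxE -[X in _ * (X * _)](sqr_sqrtr (ltW (d0 i))); field.
by rewrite gt_eqF.
Qed.

Lemma svd_ub (R : realType) (n k : nat) (X : 'M[R]_n) (d : 'rV[R]_n) (U V : 'M[R]_(n, k)) :
  svd X d -> frame U -> frame V -> `|\det (U^T *m X *m V)| <= topprod k d.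
Proof.
case=> sd d0 [Q1 [Q2 [h1 h2 ->]]] fU fV.
have -> : U^T *m (Q1 *m diag_mx d *m Q2) *m V = (Q1^T *m U)^T *m diag_mx d *m (Q2 *m V).
  by rewrite trmx_mul trmxK !mulmxA.
apply: det_frame_diag => //; apply: frame_mul => //.
by rewrite trmxK; exact: mulmx1C.
Qed.

(** The leading k left and right singular vectors attain the bound of [svd_ub]. *)
Lemma svd_frames (R : realType) (n k : nat) (X : 'M[R]_n) (d : 'rV[R]_n) (kn : (k <= n)%N) :
  svd X d -> exists U V : 'M[R]_(n, k), let D := diag_mx (colsub (widen_ord kn) d) in
    [/\ frame U, frame V, X *m V = U *m D, U^T *m X = D *m V^T & \det D = topprod k d].
Proof.
case=> sd d0 [Q1 [Q2 [h1 h2 ->]]].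
pose E : 'M[R]_(n, k) := colsub (widen_ord kn) 1%:M.
have Ei : injective (widen_ord kn) by move=> i j /(congr1 val)/= /val_inj.
have fE : frame E.
  rewrite /frame /E trmx_mxsub trmx1 -mxsub_mul mulmx1.
  by apply/matrixP => i j; rewrite !mxE (inj_eq Ei).
have dE : diag_mx d *m E = E *m diag_mx (colsub (widen_ord kn) d).
  apply/matrixP => i j; rewrite mul_diag_mx mul_mx_diag !mxE.
  by have [->|] := eqVneq i; rewrite ?mulr1 ?mul1r ?mulr0 ?mul0r.
have Ed : E^T *m diag_mx d = diag_mx (colsub (widen_ord kn) d) *m E^T.
  by have := congr1 trmx dE; rewrite !trmx_mul !tr_diag_mx.
exists (Q1 *m E), (Q2^T *m E); split.
- exact: frame_mul.
- by apply: frame_mul => //; rewrite trmxK; exact: mulmx1C.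
- by rewrite -!mulmxA [Q2 *m (_ *m _)]mulmxA h2 mul1mx dE.
- by rewrite !trmx_mul trmxK !mulmxA -[_ *m Q1^T *m Q1]mulmxA (mulmx1C h1) mulmx1 Ed.
- by rewrite det_diag topprod_widen; apply: eq_bigr => i _; rewrite mxE.
Qed.

Lemma frame_inj (R : realType) (n k : nat) (U : 'M[R]_(n, k)) (x : 'cV[R]_k) :
  frame U -> U *m x = 0 -> x = 0.
Proof. by move=> fU Ux; rewrite -[x]mul1mx -fU -mulmxA Ux mulmx0. Qed.

(** A substitute for the QR factorization: write the Gram matrix B^T B as N^T N and take Q = B
    N^-1. *)
Lemma frame_factor (R : realType) (n k : nat) (B : 'M[R]_(n, k)) :
  (forall x : 'cV[R]_k, B *m x = 0 -> x = 0) ->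
  exists (Q : 'M[R]_(n, k)) (T : 'M[R]_k), [/\ frame Q, T \in unitmx & B = Q *m T].
Proof.
move=> injB.
have : is_posdef (B^T *m B).
  apply/posdefP; split; first by rewrite trmx_mul trmxK.
  move=> v v0; have := @rv_sqnorm_gt0 R n (B *m v)^T.
  rewrite trmxK trmx_mul !mulmxA; apply; rewrite -trmx_mul.
  by apply: contra v0 => /eqP h; apply/eqP/injB; rewrite -[LHS]trmxK h trmx0.
case/posdef_factor => N uN BN; exists (B *m invmx N), N; split=> //.
  rewrite /frame trmx_mul -mulmxA [B^T *m (_ *m _)]mulmxA BN -!mulmxA mulmxV// mulmx1.
  by rewrite -trmx_mul mulmxV// trmx1.
by rewrite -mulmxA mulVmx// mulmx1.
Qed.

(** For frames U, V optimal for X Y, orthonormalizing Y V = Q T splits the determinant as det (U^T X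
    Q) det (Q^T Y V), and [svd_ub] bounds each factor. *)
Lemma svd_mul_le (R : realType) (n k : nat) (X Y : 'M[R]_n) (a b c : 'rV[R]_n) :
  (k <= n)%N -> svd X a -> svd Y b -> svd (X *m Y) c ->
  topprod k c <= topprod k a * topprod k b.
Proof.
move=> kn sX sY sXY; have [U [V [fU fV XV UX dD]]] := svd_frames kn sXY.
have [|Q [T [fQ uT YV]]] := @frame_factor R n k (Y *m V).
  move=> x; rewrite -mulmxA => /(congr1 (mulmx (invmx Y))).
  by rewrite mulKmx ?(svd_unit sY)// mulmx0; exact: frame_inj.
have TE : T = Q^T *m Y *m V by rewrite -mulmxA YV mulmxA fQ mul1mx.
have -> : topprod k c = \det (U^T *m X *m Q) * \det T.
  by rewrite -det_mulmx -!mulmxA -YV !mulmxA -[_ *m X *m Y]mulmxA UX -mulmxA fV mulmx1.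
apply: le_trans (ler_norm _) _; rewrite normrM ler_pM//; first exact: svd_ub.
by rewrite TE; exact: svd_ub.
Qed.

(** Weyl's inequality between eigenvalues and singular values, stated for an invariant subspace with
    basis W. In an orthonormal basis Q of it, L becomes similar to Q^T X Q. *)
Lemma svd_eigen_le (R : realType) (n k : nat) (X : 'M[R]_n) (c : 'rV[R]_n)
    (W : 'M[R]_(n, k)) (L : 'M[R]_k) :
  svd X c -> (forall x : 'cV[R]_k, W *m x = 0 -> x = 0) -> X *m W = W *m L ->
  `|\det L| <= topprod k c.
Proof.
move=> sX injW XW; have [Q [T [fQ uT WE]]] := frame_factor injW.
have XQ : Q^T *m X *m Q = T *m L *m invmx T.
  have -> : Q = W *m invmx T by rewrite WE -mulmxA mulmxV// mulmx1.
  rewrite -mulmxA [X *m _]mulmxA XW mulmxA mulmxA; congr (_ *m _ *m _).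
  by rewrite trmx_mul WE trmx_mul -!mulmxA [Q^T *m _]mulmxA fQ mul1mx mulmxA -trmx_mul mulmxV// trmx1 mul1mx.
have -> : \det L = \det (Q^T *m X *m Q).
  by rewrite XQ !det_mulmx mulrAC -det_mulmx mulmxV// det1 mul1r.
exact: svd_ub.
Qed.

(* [S X S^-1 = (S K S)^T (S K S)] for [X = K^T (S S K S S)], so [s^2] is a list
   of eigenvalues of [X]. *)
Lemma svd_midpoint (R : realType) (n k : nat) (K S : 'M[R]_n) (a b s : 'rV[R]_n) :
  (k <= n)%N -> S^T = S -> S \in unitmx -> svd K a ->
  svd (S *m S *m K *m S *m S) b -> svd (S *m K *m S) s ->
  topprod k s ^+ 2 <= topprod k a * topprod k b.
Proof.
move=> kn ST uS sK sB sS.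
have [X XE] : exists X, X = K^T *m (S *m S *m K *m S *m S) by eexists.
have [c sX] : exists c, svd X c.
  by apply: svd_exists; rewrite XE unitmx_mul (svd_unit (svd_tr sK)) (svd_unit sB).
have := sX; rewrite {1}XE => /(svd_mul_le kn (svd_tr sK) sB); apply: le_trans.
have [U [V [fU fV XV UX dD]]] := svd_frames kn sS.
set D := diag_mx _ in XV UX dD.
have -> : topprod k s ^+ 2 = `|\det (D *m D)|.
  by rewrite det_mulmx dD -expr2 ger0_norm// sqr_ge0.
apply: (svd_eigen_le (W := invmx S *m V) sX).
  move=> x; rewrite -mulmxA => /(congr1 (mulmx S)); rewrite mulKVmx// mulmx0.
  exact: frame_inj.
have SX : X *m invmx S = invmx S *m ((S *m K *m S)^T *m (S *m K *m S)).
  by rewrite XE !trmx_mul ST !mulmxA mulVmx// mul1mx -!mulmxA mulmxV// mulmx1.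
rewrite [X *m _]mulmxA SX -[LHS]mulmxA -[(_ *m (S *m K *m S)) *m V]mulmxA XV [_ *m (U *m _)]mulmxA.
have -> : (S *m K *m S)^T *m U = V *m D.
  by have := congr1 trmx UX; rewrite !trmx_mul trmxK tr_diag_mx trmxK.
by rewrite !mulmxA.
Qed.

(** * The subgradient inequality *)

Definition hpow (R : realType) (j : nat) : R := (2^-1) ^+ j.

Lemma hpow_gt0 (R : realType) (j : nat) : 0 < hpow R j.
Proof. by rewrite exprn_gt0. Qed.

Lemma hpow_cvg0 (R : realType) : hpow R @ \oo --> (0 : R).
Proof. by apply: cvg_expr; rewrite ger0_norm ?invr_ge0// invf_lt1 ?ltr1n. Qed.

Lemma hpowS (R : realType) (j : nat) : hpow R j = hpow R j.+1 *+ 2.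
Proof. by rewrite /hpow exprS; field. Qed.

(* [dyad_der f a d]: [f] has value [a] and right derivative [d] at [0] along the
   sequence [2^-j], [f j] standing for the value at [2^-j]. *)
Definition dyad_der (R : realType) (f : nat -> R) (a d : R) : Prop :=
  (fun j => (f j - a) / hpow R j) @ \oo --> d.

Lemma cvg_seq_ext (R : realType) (f g : nat -> R) (l : R) :
  f =1 g -> f @ \oo --> l -> g @ \oo --> l.
Proof. by move=> /funext ->. Qed.

Lemma dyad_der_cvg (R : realType) (f : nat -> R) (a d : R) :
  dyad_der f a d -> f @ \oo --> a.
Proof.
move=> fd; apply/subr_cvg0.
have h : (fun j => (f j - a) / hpow R j * hpow R j) @ \oo --> d * 0.
  by apply: cvgM => //; exact: hpow_cvg0.
rewrite mulr0 in h; apply: cvg_seq_ext h => j.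
by rewrite divfK// gt_eqF// hpow_gt0.
Qed.

Lemma dyad_der_eq (R : realType) (f g : nat -> R) (a b d e : R) :
  f =1 g -> a = b -> d = e -> dyad_der f a d -> dyad_der g b e.
Proof. by move=> /funext -> -> ->. Qed.

Lemma dyad_der_cst (R : realType) (a : R) : dyad_der (fun=> a) a 0.
Proof.
by rewrite /dyad_der; under eq_fun do rewrite subrr mul0r; exact: cvg_cst.
Qed.

Lemma dyad_derD (R : realType) (f g : nat -> R) (a b d e : R) :
  dyad_der f a d -> dyad_der g b e -> dyad_der (fun j => f j + g j) (a + b) (d + e).
Proof.
move=> fd ge; have h : (fun j => (f j - a) / hpow R j + (g j - b) / hpow R j) @ \oo --> d + e.
  exact: cvgD.
by apply: cvg_seq_ext h => j /=; rewrite -mulrDl; congr (_ / _); ring.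
Qed.

Lemma dyad_derM (R : realType) (f g : nat -> R) (a b d e : R) :
  dyad_der f a d -> dyad_der g b e ->
  dyad_der (fun j => f j * g j) (a * b) (d * b + a * e).
Proof.
move=> fd ge; have gb := dyad_der_cvg ge.
have h : (fun j => (f j - a) / hpow R j * g j + a * ((g j - b) / hpow R j)) @ \oo
    --> d * b + a * e by apply: cvgD; apply: cvgM => //; exact: cvg_cst.
apply: cvg_seq_ext h => j /=.
by field; rewrite gt_eqF// hpow_gt0.
Qed.

Lemma dyad_der_sum (R : realType) (I : Type) (r : seq I) (P : pred I)
    (f : I -> nat -> R) (a d : I -> R) :
  (forall i, dyad_der (f i) (a i) (d i)) ->
  dyad_der (fun j => \sum_(i <- r | P i) f i j) (\sum_(i <- r | P i) a i)
    (\sum_(i <- r | P i) d i).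
Proof.
move=> fd; elim: r => [|i r IH].
  apply: dyad_der_eq (dyad_der_cst 0); rewrite ?big_nil//.
  by move=> j; rewrite big_nil.
have [Pi|Pi] := boolP (P i); last first.
  by apply: dyad_der_eq IH; [move=> j|..]; rewrite big_cons (negbTE Pi).
by apply: dyad_der_eq (dyad_derD (fd i) IH); [move=> j|..]; rewrite big_cons Pi.
Qed.

Lemma dyad_der_prod1 (R : realType) (k : nat) (f : 'I_k -> nat -> R) (d : 'I_k -> R) :
  (forall i, dyad_der (f i) 1 (d i)) ->
  dyad_der (fun j => \prod_i f i j) 1 (\sum_i d i).
Proof.
elim: k f d => [|k IH] f d fd.
  by apply: dyad_der_eq (dyad_der_cst 1); [move=> j|..]; rewrite ?big_ord0.
apply: dyad_der_eq (dyad_derM (fd ord0) (IH _ _ (fun i => fd (lift ord0 i)))).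
- by move=> j; rewrite big_ord_recl.
- by rewrite mulr1.
- by rewrite mulr1 mul1r big_ord_recl.
Qed.

Lemma dyad_der_prod_ex (R : realType) (k : nat) (P : pred 'I_k) (f : 'I_k -> nat -> R)
    (a d : 'I_k -> R) :
  (forall i, dyad_der (f i) (a i) (d i)) ->
  exists e, dyad_der (fun j => \prod_(i | P i) f i j) (\prod_(i | P i) a i) e.
Proof.
move=> fd; elim: (index_enum _) => [|i r [e IH]].
  exists 0; apply: dyad_der_eq (dyad_der_cst 1); rewrite ?big_nil//.
  by move=> j; rewrite big_nil.
have [Pi|Pi] := boolP (P i); last first.
  by exists e; apply: dyad_der_eq IH; [move=> j|..]; rewrite ?big_cons ?(negbTE Pi).
exists (d i * \prod_(i <- r | P i) a i + a i * e).
by apply: dyad_der_eq (dyad_derM (fd i) IH); [move=> j|..]; rewrite ?big_cons ?Pi.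
Qed.

Lemma dyad_der_prod0 (R : realType) (k : nat) (f : 'I_k -> nat -> R) (a d : 'I_k -> R)
    (p q : 'I_k) :
  (forall i, dyad_der (f i) (a i) (d i)) -> p != q -> a p = 0 -> a q = 0 ->
  dyad_der (fun j => \prod_i f i j) 0 0.
Proof.
move=> fd pq ap aq.
have [e fe] := dyad_der_prod_ex (fun i => (i != p) && (i != q)) fd.
apply: dyad_der_eq (dyad_derM (fd p) (dyad_derM (fd q) fe)).
- by move=> j; rewrite [RHS](bigD1 p)//= [X in _ = _ * X](bigD1 q) 1?eq_sym.
- by rewrite ap mul0r.
- by rewrite ap aq !mul0r mulr0 addr0.
Qed.

(** Only the identity permutation contributes to first order. Any other one moves some p, hence also
    s p, so its product has two factors that vanish in the limit and its derivative is 0. *)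
Lemma dyad_der_det (R : realType) (k : nat) (Y : nat -> 'M[R]_k) (Y' : 'M[R]_k) :
  (forall i j, dyad_der (fun m => Y m i j) (i == j)%:R (Y' i j)) ->
  dyad_der (fun m => \det (Y m)) 1 (\tr Y').
Proof.
move=> Yd; pose e (s : 'S_k) : R := if s == 1%g then \tr Y' else 0.
have sd (s : 'S_k) : dyad_der (fun m => (-1) ^+ s * \prod_i Y m i (s i)) (s == 1%g)%:R (e s).
  rewrite /e; case: eqVneq => [->|s1].
    apply: dyad_der_eq (dyad_der_prod1 (d := fun i => Y' i i) (f := fun i m => Y m i i) _) => //.
    - move=> m; rewrite odd_perm1 mul1r; apply: eq_bigr => i _; by rewrite perm1.
    - by move=> i; have := Yd i i; rewrite eqxx.
  have [p sp] : exists p, s p != p.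
    apply/existsP; apply: contraT; rewrite negb_exists => /forallP h.
    case/eqP: s1; apply/permP => i; rewrite perm1; apply/eqP; rewrite -[_ == _]negbK; exact: h.
  apply: dyad_der_eq (dyad_derM (dyad_der_cst ((-1) ^+ s)) (dyad_der_prod0
    (p := p) (q := s p) (f := fun i m => Y m i (s i)) (fun i => Yd i (s i)) _ _ _)) => //.
  - by rewrite mulr0.
  - by rewrite !mulr0 addr0.
  - by rewrite eq_sym.
  - by rewrite eq_sym (negbTE sp).
  - by rewrite eq_sym (inj_eq perm_inj) (negbTE sp).
have h := @dyad_der_sum R 'S_k (index_enum _) predT _ _ _ sd.
apply: dyad_der_eq h => //.
- rewrite (bigD1 1%g)//= eqxx big1 ?addr0// => s /negbTE -> //.
- by rewrite (bigD1 1%g)//= /e eqxx big1 ?addr0// => s /negbTE ->.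
Qed.

(** From 1 + t <= e^t <= 1 / (1 - t) with t = h x < 1, the difference quotient lies between x and x
    / (1 - h x). *)
Lemma dyad_der_expR (R : realType) (x : R) :
  dyad_der (fun j => expR (hpow R j * x)) 1 x.
Proof.
have c0 := @hpow_cvg0 R.
have lim1 : (fun j => x / (1 - hpow R j * x)) @ \oo --> x.
  rewrite -[X in _ --> X](_ : x * (1 - 0 * x)^-1 = x); last by rewrite mul0r subr0 invr1 mulr1.
  apply: cvgM; first exact: cvg_cst.
  apply: cvgV; first by rewrite mul0r subr0 oner_eq0.
  by apply: cvgB; [exact: cvg_cst|apply: cvgM => //; exact: cvg_cst].
apply: (squeeze_cvgr _ (cvg_cst x) lim1).
have x1 : \forall j \near \oo, hpow R j * x < 1.
  have : (fun j => hpow R j * x) @ \oo --> 0 * x by apply: cvgM => //; exact: cvg_cst.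
  rewrite mul0r => /cvgrPdist_lt/(_ _ ltr01); apply: filterS => j.
  by rewrite sub0r normrN; apply: le_lt_trans; exact: ler_norm.
apply: filterS x1 => j hx; have h0 := hpow_gt0 R j.
rewrite ler_pdivlMr// ler_pdivrMr//; apply/andP; split.
  by have := expR_ge1Dx (hpow R j * x); lra.
have := expR_ge1Dx (- (hpow R j * x)); rewrite expRN => h.
have d0 : 0 < 1 - hpow R j * x by rewrite subr_gt0.
have : expR (hpow R j * x) <= (1 - hpow R j * x)^-1.
  by rewrite -[leLHS]invrK lef_pV2 ?posrE ?invr_gt0 ?expR_gt0.
move=> hh; apply: le_trans (lerB hh (lexx 1)) _.
rewrite le_eqVlt; apply/orP; left; apply/eqP; field.
by rewrite gt_eqF.
Qed.

Lemma dyad_der_le (R : realType) (f g : nat -> R) (a d e : R) :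
  dyad_der f a d -> dyad_der g a e -> (forall j, f j <= g j) -> d <= e.
Proof.
move=> fd ge fg; apply: (ler_cvg_to fd ge); apply: nearW => j.
by rewrite ler_pM2r ?invr_gt0 ?hpow_gt0// lerB.
Qed.

(** * Entrywise derivatives of matrix functions, and powers of a positive definite matrix *)

Definition mx_der (R : realType) (m n : nat) (X : nat -> 'M[R]_(m, n)) (A B : 'M[R]_(m, n)) :
  Prop := forall i j, dyad_der (fun p => X p i j) (A i j) (B i j).

Lemma mx_der_cst (R : realType) (m n : nat) (A : 'M[R]_(m, n)) : mx_der (fun=> A) A 0.
Proof. by move=> i j; rewrite mxE; exact: dyad_der_cst. Qed.

Lemma mx_derM (R : realType) (m n p : nat) (X : nat -> 'M[R]_(m, n))
    (Y : nat -> 'M[R]_(n, p)) (A A' : 'M[R]_(m, n)) (B B' : 'M[R]_(n, p)) :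
  mx_der X A A' -> mx_der Y B B' ->
  mx_der (fun q => X q *m Y q) (A *m B) (A' *m B + A *m B').
Proof.
move=> XA YB i j.
have h := @dyad_der_sum R 'I_n (index_enum _) predT _ _ _
  (fun k => dyad_derM (XA i k) (YB k j)).
apply: dyad_der_eq h; first by move=> q; rewrite mxE.
  by rewrite mxE.
by rewrite !mxE big_split.
Qed.

(** The power C^t of the matrix C whose logarithm is Q diag(l) Q^T. *)
Definition spow (R : realType) (n : nat) (Q : 'M[R]_n) (l : 'rV[R]_n) (t : R) : 'M[R]_n :=
  Q *m diag_mx (\row_i expR (t * l 0 i)) *m Q^T.

Lemma spow_sym (R : realType) (n : nat) (Q : 'M[R]_n) (l : 'rV[R]_n) (t : R) :
  (spow Q l t)^T = spow Q l t.
Proof. by rewrite /spow !trmx_mul trmxK tr_diag_mx mulmxA. Qed.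

Lemma conj_diagM (R : realType) (n : nat) (Q : 'M[R]_n) (a b : 'rV[R]_n) :
  Q *m Q^T = 1%:M ->
  Q *m diag_mx a *m Q^T *m (Q *m diag_mx b *m Q^T) =
  Q *m diag_mx (\row_i (a 0 i * b 0 i)) *m Q^T.
Proof.
move=> QQ; rewrite -diag_mxM -!mulmxA [Q^T *m (Q *m _)]mulmxA.
by rewrite (mulmx1C QQ) mul1mx.
Qed.

Lemma spowD (R : realType) (n : nat) (Q : 'M[R]_n) (l : 'rV[R]_n) (s t : R) :
  Q *m Q^T = 1%:M -> spow Q l s *m spow Q l t = spow Q l (s + t).
Proof.
move=> QQ; rewrite /spow conj_diagM//; congr (_ *m diag_mx _ *m _).
by apply/rowP => i; rewrite !mxE mulrDl expRD.
Qed.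

Lemma spow_unit (R : realType) (n : nat) (Q : 'M[R]_n) (l : 'rV[R]_n) (t : R) :
  Q *m Q^T = 1%:M -> spow Q l t \in unitmx.
Proof.
move=> QQ; rewrite /spow !unitmx_mul unitmx_tr (orthogonal_unit QQ) andbT/=.
by apply: diag_unit => i; rewrite mxE expR_gt0.
Qed.

(** The exponent 2^-(j+1) is half of the step 2^-j in [dyad_der], whence the factor 1/2. *)
Lemma spow_der (R : realType) (n : nat) (Q : 'M[R]_n) (l : 'rV[R]_n) :
  Q *m Q^T = 1%:M ->
  mx_der (fun j => spow Q l (hpow R j.+1)) 1%:M (2^-1 *: (Q *m diag_mx l *m Q^T)).
Proof.
move=> QQ.
have Ed : mx_der (fun j => diag_mx (\row_i expR (hpow R j.+1 * l 0 i))) 1%:M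
    (diag_mx (\row_i (2^-1 * l 0 i))).
  move=> p q; have h := @dyad_der_expR R (2^-1 * l 0 q).
  have [pq|pq] := eqVneq p q.
    apply: dyad_der_eq h; [move=> j|..]; rewrite !mxE ?pq ?eqxx ?mulr1n//.
    by rewrite mulrA [_ * 2^-1]mulrC -exprS.
  apply: dyad_der_eq (dyad_der_cst 0); [move=> j|..]; by rewrite !mxE (negbTE pq) ?mulr0n.
have := mx_derM (mx_derM (mx_der_cst Q) Ed) (mx_der_cst Q^T).
rewrite mulmx1 QQ mul0mx add0r mulmx0 addr0.
have -> : diag_mx (\row_i (2^-1 * l 0 i)) = 2^-1 *: diag_mx l.
  by rewrite -linearZ /=; congr diag_mx; apply/rowP => i; rewrite !mxE.
by rewrite -scalemxAr -scalemxAl.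
Qed.

Lemma topprod_svd_eq (R : realType) (n k : nat) (X : 'M[R]_n) (a b : 'rV[R]_n) :
  (k <= n)%N -> svd X a -> svd X b -> topprod k a = topprod k b.
Proof.
have le c d : (k <= n)%N -> svd X c -> svd X d -> topprod k c <= topprod k d.
  move=> kn sc sd; have [U [V [fU fV XV UX <-]]] := svd_frames kn sc.
  set D := diag_mx _ in XV *; have -> : D = U^T *m X *m V.
    by rewrite -mulmxA XV mulmxA fU mul1mx.
  by apply: le_trans (ler_norm _) _; exact: svd_ub.
by move=> kn sa sb; apply/le_anti; rewrite !le.
Qed.

(* The logarithm of the product of the [k] largest singular values of
   [C^(t/2) K C^(t/2)] has midpoint convexity at [t = 2^-j], hence its increment
   from [0] to [1] is at least its derivative at [0], which is bounded from below
   through a pair of frames that is optimal for [K]. *)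
Lemma svd_subgradient (R : realType) (n k : nat) (K Q L : 'M[R]_n) (l a b : 'rV[R]_n)
    (U V : 'M[R]_(n, k)) (D : 'M[R]_k) :
  (k <= n)%N -> Q *m Q^T = 1%:M -> svd K a ->
  svd (spow Q l 2^-1 *m K *m spow Q l 2^-1) b ->
  frame U -> frame V -> K *m V = U *m D -> U^T *m K = D *m V^T -> \det D = topprod k a ->
  L = Q *m diag_mx l *m Q^T ->
  2^-1 * (\tr (U^T *m L *m U) + \tr (V^T *m L *m V)) <=
  ln (topprod k b) - ln (topprod k a).
Proof.
move=> kn QQ sK sb fU fV KV UK dD LE.
have a0 : 0 < topprod k a by case: sK => _ /topprod_gt0 h _; exact: h.
have b0 : 0 < topprod k b by case: sb => _ /topprod_gt0 h _; exact: h.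
pose B := ln (topprod k b) - ln (topprod k a).
pose S j := spow Q l (hpow R j.+1).
have SS j : S j.+1 *m S j.+1 = S j by rewrite /S spowD// -mulr2n -hpowS.
(* With f(t) the logarithm of the top product for C^(t/2) K C^(t/2), iterating f(t/2) <= (f(0) +
   f(t)) / 2 from t = 1 gives f(2^-j) <= f(0) + 2^-j (f(1) - f(0)); [S j] is C^(t/2) at t = 2^-j. *)
have bound j s : svd (S j *m K *m S j) s -> topprod k s <= topprod k a * expR (hpow R j * B).
  elim: j s => [|j IH] s ss.
    rewrite mul1r /B expRD expRN !lnK ?posrE//.
    have -> : topprod k s = topprod k b.
      by apply: topprod_svd_eq kn ss _; rewrite /S /hpow expr1.
    by rewrite mulrC divfK// gt_eqF.
  have [b' sb'] : exists b', svd (S j *m K *m S j) b'.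
    by apply: svd_exists; rewrite 2!unitmx_mul (svd_unit sK) !spow_unit.
  have s0 : 0 < topprod k s by case: ss => _ /topprod_gt0 h _; exact: h.
  have := svd_midpoint kn (spow_sym Q l _) (spow_unit l _ QQ) sK (s := s) (b := b').
  move=> /(_ (hpow R j.+2)); rewrite -/(S j.+1).
  rewrite -[_ *m S j.+1 *m S j.+1]mulmxA SS => /(_ sb' ss) h.
  rewrite -ler_sqr ?nnegrE; [|exact: ltW|by apply/ltW; rewrite mulr_gt0 ?expR_gt0].
  apply: le_trans h _; rewrite exprMn expr2 -mulrA ler_pM2l//.
  apply: le_trans (IH _ sb') _; rewrite ler_pM2l// hpowS.
  by rewrite -expRM_natr mulr_natr mulrnAl.
have uD : D \in unitmx by rewrite unitmxE dD unitfE gt_eqF.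
(* Dividing by D makes the identity the limit of [Y j], as [dyad_der_det] requires, and turns the
   bound on the top product into one on det (Y j). *)
pose Y j := U^T *m (S j *m K *m S j) *m V *m invmx D.
have Yle j : \det (Y j) <= expR (hpow R j * B).
  have [s ss] : exists s, svd (S j *m K *m S j) s.
    by apply: svd_exists; rewrite 2!unitmx_mul (svd_unit sK) !spow_unit.
  rewrite /Y det_mulmx det_inv dD ler_pdivrMr// mulrC.
  apply: le_trans (bound _ _ ss); apply: le_trans (ler_norm _) _; exact: svd_ub.
have Sd := spow_der (l := l) QQ.
have := mx_derM (mx_derM (mx_derM (mx_der_cst U^T)
  (mx_derM (mx_derM Sd (mx_der_cst K)) Sd)) (mx_der_cst V)) (mx_der_cst (invmx D)).
rewrite -LE !mul0mx !mulmx0 !addr0 !add0r !mulmx1 !mul1mx.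
have -> : U^T *m K *m V *m invmx D = 1%:M by rewrite UK -[_ *m V]mulmxA fV mulmx1 mulmxV.
set Y' := (X in mx_der _ _ X) => Yd.
have {}Yd : dyad_der (fun j => \det (Y j)) 1 (\tr Y').
  apply: dyad_der_det => i j; apply: dyad_der_eq (Yd i j) => //; by rewrite mxE.
have := dyad_der_le Yd (@dyad_der_expR R B) Yle; rewrite -/B; apply: le_trans.
rewrite le_eqVlt; apply/orP; left; apply/eqP; rewrite /Y' mulrDr.
rewrite mulmxDr !mulmxDl mxtraceD; congr (_ + _).
  rewrite -!scalemxAl -!scalemxAr -!scalemxAl mxtraceZ; congr (_ * \tr _).
  by rewrite -!mulmxA [K *m (V *m _)]mulmxA KV -mulmxA mulmxV// mulmx1.
rewrite -!scalemxAr -!scalemxAl mxtraceZ; congr (_ * _).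
by rewrite mulmxA UK -!mulmxA [RHS]mxtrace_mulC -!mulmxA mulVmx// mulmx1.
Qed.

(** * First variation of the squared distance *)

(** With w = v / 2 >= 0, the parenthesis is (e^w - e^-w)^2, and w <= e^w - 1 <= e^w - e^-w. *)
Lemma sqr_le_cosh (R : realType) (v : R) : v ^+ 2 <= 4 * (expR v - 2 + expR (- v)).
Proof.
wlog v0 : v / 0 <= v => [hw|].
  have [/hw//|/ltW v0] := leP 0 v; have := hw (- v); rewrite oppr_ge0 sqrrN opprK.
  by move=> /(_ v0); lra.
pose w := v / 2; have w0 : 0 <= w by rewrite divr_ge0.
have vw : v = w + w by rewrite /w; field.
have := expR_ge1Dx w; have := expR_gt0 w.
rewrite expRN vw expRD; set e := expR w => e0 ew.
have -> : e * e - 2 + (e * e)^-1 = (e - e^-1) ^+ 2 by field; rewrite gt_eqF.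
have -> : (w + w) ^+ 2 = 4 * w ^+ 2 by ring.
have ei1 : e^-1 <= 1 by rewrite invf_ple ?posrE// invr1; lra.
rewrite ler_pM2l// ler_sqr ?nnegrE//; lra.
Qed.

(** An upper expansion of ln^2 around e^l, at the point e^(l + v). Its right-hand side involves v
    only through e^v and e^-v, so the matrix version will be linear in a matrix and its inverse. For
    l < 0 the term 2 l v is handled by e^v - 1 - v <= e^v - 2 + e^-v. *)
Lemma sqr_log_le (R : realType) (l v : R) :
  (l + v) ^+ 2 <= l ^+ 2 + 2 * l * (expR v - 1) +
                  (4 + 2 * `|l|) * (expR v - 2 + expR (- v)).
Proof.
have h := sqr_le_cosh v; have h1 := expR_ge1Dx v; have h2 := expR_ge1Dx (- v).
have c0 : 0 <= expR v - 2 + expR (- v) by have := sqr_ge0 v; lra.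
have [l0|l0] := leP 0 l.
  by rewrite ger0_norm//; nra.
by rewrite ltr0_norm//; nra.
Qed.

Lemma mxtrace_conj_diag (R : realType) (n : nat) (Q W : 'M[R]_n) (f g : 'rV[R]_n) :
  \tr (Q *m diag_mx f *m Q^T *m (W *m diag_mx g *m W^T)) =
  \sum_i \sum_j f 0 i * g 0 j * (Q^T *m W) i j ^+ 2.
Proof.
have -> : Q *m diag_mx f *m Q^T *m (W *m diag_mx g *m W^T) =
          (Q *m diag_mx f) *m ((Q^T *m W) *m diag_mx g *m W^T) by rewrite !mulmxA.
rewrite mxtrace_mulC.
have -> : Q^T *m W *m diag_mx g *m W^T *m (Q *m diag_mx f) =
          (Q^T *m W *m diag_mx g) *m ((Q^T *m W)^T *m diag_mx f).
  by rewrite trmx_mul trmxK !mulmxA.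
move: (Q^T *m W) => Z; rewrite /mxtrace; apply: eq_bigr => i _.
rewrite mxE; apply: eq_bigr => j _.
by rewrite !mul_mx_diag !mxE; ring.
Qed.

Lemma orthogonal_sqsum_row (R : realType) (n : nat) (Z : 'M[R]_n) (i : 'I_n) :
  Z *m Z^T = 1%:M -> \sum_j Z i j ^+ 2 = 1.
Proof.
move=> /matrixP/(_ i i); rewrite !mxE eqxx => h; rewrite -[RHS]h.
by apply: eq_bigr => j _; rewrite mxE expr2.
Qed.

Lemma orthogonal_sqsum_col (R : realType) (n : nat) (Z : 'M[R]_n) (j : 'I_n) :
  Z *m Z^T = 1%:M -> \sum_i Z i j ^+ 2 = 1.
Proof.
move=> /mulmx1C; rewrite -{2}[Z]trmxK => h; rewrite -[RHS](orthogonal_sqsum_row j h).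
by apply: eq_bigr => i _; rewrite mxE.
Qed.

(** For a unit vector u and orthogonal Q, this is the average of f with weights the squared
    coordinates of u in the basis Q; for f = log of the eigenvalues of C it is u^T (log C) u. *)
Definition qavg (R : realType) (n : nat) (Q : 'M[R]_n) (u : 'cV[R]_n) (f : 'rV[R]_n) : R :=
  (u^T *m (Q *m diag_mx f *m Q^T) *m u) 0 0.

Lemma qavgE (R : realType) (n : nat) (Q : 'M[R]_n) (u : 'cV[R]_n) (f : 'rV[R]_n) :
  qavg Q u f = \sum_i f 0 i * (Q^T *m u) i 0 ^+ 2.
Proof.
rewrite /qavg; have -> : u^T *m (Q *m diag_mx f *m Q^T) *m u =
  (Q^T *m u)^T *m diag_mx f *m (Q^T *m u) by rewrite trmx_mul trmxK !mulmxA.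
move: (Q^T *m u) => z; rewrite mul_mx_diag mxE.
by apply: eq_bigr => i _; rewrite !mxE; ring.
Qed.

Lemma qavg_weight (R : realType) (n : nat) (Q : 'M[R]_n) (u : 'cV[R]_n) :
  Q *m Q^T = 1%:M -> u^T *m u = 1%:M -> \sum_i (Q^T *m u) i 0 ^+ 2 = 1.
Proof.
move=> QQ uu; have : qavg Q u (const_mx 1) = 1.
  by rewrite /qavg diag_const1 ?mulmx1 ?QQ ?mulmx1 ?uu ?mxE// => i; rewrite mxE.
by rewrite qavgE => h; rewrite -[RHS]h; apply: eq_bigr => i _; rewrite [const_mx _ _ _]mxE mul1r.
Qed.

Lemma qavg_le (R : realType) (n : nat) (Q : 'M[R]_n) (u : 'cV[R]_n) (f : 'rV[R]_n) (m : R) :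
  Q *m Q^T = 1%:M -> u^T *m u = 1%:M -> (forall i, f 0 i <= m) -> qavg Q u f <= m.
Proof.
move=> QQ uu fm; rewrite qavgE -[leRHS]mulr1 -(qavg_weight QQ uu) big_distrr /=.
by apply: ler_sum => i _; rewrite ler_wpM2r ?sqr_ge0.
Qed.

Lemma qavg_ge0 (R : realType) (n : nat) (Q : 'M[R]_n) (u : 'cV[R]_n) (f : 'rV[R]_n) :
  (forall i, 0 <= f 0 i) -> 0 <= qavg Q u f.
Proof. by move=> f0; rewrite qavgE sumr_ge0// => i _; rewrite mulr_ge0 ?sqr_ge0. Qed.

Lemma qavgD (R : realType) (n : nat) (Q : 'M[R]_n) (u : 'cV[R]_n) (f g : 'rV[R]_n) :
  qavg Q u (f + g) = qavg Q u f + qavg Q u g.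
Proof. by rewrite !qavgE -big_split; apply: eq_bigr => i _; rewrite /= mxE mulrDl. Qed.

Lemma qavgZ (R : realType) (n : nat) (Q : 'M[R]_n) (u : 'cV[R]_n) (a : R) (f : 'rV[R]_n) :
  qavg Q u (a *: f) = a * qavg Q u f.
Proof. by rewrite !qavgE big_distrr; apply: eq_bigr => i _; rewrite /= mxE mulrA. Qed.

(** For a unit vector u these matrices are closed under products and, by the choice of parameter in
    [rankup_inv_coef], under inverses for |s| <= 1/2. Both S C S and its inverse then stay
    explicit. *)
Definition rankup (R : realType) (n : nat) (u : 'cV[R]_n) (s : R) : 'M[R]_n :=
  1%:M + s *: (u *m u^T).

Lemma rankup_sym (R : realType) (n : nat) (u : 'cV[R]_n) (s : R) :
  (rankup u s)^T = rankup u s.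
Proof. by rewrite /rankup linearD linearZ /= trmx1 trmx_mul trmxK. Qed.

Lemma rankupM (R : realType) (n : nat) (u : 'cV[R]_n) (s t : R) :
  u^T *m u = 1%:M -> rankup u s *m rankup u t = rankup u (s + t + s * t).
Proof.
move=> uu; rewrite /rankup mulmxDl mul1mx mulmxDr mulmx1 -scalemxAl -scalemxAr.
rewrite -mulmxA [u^T *m (_ *m _)]mulmxA uu mul1mx scalerA.
by rewrite !scalerDl !addrA; congr (_ + _); rewrite addrAC.
Qed.

Lemma mxtrace_rankup (R : realType) (n : nat) (Q : 'M[R]_n) (u : 'cV[R]_n) (s : R)
    (f g : 'rV[R]_n) :
  Q *m Q^T = 1%:M ->
  \tr (Q *m diag_mx f *m Q^T *m (rankup u s *m (Q *m diag_mx g *m Q^T) *m rankup u s)) =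
  \sum_i f 0 i * g 0 i + 2 * s * qavg Q u (\row_i (f 0 i * g 0 i)) +
  s ^+ 2 * (qavg Q u f * qavg Q u g).
Proof.
move=> QQ; set F := Q *m diag_mx f *m Q^T; set G := Q *m diag_mx g *m Q^T.
have FG : F *m G = Q *m diag_mx (\row_i (f 0 i * g 0 i)) *m Q^T by exact: conj_diagM.
have GF : G *m F = F *m G.
  by rewrite FG conj_diagM//; congr (_ *m diag_mx _ *m _); apply/rowP => i; rewrite !mxE mulrC.
have trFG : \tr (F *m G) = \sum_i f 0 i * g 0 i.
  rewrite FG -mulmxA mxtrace_mulC -mulmxA (mulmx1C QQ) mulmx1 mxtrace_diag.
  by apply: eq_bigr => i _; rewrite mxE.
have tr1 (X : 'M[R]_n) : \tr (X *m (u *m u^T)) = (u^T *m X *m u) 0 0.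
  by rewrite mulmxA mxtrace_mulC mulmxA /mxtrace big_ord1.
rewrite /rankup mulmxDl mul1mx mulmxDr mulmx1 -scalemxAl -scalemxAr mulmxDl.
rewrite -scalemxAl scalerDr scalerA !mulmxDr !mxtraceD -!scalemxAr !mxtraceZ.
have -> : \tr (F *m (u *m u^T *m G)) = qavg Q u (\row_i (f 0 i * g 0 i)).
  by rewrite [F *m _]mulmxA mxtrace_mulC [G *m _]mulmxA tr1 GF FG.
have -> : \tr (F *m (G *m (u *m u^T))) = qavg Q u (\row_i (f 0 i * g 0 i)).
  by rewrite [F *m _]mulmxA tr1 FG.
have -> : \tr (F *m (u *m u^T *m G *m (u *m u^T))) = qavg Q u f * qavg Q u g.
  have -> : F *m (u *m u^T *m G *m (u *m u^T)) = F *m u *m (u^T *m G *m u) *m u^T.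
    by rewrite !mulmxA.
  rewrite mxtrace_mulC.
  have -> : u^T *m (F *m u *m (u^T *m G *m u)) = (u^T *m F *m u) *m (u^T *m G *m u).
    by rewrite !mulmxA.
  by rewrite /mxtrace big_ord1 [LHS]mxE big_ord1.
by rewrite trFG; ring.
Qed.

(** The number s' is the parameter of the inverse of [rankup u s]. Since s + s' = s^2 / (1 + s),
    first-order terms occurring with both s and s' cancel up to order s^2. *)
Lemma rankup_inv_coef (R : realType) (s : R) : `|s| <= 2^-1 ->
  let s' := - s / (1 + s) in
  [/\ s + s' + s * s' = 0, s' ^+ 2 <= 4 * s ^+ 2 & s + s' <= 2 * s ^+ 2].
Proof.
rewrite ler_norml => /andP[s1 s2] /=; have s0 : 0 < 1 + s by lra.
have sn0 : 1 + s != 0 by rewrite gt_eqF.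
split; first by field.
  rewrite expr_div_n sqrrN ler_pdivrMr ?exprn_gt0//.
  have : 0 <= s ^+ 2 * (4 * (1 + s) ^+ 2 - 1); last by lra.
  by apply: mulr_ge0; [exact: sqr_ge0|nra].
have -> : s + - s / (1 + s) = s ^+ 2 / (1 + s) by field.
by rewrite ler_pdivrMr//; have := sqr_ge0 s; nra.
Qed.

Lemma klein_coef_bounds (R : realType) (l e ei M : R) :
  0 < e -> 0 < ei -> 1 + `|l| <= M -> e <= M -> ei <= M ->
  [/\ 4 + 2 * `|l| <= 4 * M, 0 <= (2 * l + (4 + 2 * `|l|)) * ei,
      (2 * l + (4 + 2 * `|l|)) * ei <= 4 * M * M &
      (4 + 2 * `|l|) * e <= 4 * M * M].
Proof.
move=> e0 ei0 lM eM eiM; have l0 := normr_ge0 l; have l1 := ler_norm l.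
have l2 : - l <= `|l| by rewrite -normrN ler_norm.
split; [lra|apply: mulr_ge0; lra|apply: ler_pM; lra|apply: ler_pM; lra].
Qed.

(** The constant is 36 = 16 + 4 + 16: the terms are 2 (s + s') wq, s^2 (aq cq) and s'^2 (bq ciq).
    What remains at first order is 4 s aL. *)
Lemma klein_assemble (R : realType) (s s' M L2 L1 W aL wq aq cq bq ciq : R) :
  s' ^+ 2 <= 4 * s ^+ 2 -> s + s' <= 2 * s ^+ 2 -> 1 <= M ->
  0 <= wq <= 4 * M -> 0 <= aq <= 4 * M * M -> 0 <= cq <= M ->
  0 <= bq <= 4 * M * M -> 0 <= ciq <= M ->
  L2 - 2 * L1 - 2 * W + (2 * L1 + W + 2 * s * (2 * aL + wq) + s ^+ 2 * (aq * cq)) +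
    (W + 2 * s' * wq + s' ^+ 2 * (bq * ciq)) <=
  L2 + 4 * s * aL + s ^+ 2 * (36 * M ^+ 3).
Proof.
move=> s'2 ss M1 /andP[w0 wM] /andP[a0 aM] /andP[c0 cM] /andP[b0 bM] /andP[d0 dM].
have s0 := sqr_ge0 s; have M0 : 0 < M by lra.
have M3 : M <= M ^+ 3 by rewrite -[leLHS]expr1 ler_weXn2l.
have ac : aq * cq <= 4 * M ^+ 3.
  by have := ler_pM a0 c0 aM cM; rewrite (_ : 4 * M * M * M = 4 * M ^+ 3)//; ring.
have bc : bq * ciq <= 4 * M ^+ 3.
  by have := ler_pM b0 d0 bM dM; rewrite (_ : 4 * M * M * M = 4 * M ^+ 3)//; ring.
have t1 : (s + s') * wq <= 2 * s ^+ 2 * (4 * M ^+ 3).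
  apply: le_trans (ler_wpM2r w0 ss) _; apply: ler_wpM2l; lra.
have t2 : s ^+ 2 * (aq * cq) <= s ^+ 2 * (4 * M ^+ 3) by apply: ler_wpM2l.
have t3 : s' ^+ 2 * (bq * ciq) <= 4 * s ^+ 2 * (4 * M ^+ 3).
  by apply: ler_pM => //; rewrite ?sqr_ge0 ?mulr_ge0.
lra.
Qed.

(* Klein's inequality for [ln^2]: the scalar bound [sqr_log_le] is summed against
   the doubly stochastic weights of the two eigenbases, which turns it into a
   trace inequality. The pieces of the right-hand side are linear in [S C S] and
   in its inverse. *)
Lemma sqr_log_rankup_le (R : realType) (n : nat) (Q W : 'M[R]_n) (l x : 'rV[R]_n)
    (u : 'cV[R]_n) (s m : R) :
  Q *m Q^T = 1%:M -> W *m W^T = 1%:M -> u^T *m u = 1%:M -> `|s| <= 2^-1 ->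
  0 <= m -> (forall i, 0 < x 0 i) -> (forall i, `|l 0 i| <= m) ->
  rankup u s *m (Q *m diag_mx (map_mx expR l) *m Q^T) *m rankup u s =
    W *m diag_mx x *m W^T ->
  \sum_i ln (x 0 i) ^+ 2 <=
  \sum_i l 0 i ^+ 2 + 4 * s * qavg Q u l + s ^+ 2 * (36 * expR (3 * m)).
Proof.
move=> QQ WW uu s2 mge0 x0 lm SCS.
pose c : 'rV[R]_n := map_mx expR l; pose ci : 'rV[R]_n := map_mx (fun y => expR (- y)) l.
pose w : 'rV[R]_n := \row_i (4 + 2 * `|l 0 i|).
pose xi : 'rV[R]_n := map_mx (fun y => y^-1) x.
have := rankup_inv_coef s2; set s' := - s / (1 + s) => /= -[ss' s'2 s's].
have rK : rankup u s *m rankup u s' = 1%:M.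
  by rewrite rankupM// ss' /rankup scale0r addr0.
have rK' : rankup u s' *m rankup u s = 1%:M by exact: mulmx1C.
have [C CE] : exists C, C = Q *m diag_mx c *m Q^T by eexists.
have [Ci CiE] : exists C, C = Q *m diag_mx ci *m Q^T by eexists.
rewrite -/c -CE in SCS.
have CCi : C *m Ci = 1%:M.
  rewrite CE CiE conj_diagM// diag_const1 ?mulmx1// => i.
  by rewrite !mxE -expRD subrr expR0.
have xxi : (W *m diag_mx x *m W^T) *m (W *m diag_mx xi *m W^T) = 1%:M.
  rewrite conj_diagM// diag_const1 ?mulmx1// => i.
  by rewrite !mxE mulfV// gt_eqF.
have SCSi : rankup u s' *m Ci *m rankup u s' = W *m diag_mx xi *m W^T.
  have h : (rankup u s' *m Ci *m rankup u s') *m (rankup u s *m C *m rankup u s) = 1%:M.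
    rewrite -!mulmxA [rankup u s' *m (rankup u s *m _)]mulmxA rK' mul1mx.
    by rewrite [Ci *m (C *m _)]mulmxA (mulmx1C CCi) mul1mx.
  have := congr1 (mulmx^~ (W *m diag_mx xi *m W^T)) h.
  by rewrite /= -mulmxA SCS xxi mulmx1 mul1mx.
pose Z := Q^T *m W.
have ZZ : Z *m Z^T = 1%:M.
  by rewrite /Z trmx_mul trmxK -mulmxA [W *m (_ *m _)]mulmxA WW mul1mx mulmx1C.
have split_l (f : 'I_n -> R) : \sum_i f i = \sum_i \sum_j f i * Z i j ^+ 2.
  by apply: eq_bigr => i _; rewrite -big_distrr /= (orthogonal_sqsum_row i ZZ) mulr1.
have split_x (f : 'I_n -> R) : \sum_j f j = \sum_i \sum_j f j * Z i j ^+ 2.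
  rewrite exchange_big /=; apply: eq_bigr => j _.
  by rewrite -big_distrr /= (orthogonal_sqsum_col j ZZ) mulr1.
(* In [sqr_log_le] with v = ln x_j - l_i one has e^v = x_j e^(-l_i) and e^-v = x_j^-1 e^(l_i). The
   vectors [a] and [b] collect the coefficients of x_j and x_j^-1, which depend on i alone. *)
pose a : 'rV[R]_n := \row_i ((2 * l 0 i + w 0 i) * ci 0 i).
pose b : 'rV[R]_n := \row_i (w 0 i * c 0 i).
have key : \sum_j ln (x 0 j) ^+ 2 <=
    \sum_i (l 0 i ^+ 2 - 2 * l 0 i - 2 * w 0 i) +
    \tr (Q *m diag_mx a *m Q^T *m (W *m diag_mx x *m W^T)) +
    \tr (Q *m diag_mx b *m Q^T *m (W *m diag_mx xi *m W^T)).
  rewrite !mxtrace_conj_diag split_x [X in X + _ + _]split_l -!big_split /=.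
  apply: ler_sum => i _; rewrite -!big_split /=; apply: ler_sum => j _.
  rewrite -!mulrDl ler_wpM2r ?sqr_ge0// !mxE.
  have := sqr_log_le (l 0 i) (ln (x 0 j) - l 0 i).
  rewrite addrC subrK opprB !expRD !expRN lnK ?posrE//.
  move/le_trans; apply; rewrite le_eqVlt; apply/orP; left; apply/eqP; ring.
apply: le_trans key _; rewrite -SCS -SCSi CE CiE !mxtrace_rankup//.
have cic i : ci 0 i * c 0 i = 1 by rewrite !mxE -expRD addNr expR0.
have ac i : a 0 i * c 0 i = 2 * l 0 i + w 0 i by rewrite [a 0 i]mxE -mulrA cic mulr1.
have bci i : b 0 i * ci 0 i = w 0 i by rewrite [b 0 i]mxE -mulrA [_ * ci 0 i]mulrC cic mulr1.
have -> : \row_i (a 0 i * c 0 i) = 2 *: l + w by apply/rowP => i; rewrite mxE ac !mxE.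
have -> : \row_i (b 0 i * ci 0 i) = w by apply/rowP => i; rewrite mxE bci.
rewrite (eq_bigr _ (fun i _ => ac i)) (eq_bigr _ (fun i _ => bci i)).
rewrite qavgD qavgZ.
pose M := expR m; have -> : expR (3 * m) = M ^+ 3 by rewrite expRM_natl.
have bnd i : [/\ w 0 i <= 4 * M, 0 <= a 0 i, a 0 i <= 4 * M * M & b 0 i <= 4 * M * M].
  rewrite !mxE; apply: klein_coef_bounds; rewrite ?expR_gt0 ?ler_expR//.
  - by apply: le_trans (expR_ge1Dx _) _; rewrite ler_expR.
  - by apply: le_trans (lm i); exact: ler_norm.
  - by apply: le_trans (lm i); rewrite -normrN; exact: ler_norm.
have w0 i : 0 <= w 0 i by rewrite mxE addr_ge0// mulr_ge0.
have -> : \sum_i (l 0 i ^+ 2 - 2 * l 0 i - 2 * w 0 i) =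
    \sum_i l 0 i ^+ 2 - 2 * \sum_i l 0 i - 2 * \sum_i w 0 i.
  by rewrite !big_distrr /= -!sumrB.
have -> : \sum_i (2 * l 0 i + w 0 i) = 2 * \sum_i l 0 i + \sum_i w 0 i.
  by rewrite big_split big_distrr.
apply: klein_assemble => //.
- by rewrite -[leLHS]expR0 ler_expR.
- by rewrite qavg_ge0 ?qavg_le// => i; case: (bnd i).
- by rewrite qavg_ge0 ?qavg_le// => i; case: (bnd i).
- rewrite qavg_ge0 ?qavg_le// => i; rewrite mxE ?expR_ge0// ler_expR.
  by apply: le_trans (lm i); exact: ler_norm.
- rewrite qavg_ge0 ?qavg_le// => i; first by case: (bnd i).
  by rewrite mxE mulr_ge0// mxE expR_ge0.
- rewrite qavg_ge0 ?qavg_le// => i; rewrite mxE ?expR_ge0// ler_expR.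
  by apply: le_trans (lm i); rewrite -normrN; exact: ler_norm.
Qed.

(** * Eigenvalues and symplectic eigenvalues as singular values *)

Lemma char_poly_orthogonal (R : comNzRingType) (n : nat) (U A : 'M[R]_n) :
  U *m U^T = 1%:M -> char_poly (U *m A *m U^T) = char_poly A.
Proof.
move=> UU; rewrite /char_poly /char_poly_mx.
have UU' : map_mx polyC U *m map_mx polyC U^T = 1%:M by rewrite -map_mxM UU map_mx1.
have -> : 'X%:M - map_mx polyC (U *m A *m U^T) =
    map_mx polyC U *m ('X%:M - map_mx polyC A) *m map_mx polyC U^T.
  rewrite mulmxBr mulmxBl !map_mxM; congr (_ - _).
  by rewrite mul_mx_scalar -scalemxAl UU' scalemx1.
by rewrite !det_mulmx mulrAC -det_mulmx UU' det1 mul1r.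
Qed.

Lemma char_poly_diag (R : comNzRingType) (n : nat) (d : 'rV[R]_n) :
  char_poly (diag_mx d) = \prod_(i < n) ('X - (d 0 i)%:P).
Proof.
rewrite char_poly_trig ?diag_mx_is_trig//; apply: eq_bigr => i _.
by rewrite mxE eqxx mulr1n.
Qed.

(** The factor N = d^(1/2) U^T is chosen so that N N^T = diag d. *)
Lemma posdef_spectral_svd (R : realType) (n : nat) (A : 'M[R]_n) :
  is_posdef A -> exists (U N : 'M[R]_n) (d : 'rV[R]_n),
    [/\ U *m U^T = 1%:M, A = U *m diag_mx d *m U^T, N \in unitmx, A = N^T *m N &
        svd (N *m 1%:M *m N^T) d].
Proof.
move=> /posdef_spectral[U [d [UU AE sd d0]]].
exists U, (diag_mx (map_mx Num.sqrt d) *m U^T), d; split=> //.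
- rewrite unitmx_mul unitmx_tr (orthogonal_unit UU) andbT.
  by apply: diag_unit => i; rewrite mxE sqrtr_gt0.
- rewrite trmx_mul trmxK tr_diag_mx -mulmxA [diag_mx _ *m (_ *m _)]mulmxA diag_mxM mulmxA AE.
  congr (_ *m diag_mx _ *m _); apply/rowP => i.
  by rewrite !mxE -expr2 sqr_sqrtr// ltW.
- split=> //; exists 1%:M, 1%:M; rewrite !trmx1 !mulmx1 mul1mx; split=> //.
  rewrite trmx_mul trmxK tr_diag_mx -mulmxA [U^T *m (_ *m _)]mulmxA (mulmx1C UU) mul1mx.
  rewrite diag_mxM; congr diag_mx; apply/rowP => i.
  by rewrite !mxE -expr2 sqr_sqrtr// ltW.
Qed.

Lemma eigvals_svd (R : realType) (n : nat) (A : posdefmx R n) :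
  exists N : 'M[R]_n, [/\ N \in unitmx, posdefmx_val A = N^T *m N &
    svd (N *m 1%:M *m N^T) (eigvals A)].
Proof.
have [U [N [d [UU AE uN AN sN]]]] := posdef_spectral_svd (posdefmxP A).
have [sd d0 _] := sN.
have cpA : char_poly A = \prod_(i < n) ('X - (d 0 i)%:P).
  by rewrite AE char_poly_orthogonal// char_poly_diag.
have aE : posrv_val (eigvals A) = d.
  rewrite /eigvals; case: xgetP => [a _ [sa ca]|]; last first.
    have pd : [forall i, 0 < d 0 i] by apply/forallP.
    by move/(_ (PosRv pd)) => h; exfalso; apply: h.
  have sorted_of (x : 'rV[R]_n) : rv_nonincreasing x ->
      sorted (fun y z => z <= y) [seq x 0 i | i <- enum 'I_n].
    move=> sx; rewrite sorted_map.
    have : sorted (fun i j : 'I_n => (i <= j)%N) (enum 'I_n).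
      by have := iota_sorted 0 n; rewrite -val_enum_ord sorted_map.
    by apply: sub_sorted => i j /sx.
  have prodE (x : 'rV[R]_n) : \prod_(i < n) ('X - (x 0 i)%:P) =
      \prod_(y <- [seq x 0 i | i <- enum 'I_n]) ('X - y%:P).
    by rewrite big_map big_enum.
  (* Equal products of linear factors have the same roots up to permutation, and sortedness then
     fixes the order. *)
  have /prod_XsubC_eq : \prod_(y <- [seq (a : 'rV_n) 0 i | i <- enum 'I_n]) ('X - y%:P) =
      \prod_(y <- [seq d 0 i | i <- enum 'I_n]) ('X - y%:P).
    by rewrite -!prodE -ca.
  have tr : transitive (fun y z : R => z <= y).
    by move=> y x z xy yz; exact: le_trans yz xy.
  have asym : antisymmetric (fun y z : R => z <= y).
    by move=> x y; rewrite andbC => /le_anti.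
  move=> /(sorted_eq tr asym (sorted_of _ sa) (sorted_of _ sd))/eq_in_map h.
  by apply/rowP => i; apply: h; rewrite mem_enum.
by exists N; rewrite aE.
Qed.

(** The real normal form of an invertible antisymmetric matrix, built one plane at a time. The
    orthogonal projection P off the columns of U and V commutes with K. An eigenvector u of P K^T K
    P with eigenvalue t^2 > 0 is paired with v = - K u / t, and K maps v to t u. *)
Lemma antisym_frames (R : realType) (n k : nat) (K : 'M[R]_(n + n)) :
  K^T = - K -> K \in unitmx -> (k <= n)%N ->
  exists (U V : 'M[R]_(n + n, k)) (d : 'rV[R]_k),
    [/\ forall i, 0 < d 0 i, U^T *m U = 1%:M /\ V^T *m V = 1%:M, U^T *m V = 0,
        K *m V = U *m diag_mx d & K *m U = - (V *m diag_mx d)].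
Proof.
move=> KT uK; elim: k => [|k IH] kn.
  exists 0, 0, 0; split; first by case.
  - by split; apply/matrixP => -[].
  - by apply/matrixP => -[].
  - by apply/matrixP => ? [].
  - by apply/matrixP => ? [].
have [U [V [d [d0 [UU VV] UV KV KU]]]] := IH (ltnW kn).
have VU : V^T *m U = 0 by rewrite -[LHS]trmxK trmx_mul trmxK UV trmx0.
have [S SE] : exists S, S = K^T *m K by eexists.
have ST : S^T = S by rewrite SE trmx_mul trmxK.
have [P PE] : exists P, P = 1%:M - U *m U^T - V *m V^T by eexists.
have PT : P^T = P by rewrite PE !linearB /= trmx1 !trmx_mul !trmxK.
have PU : P *m U = 0.
  by rewrite PE !mulmxBl mul1mx -!mulmxA UU VU mulmx1 mulmx0 subr0 subrr.
have PV : P *m V = 0.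
  by rewrite PE !mulmxBl mul1mx -!mulmxA UV VV mulmx1 mulmx0 subr0 subrr.
have UP : U^T *m P = 0 by rewrite -[LHS]trmxK trmx_mul trmxK PT PU trmx0.
have VP : V^T *m P = 0 by rewrite -[LHS]trmxK trmx_mul trmxK PT PV trmx0.
have PP : P *m P = P.
  by rewrite {2}PE !mulmxBr mulmx1 !mulmxA PU PV !mul0mx !subr0.
have UK : U^T *m K = diag_mx d *m V^T.
  have := congr1 trmx KU; rewrite trmx_mul KT [RHS]linearN /= trmx_mul tr_diag_mx mulmxN.
  by move/oppr_inj.
have VK : V^T *m K = - (diag_mx d *m U^T).
  have := congr1 trmx KV; rewrite trmx_mul KT trmx_mul tr_diag_mx mulmxN => <-.
  by rewrite opprK.
have PK : P *m K = K *m P.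
  rewrite PE !mulmxBl !mulmxBr mul1mx mulmx1 -[U *m U^T *m K]mulmxA UK.
  rewrite -[V *m V^T *m K]mulmxA VK !mulmxA KU KV mulmxN mulNmx !opprK !mulmxA.
  by rewrite addrAC.
have PS : P *m S = S *m P by rewrite SE KT !mulNmx mulmxN mulmxA PK -!mulmxA PK.
(* The trace is the rank 2 (n - k) of the projection, so P is nonzero while k < n. *)
have trP : \tr P = (n + n)%:R - k%:R - k%:R.
  rewrite PE !linearB /= mxtrace1 mxtrace_mulC UU mxtrace1.
  by rewrite mxtrace_mulC VV mxtrace1.
have trP0 : \tr P != 0.
  rewrite trP -addrA -opprD -!natrD -natrB ?leq_add ?(ltnW kn)//.
  by rewrite pnatr_eq0 subn_eq0 -ltnNge -addnS leq_add// ltnW.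
have [Q [e [QQ PSPE]]] : exists (Q : 'M[R]_(n + n)) (e : 'rV[R]_(n + n)),
    Q *m Q^T = 1%:M /\ P *m S *m P = Q *m diag_mx e *m Q^T.
  by apply: sym_spectral; rewrite !trmx_mul PT ST mulmxA.
(* If every eigenvalue of P K^T K P vanished, K P would be 0, and P = 0 by invertibility of K. *)
have [i ei] : exists i, e 0 i != 0.
  apply/existsP; apply: contraT; rewrite negb_exists => /forallP h.
  have e0 : e = 0 by apply/rowP => i; rewrite [RHS]mxE; apply/eqP; rewrite -[_ == _]negbK.
  case/eqP: trP0; have KP : K *m P = 0.
    apply/matrixP => p q; rewrite [RHS]mxE.
    have : ((K *m P)^T *m (K *m P)) q q = 0.
      have -> : (K *m P)^T *m (K *m P) = P *m S *m P.
        by rewrite trmx_mul PT SE !mulmxA.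
      by rewrite PSPE e0 linear0 mulmx0 mul0mx mxE.
    rewrite mxE => /psumr_eq0P hh; apply/eqP; rewrite -sqrf_eq0 expr2.
    have := hh _ p isT; rewrite mxE => -> //.
    by move=> r _; rewrite mxE -expr2 sqr_ge0.
  by rewrite -[P](mulKmx uK) KP mulmx0 linear0.
pose u := col i Q.
have uu : u^T *m u = 1%:M.
  apply/matrixP => a b; rewrite !ord1; have /matrixP/(_ i i) := mulmx1C QQ.
  by rewrite !mxE !eqxx => <-; apply: eq_bigr => r _; rewrite !mxE.
have PSPu : P *m S *m P *m u = e 0 i *: u.
  have uE : u = Q *m delta_mx i 0 by rewrite /u colE.
  rewrite uE PSPE -!mulmxA [Q^T *m (Q *m _)]mulmxA (mulmx1C QQ) mul1mx.
  rewrite scalemxAr; congr (_ *m _); apply/matrixP => a b; rewrite mul_diag_mx !mxE.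
  by have [->|] := eqVneq a i; rewrite ?mulr0.
(* A nonzero eigenvalue puts u in the range of P, orthogonal to the planes already found. *)
have Pu : P *m u = u.
  apply: (scalerI ei); rewrite scalemxAr -PSPu !mulmxA PP.
  by [].
have Su : S *m u = e 0 i *: u.
  by rewrite -PSPu -mulmxA Pu PS -mulmxA Pu.
clearbody u.
have e_gt0 : 0 < e 0 i.
  rewrite lt_neqAle eq_sym ei /=.
  have -> : e 0 i = ((K *m u)^T *m (K *m u)) 0 0.
    by rewrite trmx_mul -mulmxA [K^T *m (_ *m _)]mulmxA -SE Su -scalemxAr uu !mxE eqxx mulr1.
  by have := rv_sqnorm_ge0 (K *m u)^T; rewrite trmxK.
pose t := Num.sqrt (e 0 i).
have t0 : 0 < t by rewrite sqrtr_gt0.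
have tt : t * t = e 0 i by rewrite -expr2 sqr_sqrtr// ltW.
have [v vE] : exists v, v = - (t^-1 *: (K *m u)) by eexists.
have Ku : K *m u = - (t *: v).
  by rewrite vE scalerN opprK scalerA divff ?scale1r// gt_eqF.
have KKu : K *m (K *m u) = - (e 0 i *: u).
  by rewrite -Su SE KT !mulNmx mulmxA opprK.
have Kv : K *m v = t *: u.
  rewrite vE mulmxN -scalemxAr KKu scalerN opprK scalerA -tt mulrA mulVf ?mul1r//.
  by rewrite gt_eqF.
have uKu : u^T *m K *m u = 0.
  have h : u^T *m K *m u = - (u^T *m K *m u).
    have : (u^T *m K *m u)^T = - (u^T *m K *m u).
      by rewrite !trmx_mul trmxK KT mulNmx mulmxN mulmxA.
    by move=> <-; apply/matrixP => a b; rewrite !ord1 [RHS]mxE.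
  apply/matrixP => a b; rewrite !ord1 [RHS]mxE; have /matrixP/(_ 0 0) := h.
  by rewrite [RHS]mxE; move: (_ 0 0) => z hz; lra.
have uv : u^T *m v = 0 by rewrite vE mulmxN -scalemxAr mulmxA uKu scaler0 oppr0.
have vv : v^T *m v = 1%:M.
  rewrite {2}vE mulmxN -scalemxAr mulmxA.
  have -> : v^T *m K = - (t *: u^T).
    have := congr1 trmx Kv; rewrite trmx_mul KT mulmxN linearZ /= => <-.
    by rewrite opprK.
  by rewrite mulNmx -scalemxAl uu scalerN opprK scalerA mulVf ?scale1r// gt_eqF.
have Uu : U^T *m u = 0 by rewrite -Pu mulmxA UP mul0mx.
have Vu : V^T *m u = 0 by rewrite -Pu mulmxA VP mul0mx.
have Uv : U^T *m v = 0.
  by rewrite vE mulmxN -scalemxAr mulmxA UK -mulmxA Vu mulmx0 scaler0 oppr0.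
have Vv : V^T *m v = 0.
  by rewrite vE mulmxN -scalemxAr mulmxA VK mulNmx -mulmxA Uu mulmx0 oppr0 scaler0 oppr0.
have tr0 (a b : nat) (X : 'M[R]_(n + n, a)) (Y : 'M[R]_(n + n, b)) :
  X^T *m Y = 0 -> Y^T *m X = 0.
  by move=> h; rewrite -[LHS]trmxK trmx_mul trmxK h trmx0.
suff : exists (U V : 'M[R]_(n + n, 1 + k)) (d : 'rV[R]_(1 + k)),
    [/\ forall i, 0 < d 0 i, U^T *m U = 1%:M /\ V^T *m V = 1%:M, U^T *m V = 0,
        K *m V = U *m diag_mx d & K *m U = - (V *m diag_mx d)] by [].
exists (row_mx u U), (row_mx v V), (row_mx t%:M d).
have dE : diag_mx (row_mx (t%:M : 'M[R]_1) d) = block_mx (t%:M : 'M[R]_1) 0 0 (diag_mx d).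
  by rewrite diag_mx_row; congr block_mx; apply/matrixP => a b; rewrite !ord1 !mxE.
split.
- move=> j; rewrite mxE; case: splitP => a _; last exact: d0.
  by rewrite ord1 mxE eqxx.
- rewrite !tr_row_mx !mul_col_row uu UU vv VV Uu Vv (tr0 _ _ _ _ Uu) (tr0 _ _ _ _ Vv).
  by rewrite -!scalar_mx_block.
- rewrite !tr_row_mx !mul_col_row uv UV Uv (tr0 _ _ _ _ Vu).
  by apply/matrixP => a b; rewrite !mxE; do 2 (case: splitP => *; rewrite ?mxE).
- rewrite dE mul_mx_row mul_row_block !mulmx0 addr0 add0r Kv KV.
  by rewrite mul_mx_scalar.
- rewrite dE mul_mx_row mul_row_block !mulmx0 addr0 add0r Ku KU opp_row_mx.
  by rewrite mul_mx_scalar.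
Qed.

Lemma symplJ_tr (R : realType) (n : nat) : (symplJ R n)^T = - symplJ R n.
Proof. by rewrite /symplJ tr_block_mx opp_block_mx !trmx0 linearN /= trmx1 oppr0 opprK. Qed.

Lemma symplJ_orth (R : realType) (n : nat) : symplJ R n *m (symplJ R n)^T = 1%:M.
Proof.
rewrite /symplJ tr_block_mx !trmx0 linearN /= trmx1 mulmx_block !mulmx0 !mul0mx.
by rewrite !addr0 !add0r mulmx1 mulmxN mulmx1 opprK -scalar_mx_block.
Qed.

Lemma perm_diag (R : realType) (n : nat) (s : 'S_n) (d : 'rV[R]_n) :
  diag_mx d *m perm_mx s^-1 = perm_mx s^-1 *m diag_mx (\row_i d 0 (s i)).
Proof.
apply/matrixP => i j; rewrite mul_diag_mx mul_mx_diag !mxE.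
have [<-|] := eqVneq (s^-1%g i) j; first by rewrite permKV mulr1 mul1r.
by rewrite mulr0 mul0r.
Qed.

Lemma perm_mx_orth (R : realType) (n : nat) (s : 'S_n) :
  (perm_mx s : 'M[R]_n) *m (perm_mx s)^T = 1%:M.
Proof. by rewrite tr_perm_mx -perm_mxM mulgV perm_mx1. Qed.

(** The hypothesis makes J M^T J^T a right inverse of M; it is then a left inverse too. *)
Lemma symplectic_of_tr (R : realType) (n : nat) (M : 'M[R]_(n + n)) :
  M *m symplJ R n *m M^T = symplJ R n -> symplectic M.
Proof.
move=> h; rewrite /symplectic; set J := symplJ R n in h *.
have JJ : J *m J^T = 1%:M by exact: symplJ_orth.
have h1 : M *m (J *m M^T *m J^T) = 1%:M by rewrite !mulmxA h.
have h2 := mulmx1C h1.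
have h3 : M^T *m J^T *m M = J^T.
  have := congr1 (fun X => J^T *m X) h2.
  by rewrite /= mulmx1 !mulmxA (mulmx1C JJ) mul1mx.
move: h3; rewrite /J symplJ_tr -/J mulmxN mulNmx; exact: oppr_inj.
Qed.

(** With A = N^T N, an orthogonal Q brings the antisymmetric matrix K = N J N^T to the normal form
    with blocks D and -D. Then M = D^(-1/2) Q^T N, with D^(-1/2) acting on both halves, sends J to J
    and recovers A. *)
Lemma Williamson (R : realType) (n : nat) (A : 'M[R]_(n + n)) :
  is_posdef A -> exists (M : 'M[R]_(n + n)) (d : 'rV[R]_n),
    [/\ forall i, 0 < d 0 i, rv_nondecreasing d, symplectic M &
        A = M^T *m block_mx (diag_mx d) 0 0 (diag_mx d) *m M].
Proof.
move=> /posdef_factor[N uN AE]; pose J := symplJ R n.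
have [K KE] : exists K, K = N *m J *m N^T by eexists.
have JJ : J *m J^T = 1%:M by exact: symplJ_orth.
have KT : K^T = - K.
  by rewrite KE !trmx_mul trmxK symplJ_tr mulNmx mulmxN mulmxA.
have uK : K \in unitmx by rewrite KE !unitmx_mul unitmx_tr uN (orthogonal_unit JJ).
have [U [V [d [d0 [UU VV] UV KV KU]]]] := antisym_frames KT uK (leqnn n).
(* [rv_sort] sorts downwards, so - d is sorted to obtain d in increasing order. *)
have [s hs] := rv_sort (- d).
pose p := perm_mx s^-1 : 'M[R]_n; pose e := \row_i d 0 (s i).
have pp : p^T *m p = 1%:M by apply: mulmx1C; exact: perm_mx_orth.
have dp : diag_mx d *m p = p *m diag_mx e by exact: perm_diag.
pose Q : 'M[R]_(n + n) := row_mx (U *m p) (V *m p).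
have QQ : Q *m Q^T = 1%:M.
  have conj (X Y : 'M[R]_(n + n, n)) (T : 'M[R]_n) : X^T *m Y = T -> (X *m p)^T *m (Y *m p) = p^T *m T *m p.
    by move=> <-; rewrite trmx_mul !mulmxA.
  have VU : V^T *m U = 0 by rewrite -[LHS]trmxK trmx_mul trmxK UV trmx0.
  apply: mulmx1C; rewrite /Q tr_row_mx mul_col_row.
  rewrite (conj _ _ _ UU) (conj _ _ _ VV) (conj _ _ _ UV) (conj _ _ _ VU).
  by rewrite !mulmx0 !mul0mx !mulmx1 pp -scalar_mx_block.
pose B := block_mx 0 (diag_mx e) (- diag_mx e) 0.
have KQ : K *m Q = Q *m B.
  rewrite /Q /B mul_mx_row mul_row_block !mulmx0 addr0 add0r !mulmxA KU KV.
  by rewrite mulNmx mulmxN -!mulmxA dp.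
have e0 i : 0 < e 0 i by rewrite mxE.
pose r := map_mx (fun x : R => (Num.sqrt x)^-1) e.
pose Z := block_mx (diag_mx r) 0 0 (diag_mx r).
have rer : diag_mx r *m diag_mx e *m diag_mx r = 1%:M.
  rewrite !diag_mxM diag_const1// => i; rewrite !mxE.
  rewrite -[X in _ * X * _](sqr_sqrtr (ltW (d0 _))); field.
  by rewrite gt_eqF// sqrtr_gt0.
have ZT : Z^T = Z by rewrite /Z tr_block_mx !tr_diag_mx !trmx0.
exists (Z *m Q^T *m N), e; split=> //.
- by move=> i j /hs; rewrite !mxE lerN2.
- apply: symplectic_of_tr; rewrite !trmx_mul trmxK ZT.
  have -> : Z *m Q^T *m N *m symplJ R n *m (N^T *m (Q *m Z)) = Z *m Q^T *m (K *m Q) *m Z.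
    by rewrite KE !mulmxA.
  rewrite KQ -[Z *m Q^T *m _]mulmxA [Q^T *m _]mulmxA (mulmx1C QQ) mul1mx.
  rewrite /Z /B !mulmx_block !(mulmx0, mul0mx, addr0, add0r).
  by rewrite mulmxN mulNmx rer /symplJ.
rewrite !trmx_mul trmxK ZT.
have -> : N^T *m (Q *m Z) *m block_mx (diag_mx e) 0 0 (diag_mx e) *m (Z *m Q^T *m N) =
  N^T *m Q *m (Z *m block_mx (diag_mx e) 0 0 (diag_mx e) *m Z) *m Q^T *m N.
  by rewrite !mulmxA.
rewrite /Z !mulmx_block !(mulmx0, mul0mx, addr0, add0r) rer.
by rewrite -scalar_mx_block mulmx1 -[N^T *m Q *m Q^T]mulmxA QQ mulmx1.
Qed.

(** The permutation that reads the interleaved list d_n, d_n, ..., d_1, d_1 off the two copies in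
    [row_mx a a]: even positions use the left copy, odd ones the right. *)
Definition dhat_index (n : nat) (i : 'I_(n + n)) : 'I_(n + n) :=
  if odd i then rshift n (rev_ord (half_ord i)) else lshift n (rev_ord (half_ord i)).

Lemma dhat_index_inj (n : nat) : injective (@dhat_index n).
Proof.
move=> i j; rewrite /dhat_index => h; apply/val_inj => /=.
rewrite -[LHS]odd_double_half -[RHS]odd_double_half.
have [oh hh] : odd i = odd j /\ half_ord i = half_ord j.
  move: h; case: (odd i); case: (odd j).
  - by move=> /rshift_inj/rev_ord_inj.
  - by move=> /eqP; rewrite eq_rlshift.
  - by move=> /eqP; rewrite eq_lrshift.
  - by move=> /lshift_inj/rev_ord_inj.
by rewrite oh; have /(congr1 val)/= -> := hh.
Qed.

(** Take N = Z M with M from Williamson's theorem and Z^2 = diag(a, a). Since M^T is symplectic as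
    well, N J N^T = Z J Z = diag(a, a) J, a singular value decomposition up to sorting. *)
Lemma ext_sympl_svd (R : realType) (n : nat) (A : posdefmx R (n + n)) :
  exists N : 'M[R]_(n + n), [/\ N \in unitmx, posdefmx_val A = N^T *m N &
    svd (N *m symplJ R n *m N^T) (ext_sympl_eigvals A)].
Proof.
have [a [sa [M sM AE]]] : exists a : posrv R n, rv_nondecreasing a /\
    exists2 M : 'M[R]_(n + n), symplectic M &
      posdefmx_val A = M^T *m block_mx (diag_mx a) 0 0 (diag_mx a) *m M /\
      sympl_eigvals A = a.
  rewrite /sympl_eigvals; case: xgetP => [a _ [sa [M sM AE]]|]; first by exists a; split => //; exists M.
  have [M [d [d0 sd sM AE]]] := Williamson (posdefmxP A).
  have pd : [forall i, 0 < d 0 i] by apply/forallP.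
  move/(_ (PosRv pd)) => h; exfalso; apply: h; split => //; by exists M.
case: AE => AE aE; pose J := symplJ R n.
have a0 i : 0 < posrv_val a 0 i by exact: (forallP (posrvP a)).
pose r := map_mx Num.sqrt a; pose Z := block_mx (diag_mx r) 0 0 (diag_mx r).
have ZT : Z^T = Z by rewrite /Z tr_block_mx !tr_diag_mx !trmx0.
have rr : diag_mx r *m diag_mx r = diag_mx a.
  rewrite diag_mxM; congr diag_mx; apply/rowP => i.
  by rewrite !mxE -expr2 sqr_sqrtr// ltW.
have ZZ : Z *m Z = block_mx (diag_mx a) 0 0 (diag_mx a).
  by rewrite /Z mulmx_block !mulmx0 !mul0mx !addr0 !add0r rr.
have uA : posdefmx_val A \in unitmx by apply: posdef_unit; exact: posdefmxP.
have AN : posdefmx_val A = (Z *m M)^T *m (Z *m M).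
  by rewrite trmx_mul ZT -mulmxA [Z *m (Z *m _)]mulmxA ZZ AE mulmxA.
have MJM : M *m J *m M^T = J.
  have h : J^T *m M^T *m J *m M = 1%:M.
    by rewrite -mulmxA -mulmxA [M^T *m _]mulmxA sM (mulmx1C (symplJ_orth R n)).
  have {}h := mulmx1C h.
  have := congr1 (fun X => X *m J) h; rewrite mul1mx /J !mulmxA => h'.
  have JJ := mulmx1C (symplJ_orth R n).
  move: h'; rewrite symplJ_tr -[M *m _ *m M^T *m _ *m _]mulmxA.
  have -> : symplJ R n *m symplJ R n = - 1%:M.
    by rewrite -[X in X *m _]opprK -symplJ_tr mulNmx JJ.
  by rewrite mulmxN mulmx1 mulmxN mulNmx opprK.
exists (Z *m M); split=> //.
  by move: uA; rewrite AN unitmx_mul => /andP[].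
pose s := perm (@dhat_index_inj n); pose x : 'rV[R]_(n + n) := row_mx a a.
have KE : (Z *m M) *m J *m (Z *m M)^T = diag_mx x *m J.
  rewrite trmx_mul ZT.
  have -> : Z *m M *m J *m (M^T *m Z) = Z *m (M *m J *m M^T) *m Z by rewrite !mulmxA.
  rewrite MJM /x diag_mx_row /J /symplJ /Z !mulmx_block !(mulmx0, mul0mx, addr0, add0r).
  rewrite ?mulmx1.
  by rewrite !mulmxN !mulNmx !mulmx1 rr.
have xs : posrv_val (ext_sympl_eigvals A) = \row_i x 0 (s i).
  apply/rowP => i; rewrite [LHS]mxE aE [RHS]mxE permE /dhat_index /x mxE.
  by case: (odd i); rewrite ?(unsplitK (inl _)) ?(unsplitK (inr _)).
split.
- move=> i j ij; rewrite [X in X <= _]mxE [X in _ <= X]mxE aE; apply: sa => /=.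
  by rewrite leq_sub2l// ltnS half_leq.
- by move=> i; rewrite (forallP (posrvP (ext_sympl_eigvals A))).
exists (perm_mx s^-1), ((perm_mx s^-1)^T *m J); split.
- exact: perm_mx_orth.
- rewrite trmx_mul trmxK mulmxA -[_ *m J *m _]mulmxA symplJ_orth mulmx1.
  by apply: mulmx1C; exact: perm_mx_orth.
by rewrite KE xs -perm_diag mulmxA -[_ *m perm_mx _ *m _]mulmxA perm_mx_orth mulmx1.
Qed.

(** * Lipschitz estimates *)

(** Two factors of one Gram matrix differ by the orthogonal matrix W = N' N^-1, which conjugates N E
    N^T. Hence singular values of N E N^T depend on N^T N only. *)
Lemma svd_gram_indep (R : realType) (n : nat) (E N N' : 'M[R]_n) (a : 'rV[R]_n) :
  N \in unitmx -> N'^T *m N' = N^T *m N ->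
  svd (N *m E *m N^T) a -> svd (N' *m E *m N'^T) a.
Proof.
move=> uN NN [sa a0 [Q1 [Q2 [h1 h2 KE]]]].
have [W WE] : exists W, W = N' *m invmx N by eexists.
have WW : W *m W^T = 1%:M.
  apply: mulmx1C; rewrite WE trmx_mul -mulmxA [N'^T *m (_ *m _)]mulmxA NN -!mulmxA mulmxV//.
  by rewrite mulmx1 -trmx_mul mulmxV// trmx1.
have -> : N' *m E *m N'^T = W *m (N *m E *m N^T) *m W^T.
  rewrite WE trmx_mul -!mulmxA [N^T *m (_ *m _)]mulmxA -trmx_mul mulVmx// trmx1 mul1mx.
  by rewrite [invmx N *m (_ *m _)]mulmxA mulVmx// mul1mx.
split=> //; exists (W *m Q1), (Q2 *m W^T); split.
- by rewrite trmx_mul mulmxA -[_ *m Q1 *m _]mulmxA h1 mulmx1.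
- by rewrite trmx_mul trmxK mulmxA -[_ *m W^T *m W]mulmxA (mulmx1C WW) mulmx1.
- by rewrite KE !mulmxA.
Qed.

Lemma lnnorm_ge0 (R : realType) (n : nat) (d : 'rV[R]_n) : 0 <= lnnorm d.
Proof. exact: sqrtr_ge0. Qed.

Lemma lnnorm_coord (R : realType) (n : nat) (d : 'rV[R]_n) (i : 'I_n) :
  `|ln (d 0 i)| <= lnnorm d.
Proof.
rewrite /lnnorm -sqrtr_sqr ler_wsqrtr// (bigD1 i)//= lerDl.
by apply: sumr_ge0 => j _; exact: sqr_ge0.
Qed.

Lemma lnnorm_sq (R : realType) (n : nat) (d : 'rV[R]_n) :
  lnnorm d ^+ 2 = \sum_i ln (d 0 i) ^+ 2.
Proof. by rewrite /lnnorm sqr_sqrtr// sumr_ge0// => i _; exact: sqr_ge0. Qed.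

Lemma lnnorm_sub_le (R : realType) (n : nat) (a b : 'rV[R]_n) (m : R) : 0 <= m ->
  (forall i, `|ln (a 0 i) - ln (b 0 i)| <= m) -> lnnorm a - lnnorm b <= n%:R * m.
Proof.
move=> m0 abm; have na := lnnorm_ge0 a; have nb := lnnorm_ge0 b.
have [//|ab] := leP (lnnorm a) (lnnorm b).
  by move=> ab; rewrite (le_trans (y := 0)) ?subr_le0// mulr_ge0.
have h : lnnorm a ^+ 2 - lnnorm b ^+ 2 <= n%:R * m * (lnnorm a + lnnorm b).
  rewrite !lnnorm_sq -sumrB.
  apply: le_trans (_ : \sum_(i < n) m * (lnnorm a + lnnorm b) <= _); last first.
    by rewrite sumr_const card_ord -[leLHS]mulr_natl mulrA.
  apply: ler_sum => i _; rewrite subr_sqr; apply: le_trans (ler_norm _) _.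
  rewrite normrM ler_pM//; apply: le_trans (ler_normD _ _) _.
  by apply: lerD; exact: lnnorm_coord.
have s0 : 0 < lnnorm a + lnnorm b by lra.
by rewrite -(ler_pM2r s0) -subr_sqr.
Qed.

Lemma lnnorm_inv (R : realType) (n : nat) (d : 'rV[R]_n) :
  (forall i, 0 < d 0 i) -> lnnorm (map_mx (fun x => x^-1) d) = lnnorm d.
Proof.
move=> d0; rewrite /lnnorm; congr Num.sqrt; apply: eq_bigr => i _.
by rewrite mxE lnV ?posrE// sqrrN.
Qed.

Lemma posdefmx_factor (R : realType) (n : nat) (A B : posdefmx R n) :
  exists (N U : 'M[R]_n) (d : 'rV[R]_n), [/\ N \in unitmx /\ posdefmx_val A = N^T *m N,
    U *m U^T = 1%:M, forall i, 0 < d 0 i,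
    posdefmx_val B = N^T *m (U *m diag_mx d *m U^T) *m N & dist_pd A B = lnnorm d].
Proof.
have [N uN AE] := posdef_factor (posdefmxP A).
have [U [d [UU d0 BE]]] := posdef_simdiag uN (posdefmxP B).
exists N, U, d; split=> //; apply: (dist_pdE (M := U^T *m N)).
  by rewrite trmx_mul trmxK -mulmxA [U *m (_ *m _)]mulmxA UU mul1mx.
by rewrite BE trmx_mul trmxK !mulmxA.
Qed.

Lemma dist_pd_ge0 (R : realType) (n : nat) (A B : posdefmx R n) : 0 <= dist_pd A B.
Proof. by rewrite /dist_pd /norm2mx sqrtr_ge0. Qed.

Lemma dist_pd_sym (R : realType) (n : nat) (A B : posdefmx R n) :
  dist_pd A B = dist_pd B A.
Proof.
have [N [U [d [[uN AE] UU d0 BE ->]]]] := posdefmx_factor A B.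
have [s sE] : exists s, s = map_mx Num.sqrt d by eexists.
have ss : diag_mx s *m diag_mx s = diag_mx d.
  rewrite diag_mxM; congr diag_mx; apply/rowP => i.
  by rewrite sE !mxE -expr2 sqr_sqrtr// ltW.
rewrite -(lnnorm_inv d0); apply/esym.
apply: (dist_pdE (M := diag_mx s *m U^T *m N)); rewrite !trmx_mul trmxK tr_diag_mx.
  by rewrite BE -ss !mulmxA.
have -> : N^T *m (U *m diag_mx s) *m diag_mx (map_mx (fun x => x^-1) d) *m
    (diag_mx s *m U^T *m N) =
  N^T *m U *m (diag_mx s *m diag_mx (map_mx (fun x => x^-1) d) *m diag_mx s) *m U^T *m N.
  by rewrite !mulmxA.
rewrite !diag_mxM diag_const1 ?mulmx1 -?[N^T *m U *m _]mulmxA ?UU ?mulmx1// => i.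
rewrite sE !mxE -[X in _ * X^-1](sqr_sqrtr (ltW (d0 i))); field.
by rewrite gt_eqF// sqrtr_gt0.
Qed.

Lemma dist_pd_congr (R : realType) (n : nat) (A B A' B' : posdefmx R n) (G : 'M[R]_n) :
  posdefmx_val A' = G^T *m A *m G -> posdefmx_val B' = G^T *m B *m G ->
  dist_pd A' B' = dist_pd A B.
Proof.
have [N [U [d [[uN AE] UU d0 BE ->]]]] := posdefmx_factor A B.
rewrite AE BE => A'E B'E; apply: (dist_pdE (M := U^T *m N *m G)).
  rewrite A'E !trmx_mul trmxK -!mulmxA [U *m (_ *m _)]mulmxA UU mul1mx.
  by [].
by rewrite B'E !trmx_mul trmxK !mulmxA.
Qed.

Lemma spow1_ln (R : realType) (n : nat) (U : 'M[R]_n) (d : 'rV[R]_n) :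
  (forall i, 0 < d 0 i) -> spow U (map_mx (@ln R) d) 1 = U *m diag_mx d *m U^T.
Proof.
move=> d0; rewrite /spow; congr (_ *m diag_mx _ *m _).
by apply/rowP => i; rewrite !mxE mul1r lnK ?posrE.
Qed.

(* [S = C^(1/2)]: if [A = N^T N] and [B = N^T C N] then [B = (S N)^T (S N)]. *)
Lemma svd_half (R : realType) (n : nat) (E N N' U B : 'M[R]_n) (d b : 'rV[R]_n) :
  N \in unitmx -> N' \in unitmx -> U *m U^T = 1%:M -> (forall i, 0 < d 0 i) ->
  B = N^T *m (U *m diag_mx d *m U^T) *m N -> B = N'^T *m N' ->
  svd (N' *m E *m N'^T) b ->
  svd (spow U (map_mx (@ln R) d) 2^-1 *m (N *m E *m N^T) *m
       spow U (map_mx (@ln R) d) 2^-1) b.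
Proof.
move=> uN uN' UU d0 BE BE' sb; set S := spow _ _ _.
have ST : S^T = S by exact: spow_sym.
have SS : S *m S = U *m diag_mx d *m U^T.
  rewrite spowD// -spow1_ln//; congr spow; clear; lra.
clearbody S.
have -> : S *m (N *m E *m N^T) *m S = (S *m N) *m E *m (S *m N)^T.
  by rewrite trmx_mul ST !mulmxA.
apply: svd_gram_indep sb => //.
by rewrite -BE' BE trmx_mul ST !mulmxA -[_ *m S *m S]mulmxA SS !mulmxA.
Qed.

Lemma topprod_le_exp (R : realType) (n k : nat) (c : 'rV[R]_n) (m : R) :
  (k <= n)%N -> (forall i, 0 < c 0 i) -> (forall i, c 0 i <= m) -> topprod k c <= m ^+ k.
Proof.
move=> kn c0 cm; rewrite topprod_widen -[k in X in _ <= X]card_ord -prodr_const.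
by apply: ler_prod => i _; rewrite ltW ?c0 ?cm.
Qed.

Lemma ln_topprod_lip (R : realType) (n k : nat) (E N N' : 'M[R]_n) (A B : posdefmx R n)
    (a b : 'rV[R]_n) :
  (k <= n)%N -> N \in unitmx -> N' \in unitmx ->
  posdefmx_val A = N^T *m N -> posdefmx_val B = N'^T *m N' ->
  svd (N *m E *m N^T) a -> svd (N' *m E *m N'^T) b ->
  ln (topprod k b) <= ln (topprod k a) + k%:R * dist_pd A B.
Proof.
move=> kn uN uN' AE BE sa sb.
have [U [d [UU d0 BE']]] := posdef_simdiag uN (posdefmxP B).
have dE : dist_pd A B = lnnorm d.
  apply: (dist_pdE (M := U^T *m N)).
    by rewrite trmx_mul trmxK -mulmxA [U *m (_ *m _)]mulmxA UU mul1mx.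
  by rewrite BE' trmx_mul trmxK !mulmxA.
have sSKS := svd_half uN uN' UU d0 BE' BE sb.
set S := spow _ _ _ in sSKS.
pose x : 'rV[R]_n := \row_i expR (2^-1 * ln (d 0 i)).
have [p hp] := rv_sort x.
have sS : svd S (\row_i x 0 (p i)).
  split.
  - by move=> i j /hp; rewrite !mxE.
  - by move=> i; rewrite !mxE expR_gt0.
  exists (col_perm p U), (col_perm p U)^T; split.
  - exact: orthogonal_row_perm.
  - by rewrite trmxK; apply: mulmx1C; exact: orthogonal_row_perm.
  - rewrite diag_col_perm /S /spow; congr (_ *m diag_mx _ *m _).
    by apply/rowP => i; rewrite !mxE.
(* The eigenvalues of S = C^(1/2) are exp (ln d_i / 2), each at most exp (dist / 2). S occurs on
   both sides of K, so the two bounds multiply to exp (k dist). *)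
have tS : topprod k (\row_i x 0 (p i)) <= expR (2^-1 * dist_pd A B) ^+ k.
  apply: topprod_le_exp => // i; rewrite !mxE ?expR_gt0// ler_expR ler_wpM2l ?invr_ge0// dE.
  by apply: le_trans (ler_norm _) _; exact: lnnorm_coord.
have [c sc] : exists c, svd (S *m (N *m E *m N^T)) c.
  by apply: svd_exists; rewrite unitmx_mul (svd_unit sS) (svd_unit sa).
have h1 := svd_mul_le kn sS sa sc; have h2 := svd_mul_le kn sc sS sSKS.
have a0 : 0 < topprod k a by case: sa => _ /topprod_gt0 h _; exact: h.
have b0 : 0 < topprod k b by case: sb => _ /topprod_gt0 h _; exact: h.
have c0 : 0 < topprod k c by case: sc => _ /topprod_gt0 h _; exact: h.
have s0 : 0 < topprod k (\row_i x 0 (p i)) by case: sS => _ /topprod_gt0 h _; exact: h.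
set e := expR _ ^+ k in tS.
have e0 : 0 <= e by rewrite exprn_ge0// expR_ge0.
have : topprod k b <= topprod k a * expR (k%:R * dist_pd A B).
  apply: le_trans h2 _; apply: le_trans (ler_pM (ltW c0) (ltW s0) h1 tS) _.
  apply: le_trans (ler_wpM2r e0 (ler_wpM2r (ltW a0) tS)) _.
  rewrite mulrAC mulrC le_eqVlt; apply/orP; left; apply/eqP; congr (_ * _).
  rewrite /e -!expRM_natl -expRD; congr expR; lra.
rewrite -ler_ln ?posrE ?mulr_gt0 ?expR_gt0// lnM ?posrE ?expR_gt0// expRK.
by [].
Qed.

(** The logarithm of the entry of index i is f_(i+1) - f_i, whose Lipschitz constant is at most (i +
    1) + i <= 2 n. *)
Lemma ln_svd_lip (R : realType) (n : nat) (E N N' : 'M[R]_n) (A B : posdefmx R n)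
    (a b : 'rV[R]_n) (i : 'I_n) :
  N \in unitmx -> N' \in unitmx ->
  posdefmx_val A = N^T *m N -> posdefmx_val B = N'^T *m N' ->
  svd (N *m E *m N^T) a -> svd (N' *m E *m N'^T) b ->
  `|ln (a 0 i) - ln (b 0 i)| <= (2 * n)%:R * dist_pd A B.
Proof.
move=> uN uN' AE BE sa sb; have D0 := dist_pd_ge0 A B.
have lnS (c : 'rV[R]_n) (X : 'M[R]_n) : svd X c ->
    ln (c 0 i) = ln (topprod i.+1 c) - ln (topprod i c).
  case=> _ c0 _; rewrite (topprodS _ (ltn_ord i)) lnM ?posrE ?topprod_gt0//.
  by rewrite addrC addKr; congr (ln (c 0 _)); exact: val_inj.
have leS := ltn_ord i; have leI := ltnW leS.
have h1 := ln_topprod_lip leS uN uN' AE BE sa sb.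
have h2 := ln_topprod_lip leS uN' uN BE AE sb sa.
have h3 := ln_topprod_lip leI uN uN' AE BE sa sb.
have h4 := ln_topprod_lip leI uN' uN BE AE sb sa.
rewrite -[dist_pd B A]dist_pd_sym in h2 h4.
rewrite (lnS _ _ sa) (lnS _ _ sb).
have iD : (i.+1)%:R * dist_pd A B <= n%:R * dist_pd A B by rewrite ler_wpM2r// ler_nat.
have iD' : i%:R * dist_pd A B <= n%:R * dist_pd A B by rewrite ler_wpM2r// ler_nat.
have -> : (2 * n)%:R * dist_pd A B = n%:R * dist_pd A B + n%:R * dist_pd A B.
  by rewrite natrM -mulrA mulr_natl mulr2n.
move: h1 h2 h3 h4 iD iD'; clear.
move: (ln (topprod i.+1 a)) (ln (topprod i.+1 b)) (ln (topprod i a)) (ln (topprod i b)).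
move: (i.+1%:R * _) (i%:R * _) (n%:R * _) => x y z p q r s; rewrite ler_norml; lra.
Qed.

(** A factor 2 n bounds each logarithmic coordinate and a factor n passes to the norm; the added 1
    gives a constant at least 1 even for n = 0. *)
Definition kap (R : realType) (n : nat) : R := (2 * n * n).+1%:R.

Lemma kap_ge1 (R : realType) (n : nat) : 1 <= kap R n.
Proof. by rewrite ler1n. Qed.

(** A congruence takes C to the identity. Distances to it are norms of logarithms of eigenvalues,
    which [ln_svd_lip] with E = 1 compares. *)
Lemma dist_pd_quasi (R : realType) (n : nat) (A B C : posdefmx R n) :
  `|dist_pd A C - dist_pd B C| <= kap R n * dist_pd A B.
Proof.
wlog suff hw : A B / dist_pd A C - dist_pd B C <= kap R n * dist_pd A B.
  by rewrite ler_norml lerNl opprB hw andbT [dist_pd A B]dist_pd_sym hw.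
have [N uN CE] := posdef_factor (posdefmxP C).
have uiN : invmx N \in unitmx by rewrite unitmx_inv.
pose inn (X : posdefmx R n) : posdefmx R n := PosDefMx (posdef_congr uiN (posdefmxP X)).
have iC : posdefmx_val (inn C) = 1%:M.
  by rewrite /= CE !mulmxA -trmx_mul mulmxV// trmx1 mul1mx mulmxV.
have di X Y : dist_pd (inn X) (inn Y) = dist_pd X Y by apply: (dist_pd_congr (G := invmx N)).
rewrite -(di A) -(di B) -(di A B); move: (inn A) (inn B) (inn C) iC.
clear => A B C CE.
have dC (X : posdefmx R n) : exists (M : 'M[R]_n) (d : 'rV[R]_n), [/\ M \in unitmx,
    posdefmx_val X = M^T *m M, svd (M *m 1%:M *m M^T) d & dist_pd X C = lnnorm d].
  have [U [M [d [UU XE uM XM sM]]]] := posdef_spectral_svd (posdefmxP X).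
  exists M, d; split=> //; rewrite dist_pd_sym; apply: (dist_pdE (M := U^T)).
    by rewrite CE trmxK UU.
  by rewrite trmxK.
have [M [a [uM AM sa ->]]] := dC A; have [M' [b [uM' BM sb ->]]] := dC B.
have D0 := dist_pd_ge0 A B.
have := lnnorm_sub_le (a := a) (b := b) _ (fun i => ln_svd_lip i uM uM' AM BM sa sb).
move=> /(_ (mulr_ge0 (ler0n _ _) D0)) h; apply: le_trans h _.
by rewrite mulrA ler_wpM2r// -natrM ler_nat mulnC leqnSn.
Qed.

(* Common description of both maps of the theorem: [E] is the identity for the
   eigenvalue map and [J] for the extended symplectic eigenvalue map. *)
Definition spectral_map (R : realType) (n : nat) (E : 'M[R]_n)
    (v : posdefmx R n -> posrv R n) : Prop :=
  forall A, exists N : 'M[R]_n, [/\ N \in unitmx, posdefmx_val A = N^T *m N &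
    svd (N *m E *m N^T) (v A)].

Lemma spectral_map_lip (R : realType) (n : nat) (E : 'M[R]_n)
    (v : posdefmx R n -> posrv R n) (A B : posdefmx R n) : spectral_map E v ->
  dist_pos (v A) (v B) <= kap R n * dist_pd A B.
Proof.
move=> sv; have [N [uN AE sa]] := sv A; have [N' [uN' BE sb]] := sv B.
have D0 := dist_pd_ge0 A B.
have r0 : 0 <= kap R n * dist_pd A B by rewrite mulr_ge0// ler0n.
rewrite /dist_pos -(ger0_norm r0) -sqrtr_sqr ler_wsqrtr//.
apply: le_trans (_ : \sum_(i < n) ((2 * n)%:R * dist_pd A B) ^+ 2 <= _).
  apply: ler_sum => i _; rewrite -[leLHS]real_normK ?num_real// ler_sqr ?nnegrE ?mulr_ge0//.
  exact: (ln_svd_lip i uN uN' AE BE sa sb).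
rewrite sumr_const card_ord -[leLHS]mulr_natl !exprMn mulrA ler_wpM2r ?sqr_ge0//.
rewrite /kap -!natrX -natrM ler_nat.
have : (2 * n * n <= (2 * n * n).+1)%N by [].
case: n {sv N uN AE sa N' uN' BE sb D0 r0 E v A B} => [|n] h; first by rewrite mul0n.
apply: leq_trans (_ : (2 * n.+1 * n.+1) ^ 2 <= _)%N; last by rewrite leq_exp2r.
by rewrite [in leqRHS]expnMn mulnC leq_mul2l; apply/orP; right; rewrite expnS leq_pmulr.
Qed.

(** * Barycenters as minimizers over the probability space *)

(* Weakening of the triangle inequality by a constant factor [c]; it is all that
   the argument needs, so that the true triangle inequality for [dist_pd], which
   lies deeper, is never proved. *)
Definition quasi_metric (R : realType) (T : Type) (dist : T -> T -> R) (c : R) : Prop :=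
  [/\ 1 <= c, forall x y, 0 <= dist x y, forall x y, dist x y = dist y x &
      forall x y z, `|dist x z - dist y z| <= c * dist x y].

Lemma lip_borel_real (R : realType) (T : pointedType) (dist : T -> T -> R) (c : R)
    (f : T -> R) :
  0 <= c -> (forall x y, `|f x - f y| <= c * dist x y) ->
  measurable_fun [set: borel dist] f.
Proof.
move=> c0 fc; have cc : 0 < c + 1 by lra.
apply: (measurability _ (RGenOInfty.measurableE R)) => // _ [_ [r ->] <-].
rewrite setTI; apply: sub_sigma_algebra => x /=; rewrite in_itv /= andbT => rx.
(* Dividing by c + 1 rather than c covers c = 0. *)
exists ((f x - r) / (c + 1)); first by rewrite divr_gt0 ?subr_gt0.
move=> y /=; rewrite in_itv /= andbT ltr_pdivlMr// => h.
have h1 := le_trans (ler_norm _) (fc x y).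
have [d0|d0] := leP 0 (dist x y); first by rewrite mulrDr mulr1 in h; lra.
suff : c * dist x y <= 0 by lra.
by rewrite mulr_ge0_le0// ltW.
Qed.

Lemma lip_borel (R : realType) (T T' : pointedType) (dist : T -> T -> R)
    (dist' : T' -> T' -> R) (c : R) (F : T -> T') :
  0 <= c -> (forall x y, dist' (F x) (F y) <= c * dist x y) ->
  measurable_fun [set: borel dist] (F : borel dist -> borel dist').
Proof.
move=> c0 Fc; have cc : 0 < c + 1 by lra.
apply: (@measurability _ _ (borel dist) (borel dist') setT F (dist_open dist') erefl) => _ [U oU <-].
rewrite setTI; apply: sub_sigma_algebra => x /= /oU[r r0 rU].
exists (r / (c + 1)); first by rewrite divr_gt0.
move=> y /= h; apply: rU => /=; apply: le_lt_trans (Fc x y) _.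
move: h; rewrite ltr_pdivlMr// mulrDr mulr1 => h.
have [d0|d0] := leP 0 (dist x y); first lra.
by apply: le_lt_trans r0; rewrite mulr_ge0_le0// ltW.
Qed.

(** * Integrable real functions on the probability space *)

Definition L1fun (R : realType) (d : measure_display) (Omega : measurableType d)
    (P : probability Omega R) (f : Omega -> R) : Prop :=
  P.-integrable setT (EFin \o f).

Lemma L1_meas (R : realType) (d : measure_display) (Omega : measurableType d)
    (P : probability Omega R) (f : Omega -> R) : L1fun P f -> measurable_fun setT f.
Proof. by move=> /integrableP[/measurable_EFinP]. Qed.

Lemma L1_cst (R : realType) (d : measure_display) (Omega : measurableType d)
    (P : probability Omega R) (r : R) : L1fun P (fun=> r).
Proof. exact: finite_measure_integrable_cst. Qed.

Lemma L1D (R : realType) (d : measure_display) (Omega : measurableType d)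
    (P : probability Omega R) (f g : Omega -> R) :
  L1fun P f -> L1fun P g -> L1fun P (fun w => f w + g w).
Proof. by move=> fL gL; exact: (integrableD measurableT fL gL). Qed.

Lemma L1Z (R : realType) (d : measure_display) (Omega : measurableType d)
    (P : probability Omega R) (r : R) (f : Omega -> R) :
  L1fun P f -> L1fun P (fun w => r * f w).
Proof. by move=> fL; exact: (integrableZl measurableT r fL). Qed.

Lemma L1B (R : realType) (d : measure_display) (Omega : measurableType d)
    (P : probability Omega R) (f g : Omega -> R) :
  L1fun P f -> L1fun P g -> L1fun P (fun w => f w - g w).
Proof. by move=> fL gL; exact: (integrableB measurableT fL gL). Qed.

Lemma L1_sum (R : realType) (d : measure_display) (Omega : measurableType d)
    (P : probability Omega R) (I : Type) (r : seq I) (Q : pred I) (f : I -> Omega -> R) :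
  (forall i, L1fun P (f i)) -> L1fun P (fun w => \sum_(i <- r | Q i) f i w).
Proof.
move=> fL; elim: r => [|i r IH].
  have -> : (fun w => \sum_(i <- [::] | Q i) f i w) = fun=> 0.
    by apply/funext => w; rewrite big_nil.
  exact: L1_cst.
have -> : (fun w => \sum_(j <- i :: r | Q j) f j w) =
    if Q i then fun w => f i w + \sum_(j <- r | Q j) f j w
    else fun w => \sum_(j <- r | Q j) f j w.
  by apply/funext => w; rewrite big_cons; case: ifP.
by case: ifP => _ //; apply: L1D.
Qed.

Lemma L1_le (R : realType) (d : measure_display) (Omega : measurableType d)
    (P : probability Omega R) (f g : Omega -> R) :
  measurable_fun setT f -> (forall w, `|f w| <= g w) -> L1fun P g -> L1fun P f.
Proof.
move=> mf fg gL; apply: (le_integrable _ _ _ gL) => //; first exact/measurable_EFinP.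
by move=> w _ /=; rewrite lee_fin (le_trans (fg w))// ler_norm.
Qed.

Lemma RI_cst (R : realType) (d : measure_display) (Omega : measurableType d)
    (P : probability Omega R) (r : R) : \int[P]_w r = r.
Proof.
rewrite Rintegral_cst// (_ : fine _ = 1) ?mulr1//.
exact: (congr1 fine (probability_setT P)).
Qed.

Lemma RI_sum (R : realType) (d : measure_display) (Omega : measurableType d)
    (P : probability Omega R) (I : Type) (r : seq I) (Q : pred I) (f : I -> Omega -> R) :
  (forall i, L1fun P (f i)) ->
  \int[P]_w (\sum_(i <- r | Q i) f i w) = \sum_(i <- r | Q i) \int[P]_w f i w.
Proof.
move=> fL; elim: r => [|i r IH].
  rewrite big_nil -[RHS](RI_cst P 0); apply: eq_Rintegral => w _.
  by rewrite big_nil.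
transitivity (\int[P]_w (if Q i then f i w + \sum_(j <- r | Q j) f j w
    else \sum_(j <- r | Q j) f j w)).
  by apply: eq_Rintegral => w _; rewrite big_cons.
rewrite big_cons; case: ifP => _ //.
by rewrite RintegralD ?IH//; [exact: fL | exact: L1_sum].
Qed.

Lemma quasi_sq_le (R : realType) (T : Type) (dist : T -> T -> R) (c : R) (x y a : T) :
  quasi_metric dist c ->
  `|dist x a ^+ 2 - dist y a ^+ 2| <= c * dist x y * (2 * dist y a + c * dist x y).
Proof.
case=> c1 d0 _ q; rewrite subr_sqr normrM; apply: ler_pM => //.
rewrite ger0_norm ?addr_ge0//.
by have := le_trans (ler_norm _) (q x y a); lra.
Qed.

Lemma L1_dist (R : realType) (T : pointedType) (dist : T -> T -> R) (c : R)
    (d : measure_display) (Omega : measurableType d) (P : probability Omega R)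
    (phi : Omega -> borel dist) (z : T) :
  quasi_metric dist c -> L1map P phi -> L1fun P (fun w => dist z (phi w)).
Proof.
move=> [c1 d0 ds dq] [mphi [x xfin]].
have md y : measurable_fun setT (fun w => dist y (phi w)).
  apply: (measurableT_comp _ mphi); apply: (lip_borel_real (c := c)); first lra.
  by move=> a b; rewrite ![dist y _]ds.
have xL : L1fun P (fun w => dist x (phi w)).
  apply/integrableP; split; first exact/measurable_EFinP.
  apply: le_lt_trans xfin; rewrite le_eqVlt; apply/orP; left; apply/eqP.
  by apply: eq_integral => w _ /=; rewrite ger0_norm// ds.
apply: (L1_le (md z) _ (L1D xL (L1_cst P (c * dist z x)))) => w.
rewrite ger0_norm//; have := le_trans (ler_norm _) (dq z x (phi w)); lra.
Qed.

Lemma L1_distsq (R : realType) (T : pointedType) (dist : T -> T -> R) (c : R)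
    (d : measure_display) (Omega : measurableType d) (P : probability Omega R)
    (phi : Omega -> borel dist) (y z : T) :
  quasi_metric dist c -> L1map P phi ->
  L1fun P (fun w => dist z (phi w) ^+ 2 - dist y (phi w) ^+ 2).
Proof.
move=> Q phiL; have yL := L1_dist y Q phiL; have zL := L1_dist z Q phiL.
apply: (L1_le _ _ (L1Z (c * dist z y) (L1D (L1Z 2 yL) (L1_cst P (c * dist z y))))).
  apply: measurable_funB; apply: measurable_funX; [exact: (L1_meas zL)|exact: (L1_meas yL)].
by move=> w; exact: quasi_sq_le.
Qed.

(** Differences of squared distances are integrable for any two base points, so the base point can
    be moved to z itself. *)
Lemma is_barycenter_pushforward (R : realType) (T : pointedType) (dist : T -> T -> R) (c : R)
    (d : measure_display) (Omega : measurableType d) (P : probability Omega R)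
    (phi : Omega -> borel dist) (z : T) :
  quasi_metric dist c -> L1map P phi ->
  is_barycenter (pushforward P phi) z <->
  forall x, 0 <= \int[P]_w (dist x (phi w) ^+ 2 - dist z (phi w) ^+ 2).
Proof.
move=> Q phiL; have [mphi _] := phiL; have [c1 d0 ds dq] := Q.
have md y : measurable_fun [set: borel dist] (fun a => dist y a).
  by apply: (lip_borel_real (c := c)); [lra | move=> a b; rewrite ![dist y _]ds].
have intE x y : (\int[pushforward P phi]_(a in [set: borel dist])
     (dist x a ^+ 2 - dist y a ^+ 2)%:E =
   (\int[P]_w (dist x (phi w) ^+ 2 - dist y (phi w) ^+ 2))%:E)%E.
  rewrite integral_pushforward//.
  - by rewrite preimage_setT /Rintegral fineK//; apply: integrable_fin_num => //;
      exact: (L1_distsq y x Q phiL).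
  - apply/measurable_EFinP; apply: measurable_funB; apply: measurable_funX; exact: md.
  - by rewrite preimage_setT; exact: (L1_distsq y x Q phiL).
split=> h.
  move=> x; have := h z x; rewrite !intE lee_fin.
  suff -> : \int[P]_w (dist z (phi w) ^+ 2 - dist z (phi w) ^+ 2) = 0 by [].
  by under eq_Rintegral do rewrite subrr; rewrite RI_cst.
move=> y x; rewrite !intE lee_fin -subr_ge0 -RintegralB//; last 2 first.
- exact: (L1_distsq y x Q phiL).
- exact: (L1_distsq y z Q phiL).
suff -> : \int[P]_w (dist x (phi w) ^+ 2 - dist y (phi w) ^+ 2 -
    (dist z (phi w) ^+ 2 - dist y (phi w) ^+ 2)) =
  \int[P]_w (dist x (phi w) ^+ 2 - dist z (phi w) ^+ 2) by exact: h.
by apply: eq_Rintegral => w _; ring.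
Qed.

(** * Barycenters of positive vectors *)

Lemma posrv_gt0 (R : realType) (n : nat) (a : posrv R n) (i : 'I_n) : 0 < a 0 i.
Proof. exact: (forallP (posrvP a)). Qed.

Lemma dist_pos_sq (R : realType) (n : nat) (a b : posrv R n) :
  dist_pos a b ^+ 2 = \sum_i (ln (a 0 i) - ln (b 0 i)) ^+ 2.
Proof. by rewrite /dist_pos sqr_sqrtr// sumr_ge0// => i _; exact: sqr_ge0. Qed.

Lemma dist_pos_coord (R : realType) (n : nat) (a b : posrv R n) (i : 'I_n) :
  `|ln (a 0 i) - ln (b 0 i)| <= dist_pos a b.
Proof.
rewrite /dist_pos -sqrtr_sqr ler_wsqrtr// (bigD1 i)//= lerDl.
by apply: sumr_ge0 => j _; exact: sqr_ge0.
Qed.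

Lemma dist_pos_quasi (R : realType) (n : nat) :
  quasi_metric (@dist_pos R n) (n.+1%:R).
Proof.
have quot (a b : posrv R n) : dist_pos a b = lnnorm (\row_i (a 0 i / b 0 i)).
  rewrite /dist_pos /lnnorm; congr Num.sqrt; apply: eq_bigr => i _.
  by rewrite mxE ln_div ?posrE ?posrv_gt0.
split; first by rewrite ler1n.
- by move=> a b; exact: sqrtr_ge0.
- move=> a b; rewrite /dist_pos; congr Num.sqrt; apply: eq_bigr => i _.
  by rewrite -sqrrN opprB.
move=> a b c; have d0 : 0 <= dist_pos a b by exact: sqrtr_ge0.
have h x y : (forall i : 'I_n, `|ln ((x : posrv R n) 0 i) - ln ((y : posrv R n) 0 i)| <= dist_pos a b) ->
    dist_pos x c - dist_pos y c <= n.+1%:R * dist_pos a b.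
  move=> xy; rewrite (quot x c) (quot y c); apply: le_trans (lnnorm_sub_le d0 _) _.
    move=> i; rewrite !mxE !ln_div ?posrE ?posrv_gt0// opprB addrA subrK.
    exact: xy.
  by rewrite ler_wpM2r// ler_nat.
rewrite ler_norml lerNl opprB !h//; first exact: dist_pos_coord.
by move=> i; rewrite distrC; exact: dist_pos_coord.
Qed.

Lemma L1_ln_coord (R : realType) (n : nat) (d : measure_display)
    (Omega : measurableType d) (P : probability Omega R)
    (psi : Omega -> borel (@dist_pos R n)) (i : 'I_n) :
  L1map P psi -> L1fun P (fun w => ln ((psi w : posrv R n) 0 i)).
Proof.
move=> psiL; have [mpsi _] := psiL.
pose e : posrv R n := PosRv (posrv1_subproof R n).
apply: (L1_le _ _ (L1_dist e (@dist_pos_quasi R n) psiL)).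
  apply: (measurableT_comp (f := fun a : borel (@dist_pos R n) => ln ((a : posrv R n) 0 i)) _ mpsi).
  apply: (lip_borel_real (c := 1)) => // a b; rewrite mul1r; exact: dist_pos_coord.
move=> w; have := dist_pos_coord (psi w) e i; rewrite mxE ln1 subr0.
by have [_ _ -> _] := @dist_pos_quasi R n.
Qed.

(** In logarithmic coordinates the functional is quadratic with minimum at the mean m. Testing a
    minimizer z against exp m gives sum (ln z_j - m_j)^2 <= 0, so every choice made by [barycenter]
    has these coordinates. *)
Lemma geom_integral_pos (R : realType) (n : nat) (d : measure_display)
    (Omega : measurableType d) (P : probability Omega R)
    (psi : Omega -> borel (@dist_pos R n)) (i : 'I_n) :
  L1map P psi ->
  ln ((geom_integral (dist := @dist_pos R n) P psi) 0 i) =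
  \int[P]_w ln ((psi w : posrv R n) 0 i).
Proof.
move=> psiL; have Q := @dist_pos_quasi R n.
have lnL j := L1_ln_coord j psiL.
pose m j := \int[P]_w ln ((psi w : posrv R n) 0 j).
have intE (x z : posrv R n) :
    \int[P]_w (dist_pos x (psi w) ^+ 2 - dist_pos z (psi w) ^+ 2) =
    \sum_i (ln (x 0 i) - ln (z 0 i)) * (ln (x 0 i) + ln (z 0 i) - 2 * m i).
  have termL j : L1fun P (fun w => (ln (x 0 j) - ln (z 0 j)) *
      (ln (x 0 j) + ln (z 0 j) - 2 * ln ((psi w : posrv R n) 0 j))).
    by apply: L1Z; apply: L1B; [exact: L1_cst|exact: L1Z].
  transitivity (\int[P]_w \sum_j (ln (x 0 j) - ln (z 0 j)) *
      (ln (x 0 j) + ln (z 0 j) - 2 * ln ((psi w : posrv R n) 0 j))).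
    apply: eq_Rintegral => w _; rewrite !dist_pos_sq -sumrB.
    by apply: eq_bigr => j _; ring.
  rewrite RI_sum//; apply: eq_bigr => j _.
  rewrite RintegralZl//; last by apply: L1B; [exact: L1_cst|exact: L1Z].
  rewrite RintegralB//; [|exact: L1_cst|exact: L1Z].
  by rewrite RI_cst RintegralZl//; exact: lnL.
pose a0 : 'rV[R]_n := \row_i expR (m i).
have pa0 : [forall i, 0 < a0 0 i] by apply/forallP => j; rewrite mxE expR_gt0.
pose a := PosRv pa0.
have lna j : ln (a 0 j) = m j by rewrite mxE expRK.
rewrite /geom_integral /barycenter; case: xgetP => [z _ zb|]; last first.
  move/(_ a) => h; exfalso; apply: h; apply/(is_barycenter_pushforward _ Q psiL) => x.
  rewrite intE; apply: sumr_ge0 => j _; rewrite lna.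
  have -> : ln (x 0 j) + m j - 2 * m j = ln (x 0 j) - m j by ring.
  by rewrite -expr2 sqr_ge0.
move/(is_barycenter_pushforward _ Q psiL)/(_ a) : zb; rewrite intE => h.
have s0 : \sum_j (ln (z 0 j) - m j) ^+ 2 = 0.
  apply/le_anti; rewrite sumr_ge0 ?andbT; last by move=> j _; exact: sqr_ge0.
  rewrite -oppr_ge0; apply: le_trans h _; rewrite -sumrN le_eqVlt; apply/orP; left; apply/eqP.
  by apply: eq_bigr => j _; rewrite lna; ring.
move/eqP: s0; rewrite psumr_eq0; last by move=> j _; exact: sqr_ge0.
by move=> /allP/(_ i (mem_index_enum _)); rewrite sqrf_eq0 subr_eq0 => /eqP.
Qed.

(** * Existence of barycenters of positive definite matrices *)

Lemma dist_pd_quasi_metric (R : realType) (n : nat) :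
  quasi_metric (@dist_pd R n) (kap R n).
Proof.
split; [exact: kap_ge1|exact: dist_pd_ge0|exact: dist_pd_sym|exact: dist_pd_quasi].
Qed.

(** Here p and q are the distances of a sample point to the base point and to z, and r is the
    distance of z to the base point. The error is linear in p, so a finite first moment suffices to
    integrate. For r >= 4 c p the number q dominates; otherwise every term is controlled by r p. *)
Lemma coercive_arith (R : realType) (c r p q : R) :
  1 <= c -> 0 <= p -> 0 <= q -> 0 <= r -> `|q - p| <= c * r -> r - p <= c * q ->
  r ^+ 2 / (2 * c ^+ 2) - (c * (2 + 4 * c ^+ 2) + 2) * r * p <= q ^+ 2 - p ^+ 2.
Proof.
move=> c1 p0 q0 r0; rewrite ler_norml => /andP[h1 h2] h3.
have c0 : 0 < c by lra.
have c20 : 0 < 2 * c ^+ 2 by rewrite mulr_gt0 ?exprn_gt0.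
have K0 : 0 <= (c * (2 + 4 * c ^+ 2) + 2) * r * p.
  by rewrite mulr_ge0// mulr_ge0// addr_ge0// mulr_ge0 ?ltW// addr_gt0// mulr_gt0 ?exprn_gt0.
have [pr|pr] := leP (4 * c * p) r.
  have p4 : 4 * p <= r.
    by apply: le_trans pr; rewrite -mulrA ler_wpM2l// ler_peMl.
  have cq : 3 * r <= 4 * (c * q) by lra.
  have sq : 9 * r ^+ 2 <= 16 * (c * q) ^+ 2.
    have -> : 9 * r ^+ 2 = (3 * r) ^+ 2 by ring.
    have -> : 16 * (c * q) ^+ 2 = (4 * (c * q)) ^+ 2 by ring.
    by rewrite ler_sqr ?nnegrE// !mulr_ge0// ltW.
  have sp : 16 * (c * p) ^+ 2 <= r ^+ 2.
    have -> : 16 * (c * p) ^+ 2 = (4 * c * p) ^+ 2 by ring.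
    by rewrite ler_sqr ?nnegrE// !mulr_ge0// ltW.
  have : r ^+ 2 / (2 * c ^+ 2) <= q ^+ 2 - p ^+ 2; last by lra.
  rewrite ler_pdivrMr//.
  have -> : (q ^+ 2 - p ^+ 2) * (2 * c ^+ 2) = 2 * (c * q) ^+ 2 - 2 * (c * p) ^+ 2 by ring.
  lra.
have rp0 : 0 <= r * p by rewrite mulr_ge0.
have h4 : r ^+ 2 / (2 * c ^+ 2) <= 2 * r * p.
  rewrite ler_pdivrMr//.
  have -> : r ^+ 2 = r * r by [].
  have -> : 2 * r * p * (2 * c ^+ 2) = r * (4 * c * p * c) by ring.
  rewrite ler_wpM2l//; apply: le_trans (ltW pr) _; rewrite ler_peMr// !mulr_ge0// ltW//.
have h5 : - (c * (2 + 4 * c ^+ 2) * r * p) <= q ^+ 2 - p ^+ 2.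
  have cr0 : 0 <= c * r by rewrite mulr_ge0// ltW.
  have s0 : 0 <= q + p by rewrite addr_ge0.
  have e1 : - (c * r) * (q + p) <= q ^+ 2 - p ^+ 2.
    by rewrite subr_sqr ler_wpM2r.
  apply: le_trans e1; rewrite -mulNr.
  have e2 : q + p <= (2 + 4 * c ^+ 2) * p.
    have : c * r <= c * (4 * c * p) by rewrite ler_wpM2l// ltW.
    by rewrite (_ : c * (4 * c * p) = 4 * c ^+ 2 * p); [lra|ring].
  have := ler_wpM2l cr0 e2.
  by rewrite (_ : c * r * ((2 + 4 * c ^+ 2) * p) = c * (2 + 4 * c ^+ 2) * r * p); [lra|ring].
have -> : (c * (2 + 4 * c ^+ 2) + 2) * r * p = c * (2 + 4 * c ^+ 2) * r * p + 2 * r * p by ring.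
lra.
Qed.

Lemma ln_sq_le (R : realType) (x : R) : `|x - 1| <= 2^-1 -> ln x ^+ 2 <= 4 * (x - 1) ^+ 2.
Proof.
rewrite ler_norml => /andP[h1 h2]; have x0 : 0 < x by lra.
have l1 : ln x <= x - 1.
  by have := @le_ln1Dx R (x - 1); rewrite [1 + _]addrC subrK; apply; lra.
have l2 : 1 - x^-1 <= ln x.
  have := @le_ln1Dx R (x^-1 - 1); rewrite [1 + _]addrC subrK lnV ?posrE// => h.
  by rewrite -lerN2 opprB; apply: h; have : 0 < x^-1; [rewrite invr_gt0|lra].
have xi : x^-1 <= 2 by rewrite invf_ple ?posrE//; lra.
have xxi : x * x^-1 = 1 by rewrite divff// gt_eqF.
have -> : 4 * (x - 1) ^+ 2 = (2 * (x - 1)) ^+ 2 by ring.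
rewrite -[leLHS]real_normK ?num_real// -[leRHS]real_normK ?num_real//.
rewrite ler_sqr ?nnegrE// ler_norml.
have [x1|x1] := leP 1 x.
  rewrite ger0_norm; last lra.
  have xi1 : x^-1 <= 1 by rewrite invf_ple ?posrE// invr1.
  by apply/andP; split; lra.
rewrite ler0_norm; last lra.
have xi2 : x^-1 - 1 <= 2 * (1 - x).
  have -> : x^-1 - 1 = x^-1 * (1 - x) by rewrite mulrBr mulr1 [x^-1 * x]mulrC xxi.
  by rewrite ler_wpM2r//; lra.
by apply/andP; split; lra.
Qed.

(** Reduces continuity of the distance to that of the entries of C. The threshold 1/4 keeps each
    eigenvalue of C within 1/2 of 1, as [ln_sq_le] asks. *)
Lemma dist_pd_near (R : realType) (n : nat) (A B : posdefmx R n) (N C : 'M[R]_n) :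
  N \in unitmx -> posdefmx_val A = N^T *m N -> posdefmx_val B = N^T *m C *m N ->
  C^T = C -> \tr ((C - 1%:M) *m (C - 1%:M)) <= 4^-1 ->
  dist_pd A B ^+ 2 <= 4 * \tr ((C - 1%:M) *m (C - 1%:M)).
Proof.
move=> uN AE BE sC; have [U [d [UU CE]]] := sym_spectral sC.
have -> : C - 1%:M = U *m diag_mx (\row_i (d 0 i - 1)) *m U^T.
  rewrite CE -UU -{3}[U]mulmx1 -mulmxBl -mulmxBr; congr (_ *m _ *m _).
  by apply/matrixP => i j; rewrite !mxE; have [->|] := eqVneq i j; rewrite ?mulr1n// !mulr0n subrr.
rewrite conj_diagM// -mulmxA mxtrace_mulC -mulmxA (mulmx1C UU) mulmx1 mxtrace_diag.
have -> : dist_pd A B = lnnorm d.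
  apply: (dist_pdE (M := U^T *m N)).
    by rewrite trmx_mul trmxK AE -mulmxA [U *m (_ *m _)]mulmxA UU mul1mx.
  by rewrite trmx_mul trmxK BE CE !mulmxA.
move=> h; rewrite lnnorm_sq big_distrr /=; apply: ler_sum => i _; rewrite !mxE -expr2.
apply: ln_sq_le; rewrite -ler_sqr ?nnegrE ?invr_ge0// real_normK ?num_real//.
apply: le_trans (_ : 4^-1 <= _); last first.
  by rewrite le_eqVlt; apply/orP; left; apply/eqP; field.
apply: le_trans h; rewrite (bigD1 i)//= !mxE -expr2 lerDl sumr_ge0// => j _.
by rewrite !mxE -expr2 sqr_ge0.
Qed.

(** * Entrywise continuity of matrix functions, and the parametrization by a box *)

Definition cont_mx (R : realType) (T : topologicalType) (p q : nat) (F : T -> 'M[R]_(p, q)) : Prop :=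
  forall i j, continuous (fun x => F x i j).

Lemma continuous_bigsum (R : realType) (T : topologicalType) (k : nat) (f : 'I_k -> T -> R) :
  (forall i, continuous (f i)) -> continuous (fun x => \sum_i f i x).
Proof.
move=> fc; elim: (index_enum _) => [|i r IH].
  have -> : (fun x => \sum_(i <- [::]) f i x) = fun=> 0 by apply/funext => x; rewrite big_nil.
  by move=> x; apply: cst_continuous.
have -> : (fun x => \sum_(j <- i :: r) f j x) = fun x => f i x + \sum_(j <- r) f j x.
  by apply/funext => x; rewrite big_cons.
by move=> x; apply: cvgD; [exact: fc|exact: IH].
Qed.

Lemma cont_mx_cst (R : realType) (T : topologicalType) (p q : nat) (A : 'M[R]_(p, q)) :
  cont_mx (fun _ : T => A).
Proof. by move=> i j x; apply: cst_continuous. Qed.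

Lemma cont_mxD (R : realType) (T : topologicalType) (p q : nat) (F G : T -> 'M[R]_(p, q)) :
  cont_mx F -> cont_mx G -> cont_mx (fun x => F x + G x).
Proof.
move=> Fc Gc i j; have -> : (fun x => (F x + G x) i j) = fun x => F x i j + G x i j.
  by apply/funext => x; rewrite mxE.
by move=> x; apply: cvgD; [exact: Fc|exact: Gc].
Qed.

Lemma cont_mxM (R : realType) (T : topologicalType) (p q r : nat) (F : T -> 'M[R]_(p, q))
    (G : T -> 'M[R]_(q, r)) :
  cont_mx F -> cont_mx G -> cont_mx (fun x => F x *m G x).
Proof.
move=> Fc Gc i j; have -> : (fun x => (F x *m G x) i j) = fun x => \sum_k F x i k * G x k j.
  by apply/funext => x; rewrite mxE.
apply: continuous_bigsum => k x; apply: cvgM; [exact: Fc|exact: Gc].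
Qed.

Lemma cont_mxT (R : realType) (T : topologicalType) (p q : nat) (F : T -> 'M[R]_(p, q)) :
  cont_mx F -> cont_mx (fun x => (F x)^T).
Proof.
move=> Fc i j; have -> : (fun x => (F x)^T i j) = fun x => F x j i.
  by apply/funext => x; rewrite mxE.
exact: Fc.
Qed.

Lemma cont_vec_mx (R : realType) (p q : nat) :
  @cont_mx R 'rV[R]_(p * q) p q (@vec_mx R p q).
Proof.
move=> i j; have -> : (fun x : 'rV[R]_(p * q) => vec_mx x i j) = fun x => x 0 (mxvec_index i j).
  by apply/funext => x; rewrite mxE.
exact: coord_continuous.
Qed.

Lemma posdef_shift (R : realType) (n : nat) (e : R) (M : 'M[R]_n) :
  0 < e -> is_posdef (e%:M + M^T *m M).
Proof.
move=> e0; apply/posdefP; split.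
  by rewrite linearD /= tr_scalar_mx trmx_mul trmxK.
move=> v v0; rewrite mulmxDr mulmxDl mxDE mul_mx_scalar -scalemxAl mxZE.
apply: ltr_pwDl.
  by rewrite mulr_gt0//; have := @rv_sqnorm_gt0 R n v^T; rewrite trmxK; apply; rewrite trmx_eq0.
rewrite mulmxA -mulmxA -trmx_mul; have := rv_sqnorm_ge0 (M *m v)^T.
by rewrite trmxK.
Qed.

(* The maps [x |-> e + x^T x] parametrize matrices bounded away from the boundary
   of the cone by vectors of a box, to which the extreme value theorem applies. *)
Definition shift_pd (R : realType) (n : nat) (e : R) (e0 : 0 < e) (x : 'rV[R]_(n * n)) :
  posdefmx R n := PosDefMx (posdef_shift (vec_mx x) e0).

Definition posdefmx1 (R : realType) (n : nat) : posdefmx R n := PosDefMx (is_posdef1 R n).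

(** Eigenvalues of Z lie in [e^-r, e^r], so Z - e is positive for e = e^-r / 2. Its factor (d -
    e)^(1/2) U^T has entries at most e^(r/2) <= e^r in absolute value. *)
Lemma shift_pd_surj (R : realType) (n : nat) (r : R) (e0 : 0 < expR (- r) / 2)
    (Z : posdefmx R n) : 0 <= r ->
  dist_pd (posdefmx1 R n) Z <= r ->
  exists2 x : 'rV[R]_(n * n), (forall i, x 0 i \in `[- expR r, expR r]) &
    shift_pd e0 x = Z.
Proof.
move=> r0; have [U [d [UU ZE _ d0]]] := posdef_spectral (posdefmxP Z).
have -> : dist_pd (posdefmx1 R n) Z = lnnorm d.
  by apply: (dist_pdE (M := U^T)); rewrite /= trmxK ?UU.
move=> dr; set e := expR (- r) / 2 in e0 *.
have lnr i : `|ln (d 0 i)| <= r by apply: le_trans dr; exact: lnnorm_coord.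
have dlo i : expR (- r) <= d 0 i.
  rewrite -[leRHS]lnK ?posrE// ler_expR.
  by have := lnr i; rewrite ler_norml => /andP[].
have dhi i : d 0 i <= expR r.
  rewrite -[leLHS]lnK ?posrE// ler_expR.
  by have := lnr i; rewrite ler_norml => /andP[].
have de i : 0 <= d 0 i - e.
  by rewrite /e; have := dlo i; have := expR_gt0 (- r); lra.
pose s : 'rV[R]_n := \row_i Num.sqrt (d 0 i - e).
exists (mxvec (diag_mx s *m U^T)); last first.
  apply/val_inj => /=; rewrite mxvecK trmx_mul trmxK tr_diag_mx.
  rewrite -mulmxA [diag_mx s *m (_ *m _)]mulmxA diag_mxM ZE.
  have -> : e%:M = U *m (e%:M *m U^T) by rewrite mul_scalar_mx -scalemxAr UU scalemx1.
  rewrite -mulmxDr -mulmxDl -mulmxA; congr (_ *m (_ *m _)).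
  apply/matrixP => i j; rewrite !mxE; have [->|] := eqVneq i j; rewrite ?mulr0n ?addr0//.
  by rewrite !mulr1n -expr2 sqr_sqrtr// addrC subrK.
move=> k; case/mxvec_indexP: k => i j; rewrite mxvecE mul_diag_mx !mxE.
have er1 : 1 <= expR r by rewrite -[leLHS]expR0 ler_expR.
rewrite in_itv /= -ler_norml normrM.
apply: le_trans (_ : Num.sqrt (d 0 i - e) * 1 <= _).
  rewrite ger0_norm ?sqrtr_ge0// ler_wpM2l ?sqrtr_ge0//.
  rewrite -[leRHS]normr1 -ler_sqr ?nnegrE// !real_normK ?num_real// expr1n.
  rewrite -(orthogonal_sqsum_row j UU) (bigD1 i)//= lerDl sumr_ge0// => k _.
  exact: sqr_ge0.
rewrite mulr1 -[leRHS]ger0_norm ?expR_ge0// -sqrtr_sqr ler_wsqrtr//.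
apply: le_trans (_ : expR r <= _); first by have := dhi i; lra.
by rewrite -[leLHS]mulr1 expr2 ler_pM2l ?expR_gt0.
Qed.

Lemma shift_pd_continuous (R : realType) (n : nat) (e : R) (e0 : 0 < e)
    (x : 'rV[R]_(n * n)) (eps : R) : 0 < eps ->
  \forall y \near x, dist_pd (shift_pd e0 x) (shift_pd e0 y) < eps.
Proof.
move=> eps0; set Z := shift_pd e0 x; have [N uN ZE] := posdef_factor (posdefmxP Z).
pose C (y : 'rV[R]_(n * n)) : 'M[R]_n :=
  (invmx N)^T *m (e%:M + (vec_mx y)^T *m vec_mx y) *m invmx N.
pose q y := \tr ((C y - 1%:M) *m (C y - 1%:M)).
have cC : cont_mx C.
  apply: cont_mxM; last exact: cont_mx_cst.
  apply: cont_mxM; first exact: cont_mx_cst.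
  apply: cont_mxD; first exact: cont_mx_cst.
  by apply: cont_mxM; [apply: cont_mxT|]; exact: cont_vec_mx.
have cq : continuous q.
  apply: continuous_bigsum => i.
  have cC1 : cont_mx (fun y => C y - 1%:M) by apply: cont_mxD => //; exact: cont_mx_cst.
  exact: (cont_mxM cC1 cC1).
have Cx : C x = 1%:M.
  rewrite /C; have -> : e%:M + (vec_mx x)^T *m vec_mx x = N^T *m N by rewrite -ZE.
  by rewrite !mulmxA -trmx_mul mulmxV// trmx1 mul1mx mulmxV.
have qx : q x = 0 by rewrite /q Cx subrr mulmx0 linear0.
pose m := Num.min (4^-1) ((eps / 4) ^+ 2).
have m0 : 0 < m by rewrite lt_min invr_gt0 ltr0n /= exprn_gt0// divr_gt0.
have := cq x; move=> /cvgrPdist_lt/(_ _ m0); apply: filterS => y.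
rewrite -/(q y) -/(q x) qx sub0r normrN => /(le_lt_trans (ler_norm _)) qy.
have q4 : q y <= 4^-1 by apply: ltW; apply: lt_le_trans qy _; rewrite ge_min lexx.
have yE : posdefmx_val (shift_pd e0 y) = N^T *m C y *m N.
  by rewrite /C !mulmxA -trmx_mul mulVmx// trmx1 mul1mx -!mulmxA mulVmx// mulmx1.
have sC : (C y)^T = C y.
  by rewrite /C !trmx_mul trmxK linearD /= tr_scalar_mx trmx_mul trmxK mulmxA.
have h := dist_pd_near uN ZE yE sC q4.
rewrite -ltr_sqr ?nnegrE ?dist_pd_ge0 ?ltW//; apply: le_lt_trans h _.
have q5 : q y < (eps / 4) ^+ 2 by apply: lt_le_trans qy _; rewrite ge_min lexx orbT.
have : (eps / 4) ^+ 2 * 4 <= eps ^+ 2 by rewrite expr_div_n; have := sqr_ge0 eps; lra.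
rewrite -/(q y); lra.
Qed.

Lemma dist_pd_refl (R : realType) (n : nat) (A : posdefmx R n) : dist_pd A A = 0.
Proof.
have [N uN AE] := posdef_factor (posdefmxP A).
rewrite (dist_pdE (M := N) (d := const_mx 1) AE); last first.
  by rewrite diag_const1 ?mulmx1// => i; rewrite mxE.
by rewrite /lnnorm big1 ?sqrtr0// => i _; rewrite mxE ln1 expr0n.
Qed.

Lemma RI_le_norm (R : realType) (d : measure_display) (Omega : measurableType d)
    (P : probability Omega R) (f g : Omega -> R) :
  L1fun P f -> L1fun P g -> (forall w, `|f w| <= g w) -> `|\int[P]_w f w| <= \int[P]_w g w.
Proof.
move=> fL gL fg; apply: le_trans (le_normr_Rintegral measurableT fL) _.
by apply: le_Rintegral => //; exact: integrable_norm.
Qed.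

Lemma continuous_near (R : realType) (T : topologicalType) (f : T -> R) :
  (forall x eps, 0 < eps -> \forall y \near x, `|f x - f y| < eps) -> continuous f.
Proof. by move=> h x; apply/cvgrPdist_lt => eps; exact: h. Qed.

Lemma barycenter_pd_exists (R : realType) (n : nat) (d : measure_display)
    (Omega : measurableType d) (P : probability Omega R)
    (phi : Omega -> borel (@dist_pd R n)) :
  L1map P phi -> exists z, is_barycenter (pushforward P phi) z.
Proof.
move=> phiL; have Q := dist_pd_quasi_metric R n; have c1 := kap_ge1 R n.
have [_ d0 ds dq] := Q; set c := kap R n in c1 Q dq; clearbody c.
have c0 : 0 < c by lra.
pose I := posdefmx1 R n.
pose D z (w : Omega) := dist_pd z (phi w).
have DL z : L1fun P (D z) by exact: (L1_dist z Q phiL).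
have DDL y z : L1fun P (fun w => D z w ^+ 2 - D y w ^+ 2) by exact: (L1_distsq y z Q phiL).
pose F z := \int[P]_w (D z w ^+ 2 - D I w ^+ 2).
have FB y z : F y - F z = \int[P]_w (D y w ^+ 2 - D z w ^+ 2).
  rewrite /F -RintegralB//; [|exact: DDL|exact: DDL].
  by apply: eq_Rintegral => w _; ring.
have FI : F I = 0 by rewrite /F; under eq_Rintegral do rewrite subrr; rewrite RI_cst.
pose m := \int[P]_w D I w.
have m0 : 0 <= m by apply: Rintegral_ge0 => w _; exact: d0.
pose K := c * (2 + 4 * c ^+ 2) + 2.
have K0 : 0 < K by rewrite addr_gt0// mulr_gt0// addr_gt0// mulr_gt0// exprn_gt0.
have coer z : dist_pd z I ^+ 2 / (2 * c ^+ 2) - K * dist_pd z I * m <= F z.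
  have -> : dist_pd z I ^+ 2 / (2 * c ^+ 2) - K * dist_pd z I * m =
      \int[P]_w (dist_pd z I ^+ 2 / (2 * c ^+ 2) - K * dist_pd z I * D I w).
    rewrite RintegralB//; [|exact: L1_cst|by apply: L1Z; exact: DL].
    by rewrite RI_cst RintegralZl//; exact: DL.
  apply: le_Rintegral => //.
    by apply: L1B; [exact: L1_cst|apply: L1Z; exact: DL].
    exact: DDL.
  move=> w _; apply: coercive_arith; [exact: c1|exact: d0|exact: d0|exact: d0|exact: dq|].
  have := le_trans (ler_norm _) (dq z (phi w) I).
  by rewrite [dist_pd (phi w) I]ds.
(* The lower bound r^2 / (2 c^2) - K r m of [coer] vanishes at this radius and is nonnegative beyond
   it. *)
pose r := 2 * c ^+ 2 * K * m.
have r0 : 0 <= r by rewrite /r !mulr_ge0// ?exprn_ge0// ltW.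
have far z : r <= dist_pd I z -> 0 <= F z.
  rewrite ds => rz; apply: le_trans (coer z); rewrite subr_ge0 ler_pdivlMr; last first.
    by rewrite mulr_gt0// exprn_gt0.
  rewrite expr2 (_ : _ * _ * m * _ = dist_pd z I * r); last by rewrite /r; ring.
  by rewrite ler_wpM2l.
have e0 : 0 < expR (- r) / 2 by rewrite divr_gt0// expR_gt0.
pose A := [set x : 'rV[R]_(n * n) | forall i, x ord0 i \in `[- expR r, expR r]].
have cA : compact A.
  have -> : A = [set x : 'rV[R]_(n * n) | forall i, `[- expR r, expR r]%classic (x ord0 i)] by [].
  by apply: (@rV_compact _ _ (fun=> `[- expR r, expR r]%classic)) => _; exact: segment_compact.
have A0 : A !=set0.
  by exists 0 => i; rewrite mxE in_itv /= expR_ge0 andbT oppr_le0 expR_ge0.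
pose f x := F (shift_pd e0 x).
have cf : continuous (f : 'rV[R]_(n * n) -> R).
  apply: continuous_near => x eps eps0; set z := shift_pd e0 x; pose mz := \int[P]_w D z w.
  have mz0 : 0 <= mz by apply: Rintegral_ge0 => w _; exact: d0.
  (* For s <= 1 the increment of F is at most c s (2 mz + c s) <= s c (2 mz + c); the added 1 makes
     [B] positive. *)
  pose B := c * (2 * mz + c) + 1.
  have cB : 0 <= c * (2 * mz + c) by apply: mulr_ge0; lra.
  have B0 : 0 < B by rewrite /B; lra.
  pose t := Num.min 1 (eps / B).
  have t0 : 0 < t by rewrite lt_min ltr01 /= divr_gt0.
  have := shift_pd_continuous e0 x t0; apply: filterS => y yt.
  rewrite distrC /f FB; set s := dist_pd _ _ in yt.
  have s0 : 0 <= s by exact: d0.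
  have bL : L1fun P (fun w => c * s * (2 * D z w + c * s)).
    by apply: L1Z; apply: L1D; [apply: L1Z; exact: DL|exact: L1_cst].
  apply: le_lt_trans (RI_le_norm (DDL _ _) bL _) _.
    by move=> w; rewrite /s ds; exact: quasi_sq_le.
  rewrite RintegralZl//; last by apply: L1D; [apply: L1Z; exact: DL|exact: L1_cst].
  rewrite RintegralD//; [|apply: L1Z; exact: DL|exact: L1_cst].
  rewrite RI_cst RintegralZl//; last exact: DL.
  rewrite -/mz.
  have s1 : s < 1 by apply: lt_le_trans yt _; rewrite ge_min lexx.
  have sB : s * B < eps.
    by rewrite -ltr_pdivlMr//; apply: lt_le_trans yt _; rewrite ge_min lexx orbT.
  apply: le_lt_trans sB; rewrite [c * s]mulrC -mulrA ler_wpM2l//.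
  apply: le_trans (_ : c * (2 * mz + c) <= _); last by rewrite lerDl.
  have sc : s * c <= 1 * c by apply: ler_wpM2r; lra.
  by apply: ler_wpM2l; lra.
have [x xA xmin] := EVT_min_rV A0 cA (continuous_subspaceT cf).
exists (shift_pd e0 x); apply/(is_barycenter_pushforward _ Q phiL) => y.
rewrite -FB subr_ge0.
(* The box covers the ball of radius r around the identity, and outside that ball F >= 0 = F I, so
   the minimum on the box is global. *)
have near_ok z : dist_pd I z <= r -> F (shift_pd e0 x) <= F z.
  move=> zr; have [u uA <-] := shift_pd_surj e0 r0 zr.
  by apply: xmin; rewrite inE => i; exact: uA.
have [yr|/ltW ry] := leP (dist_pd I y) r; first exact: near_ok.
apply: le_trans (far _ ry); rewrite -FI; apply: near_ok.
by rewrite dist_pd_refl.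
Qed.

(** * The Karcher equation and the majorization *)

Lemma Rintegral_dominated0 (R : realType) (d : measure_display) (Omega : measurableType d)
    (P : probability Omega R) (f : nat -> Omega -> R) (g : Omega -> R) :
  (forall j, measurable_fun setT (f j)) -> (forall w, (fun j => f j w) @ \oo --> (0 : R)) ->
  L1fun P g -> (forall j w, `|f j w| <= g w) ->
  (fun j => \int[P]_w f j w) @ \oo --> (0 : R).
Proof.
move=> mf f0 gL fg.
have [] := @dominated_convergence _ _ _ P setT measurableT (fun j => EFin \o f j)
  (fun=> 0%E) (EFin \o g).
- by move=> j; apply/measurable_EFinP; exact: mf.
- exact: measurable_cst.
- apply: aeW => w _; apply: cvg_EFin; first by apply: nearW.
  exact: f0.
- exact: gL.
- by apply: aeW => w j _ /=; rewrite lee_fin.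
move=> _ _; rewrite integral0 => h.
exact: (fine_cvg h).
Qed.

(** With S = [rankup u s], the new point is N^T S^-2 N, relative to which N^T C N becomes S C S;
    [sqr_log_rankup_le] then applies. *)
Lemma dist_pd_variation (R : realType) (n : nat) (Z : posdefmx R n) (N : 'M[R]_n)
    (u : 'cV[R]_n) (s : R) :
  N \in unitmx -> posdefmx_val Z = N^T *m N -> u^T *m u = 1%:M -> `|s| <= 2^-1 ->
  exists2 Zs : posdefmx R n, dist_pd Zs Z <= 6 * `|s| &
    forall (A : posdefmx R n) (Q : 'M[R]_n) (c : 'rV[R]_n),
      Q *m Q^T = 1%:M -> (forall i, 0 < c 0 i) ->
      posdefmx_val A = N^T *m (Q *m diag_mx c *m Q^T) *m N ->
      dist_pd Zs A ^+ 2 <= dist_pd Z A ^+ 2 + 4 * s * qavg Q u (map_mx (@ln R) c) +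
        s ^+ 2 * (36 * expR (3 * dist_pd Z A)).
Proof.
move=> uN ZE uu s2; have [ss' _ _] := rankup_inv_coef s2; set s' := - s / (1 + s) in ss'.
have rK : rankup u s *m rankup u s' = 1%:M by rewrite rankupM// ss' /rankup scale0r addr0.
have rK' : rankup u s' *m rankup u s = 1%:M by exact: mulmx1C.
have [uS uS'] := mulmx1_unit rK.
have [G GE] : exists G, G = rankup u s' *m N by eexists.
have uG : G \in unitmx by rewrite GE unitmx_mul uS' uN.
pose Zs : posdefmx R n := PosDefMx (posdef_gram uG).
have key (A : posdefmx R n) (Q : 'M[R]_n) (c : 'rV[R]_n) : Q *m Q^T = 1%:M -> (forall i, 0 < c 0 i) ->
    posdefmx_val A = N^T *m (Q *m diag_mx c *m Q^T) *m N ->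
    dist_pd Zs A ^+ 2 <= dist_pd Z A ^+ 2 + 4 * s * qavg Q u (map_mx (@ln R) c) +
      s ^+ 2 * (36 * expR (3 * dist_pd Z A)).
  move=> QQ c0 AE.
  have -> : dist_pd Z A = lnnorm c.
    apply: (dist_pdE (M := Q^T *m N)).
      by rewrite trmx_mul trmxK -mulmxA [Q *m (_ *m _)]mulmxA QQ mul1mx.
    by rewrite AE trmx_mul trmxK !mulmxA.
  have pC : is_posdef (Q *m diag_mx c *m Q^T).
    have := @posdef_congr R n (diag_mx c) Q^T.
    by rewrite trmxK unitmx_tr; apply; [exact: orthogonal_unit|exact: posdef_diag].
  have pX : is_posdef (rankup u s *m (Q *m diag_mx c *m Q^T) *m rankup u s).
    by have := posdef_congr uS pC; rewrite rankup_sym.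
  have [W [x [WW XE _ x0]]] := posdef_spectral pX.
  have -> : dist_pd Zs A = lnnorm x.
    apply: (dist_pdE (M := W^T *m G)).
      rewrite [(W^T *m G)^T]trmx_mul trmxK -mulmxA [W *m (_ *m _)]mulmxA WW mul1mx.
      by [].
    rewrite [(W^T *m G)^T]trmx_mul trmxK.
    have -> : G^T *m W *m diag_mx x *m (W^T *m G) = G^T *m (W *m diag_mx x *m W^T) *m G.
      by rewrite !mulmxA.
    rewrite -XE AE GE trmx_mul rankup_sym.
    rewrite -!mulmxA [rankup u s *m (rankup u s' *m _)]mulmxA rK mul1mx.
    by rewrite [rankup u s' *m (rankup u s *m _)]mulmxA rK' mul1mx.
  rewrite !lnnorm_sq.
  have := @sqr_log_rankup_le R n Q W (map_mx (@ln R) c) x u s (lnnorm c) QQ WW uu s2 (lnnorm_ge0 c) x0.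
  have -> : map_mx expR (map_mx (@ln R) c) = c.
    by apply/rowP => i; rewrite !mxE lnK ?posrE.
  move=> /(_ _ XE) h; have {}h := h (fun i => _).
  have -> : \sum_i ln (c 0 i) ^+ 2 = \sum_i (map_mx (@ln R) c) 0 i ^+ 2.
    by apply: eq_bigr => i _; rewrite mxE.
  by apply: h => i; rewrite mxE; exact: lnnorm_coord.
exists Zs => //.
have ZE1 : posdefmx_val Z = N^T *m (1%:M *m diag_mx (const_mx 1) *m 1%:M^T) *m N.
  by rewrite diag_const1 ?trmx1 ?mulmx1 ?mul1mx// => i; rewrite mxE.
(* The same bound at A = Z, where C = 1, leaves dist(Zs, Z)^2 <= 36 s^2, hence the constant 6. *)
have := key Z 1%:M (const_mx 1) _ _ ZE1; rewrite trmx1 mulmx1 => /(_ erefl).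
have -> : map_mx (@ln R) (const_mx 1 : 'rV[R]_n) = 0.
  by apply/rowP => i; rewrite !mxE ln1.
rewrite dist_pd_refl mulr0 expR0 mulr1 expr0n /= add0r.
have -> : qavg (1%:M : 'M[R]_n) u 0 = 0 by rewrite /qavg linear0 mulmx0 mul0mx mulmx0 mul0mx mxE.
rewrite mulr0 add0r => /(_ (fun i => _)) h.
rewrite -ler_sqr ?nnegrE ?dist_pd_ge0 ?mulr_ge0// exprMn real_normK ?num_real//.
rewrite (_ : 6 ^+ 2 * s ^+ 2 = s ^+ 2 * 36); last by ring.
by apply: h => i; rewrite mxE.
Qed.

(* Integrated subgradient inequality. The first variations of the squared distance
   have nonnegative integral since [Z] is a barycenter. The error term of order
   [s * exp (3 dist)] need not be integrable, but its minimum with an integrable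
   bound tends to 0 in mean by dominated convergence. *)
Lemma karcher_jensen (R : realType) (n : nat) (d : measure_display)
    (Omega : measurableType d) (P : probability Omega R)
    (phi : Omega -> borel (@dist_pd R n)) (Z : posdefmx R n) (N : 'M[R]_n)
    (us : seq 'cV[R]_n) (sg : R) (T : Omega -> R) :
  L1map P phi -> is_barycenter (pushforward P phi) Z ->
  N \in unitmx -> posdefmx_val Z = N^T *m N ->
  (forall u, u \in us -> u^T *m u = 1%:M) -> `|sg| = 1 -> L1fun P T ->
  (forall w (Q : 'M[R]_n) (c : 'rV[R]_n), Q *m Q^T = 1%:M -> (forall i, 0 < c 0 i) ->
     posdefmx_val (phi w) = N^T *m (Q *m diag_mx c *m Q^T) *m N ->
     4 * (sg * \sum_(u <- us) qavg Q u (map_mx (@ln R) c)) <= T w) ->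
  0 <= \int[P]_w T w.
Proof.
move=> phiL Zb uN ZE uus sg1 TL Tle.
have Q := dist_pd_quasi_metric R n; have [c1 d0 ds dq] := Q.
have {}Zb := (is_barycenter_pushforward _ Q phiL).1 Zb.
pose s j := sg * hpow R j.+1.
have h0 j := hpow_gt0 R j.+1.
have h12 j : hpow R j.+1 <= 2^-1.
  rewrite /hpow exprS -[leRHS]mulr1 ler_wpM2l ?invr_ge0//.
  by rewrite exprn_ile1 ?invr_ge0// invf_le1 ?ler1n.
have ns j : `|s j| = hpow R j.+1 by rewrite /s normrM sg1 mul1r ger0_norm// ltW.
have s2 j : `|s j| <= 2^-1 by rewrite ns.
pose D (w : Omega) := dist_pd Z (phi w).
have DL : L1fun P D by exact: (L1_dist Z Q phiL).
set k := kap R n in c1 Q dq; clearbody k.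
pose V (z : posdefmx R n) j u := dist_pd z Z <= 6 * `|s j| /\
  forall (A : posdefmx R n) (Q : 'M[R]_n) (c : 'rV[R]_n),
      Q *m Q^T = 1%:M -> (forall i, 0 < c 0 i) ->
      posdefmx_val A = N^T *m (Q *m diag_mx c *m Q^T) *m N ->
      dist_pd z A ^+ 2 <= dist_pd Z A ^+ 2 + 4 * s j * qavg Q u (map_mx (@ln R) c) +
        s j ^+ 2 * (36 * expR (3 * dist_pd Z A)).
(* The perturbed points are fixed before w, so that they can be compared with Z under the integral;
   for a vector that is not unit the value Z is a dummy. *)
have /choice[z zV] : forall ju : nat * 'cV[R]_n, exists z,
    ju.2^T *m ju.2 = 1%:M -> V z ju.1 ju.2.
  move=> [j u] /=; have [uu|nu] := pselect (u^T *m u = 1%:M); last by exists Z.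
  by have [z h1 h2] := dist_pd_variation uN ZE uu (s2 j); exists z.
pose X j u w := dist_pd (z (j, u)) (phi w) ^+ 2 - D w ^+ 2.
have XL j u : L1fun P (X j u) by exact: (L1_distsq Z (z (j, u)) Q phiL).
have X0 j u : 0 <= \int[P]_w X j u w by exact: Zb.
pose E w := (size us)%:R * (36 * expR (3 * D w)).
(* Bound for the difference quotient [g]: [quasi_sq_le] with dist(z, Z) <= 6 h, divided by h, where
   h <= 1/2 turns the last 6 h into 3. *)
pose B w := (size us)%:R * (k * 6 * (2 * D w + k * 3)).
pose g j w := (hpow R j.+1)^-1 * \sum_(u <- us) X j u w.
have gL j : L1fun P (g j) by apply: L1Z; apply: L1_sum.
have g0 j : 0 <= \int[P]_w g j w.
  rewrite RintegralZl//; last by apply: L1_sum.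
  rewrite RI_sum//; apply: mulr_ge0; last exact: sumr_ge0.
  by rewrite invr_ge0 ltW.
have gT j w : g j w - T w <= hpow R j.+1 * E w.
  have [Nw [U [c [_ UU c0 _ _]]]] := posdefmx_factor Z (phi w).
  have {Nw c c0 U UU} [U [c [UU c0 AE]]] := posdef_simdiag uN (posdefmxP (phi w)).
  have {}Tle := Tle w U c UU c0 AE.
  have : \sum_(u <- us) X j u w <=
      \sum_(u <- us) (4 * s j * qavg U u (map_mx (@ln R) c) + s j ^+ 2 * (36 * expR (3 * D w))).
    rewrite !big_seq; apply: ler_sum => u uin.
    have [_ /(_ _ _ _ UU c0 AE)] := zV (j, u) (uus u uin).
    by rewrite /X /D /=; lra.
  rewrite [X in _ <= X -> _]big_split /= -mulr_sumr big_const_seq count_predT iter_addr addr0 => h.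
  rewrite lerBlDr /g mulrC ler_pdivrMr//; apply: le_trans h _.
  rewrite [leRHS]mulrDl [leLHS]addrC; apply: lerD.
    rewrite /E -mulr_natl (_ : s j ^+ 2 = hpow R j.+1 ^+ 2); last by rewrite -ns real_normK ?num_real.
    by rewrite le_eqVlt; apply/orP; left; apply/eqP; ring.
  rewrite /s; set S := \sum_(u <- us) _ in Tle *.
  rewrite (_ : 4 * (sg * hpow R j.+1) * S = 4 * (sg * S) * hpow R j.+1); last by ring.
  by apply: ler_wpM2r => //; exact: ltW.
have gB j w : `|g j w| <= B w.
  rewrite /g normrM ger0_norm ?invr_ge0 ?(ltW (h0 j))// mulrC ler_pdivrMr//.
  apply: le_trans (ler_norm_sum _ _ _) _.
  have -> : B w * hpow R j.+1 = \sum_(u <- us) (k * (6 * hpow R j.+1) * (2 * D w + k * 3)).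
    by rewrite big_const_seq count_predT iter_addr addr0 -mulr_natl /B; ring.
  rewrite !big_seq; apply: ler_sum => u uin.
  have [zs _] := zV (j, u) (uus u uin); rewrite ns in zs.
  apply: le_trans (quasi_sq_le _ _ _ Q) _.
  have dz := d0 (z (j, u)) Z; have DD : 0 <= D w by exact: d0.
  have hj := h12 j; apply: ler_pM.
  - apply: mulr_ge0; lra.
  - by apply: addr_ge0; [apply: mulr_ge0 => //; exact: DD|apply: mulr_ge0 => //; lra].
  - by apply: ler_wpM2l => //; lra.
  - rewrite -/(D w) lerD2l; apply: ler_wpM2l; first lra.
    by apply: le_trans zs _; lra.
pose m j w := Num.min (hpow R j.+1 * E w) (B w + `|T w|).
have E0 w : 0 <= E w by rewrite /E mulr_ge0// mulr_ge0// expR_ge0.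
have B0 w : 0 <= B w.
  have DD : 0 <= D w by exact: d0.
  rewrite /B mulr_ge0// !mulr_ge0//; lra.
have BTL : L1fun P (fun w => B w + `|T w|).
  apply: L1D; last exact: integrable_norm.
  by apply: L1Z; apply: L1Z; apply: L1D; [exact: L1Z|exact: L1_cst].
have mE : measurable_fun setT E.
  apply: measurable_funM => //; apply: measurable_funM => //.
  apply: measurableT_comp => //; exact: (L1_meas (L1Z 3 DL)).
have mm j : measurable_fun setT (m j).
  by apply: measurable_minr; [exact: measurable_funM|exact: (L1_meas BTL)].
have m0 j w : 0 <= m j w by rewrite le_min mulr_ge0 ?(ltW (h0 j))//= addr_ge0.
have mB j w : `|m j w| <= B w + `|T w| by rewrite ger0_norm// ge_min lexx orbT.
have mlim w : (fun j => m j w) @ \oo --> (0 : R).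
  apply: (squeeze_cvgr (f := fun=> 0) (h := fun j => hpow R j.+1 * E w)).
  - by apply: nearW => j; rewrite m0 /= ge_min lexx.
  - exact: cvg_cst.
  rewrite -(mul0r (E w)); apply: cvgM; last exact: cvg_cst.
  by have := @hpow_cvg0 R; rewrite -(cvg_shiftS (hpow R)).
have mL j : L1fun P (m j) by exact: (L1_le (mm j) (mB j) BTL).
have lim := Rintegral_dominated0 mm mlim BTL mB.
have le j : (- (\int[P]_w T w) <= \int[P]_w m j w).
  apply: le_trans (_ : \int[P]_w (g j w - T w) <= _).
    rewrite RintegralB//; last exact: (gL j).
    by rewrite -[leLHS]add0r; apply: lerB => //; exact: (g0 j).
  apply: le_Rintegral => //; [exact: L1B|exact: mL|].
  move=> w _; rewrite /m le_min gT /=.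
  have := gB j w; have := ler_norm (g j w); have := ler_norm (- T w); rewrite normrN; lra.
suff : (- (\int[P]_w T w) <= 0) by rewrite oppr_le0.
have cst : (fun _ : nat => - (\int[P]_w T w)) @ \oo --> - (\int[P]_w T w).
  exact: cvg_cst.
by apply: (ler_cvg_to cst lim); exact: nearW.
Qed.

Lemma ln_topprod (R : realType) (n k : nat) (a : 'rV[R]_n) : (forall i, 0 < a 0 i) ->
  ln (topprod k a) = \sum_(i < n | (i < k)%N) ln (a 0 i).
Proof.
(* Positivity of the partial products is carried through the induction because [lnM] requires it. *)
move=> a0; apply: (@proj2 (0 < topprod k a)); rewrite /topprod.
elim/big_ind2 : _ => [|x1 x2 y1 y2 [p1 <-] [p2 <-]|i _]; last by split.
- by rewrite ln1.
- by split; [exact: mulr_gt0|rewrite lnM ?posrE].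
Qed.

Lemma mxtrace_frame_qavg (R : realType) (n k : nat) (Q : 'M[R]_n) (l : 'rV[R]_n)
    (U : 'M[R]_(n, k)) :
  \tr (U^T *m (Q *m diag_mx l *m Q^T) *m U) =
  \sum_(u <- [seq col i U | i <- enum 'I_k]) qavg Q u l.
Proof.
rewrite big_map big_enum /=; apply: eq_bigr => i _; rewrite /qavg tr_col -row_mul !mxE.
by apply: eq_bigr => j _; rewrite !mxE.
Qed.

Lemma frame_cols (R : realType) (n k : nat) (U : 'M[R]_(n, k)) (u : 'cV[R]_n) :
  frame U -> u \in [seq col i U | i <- enum 'I_k] -> u^T *m u = 1%:M.
Proof.
move=> fU /mapP[i _ ->]; apply/matrixP => a b; rewrite !ord1.
have /matrixP/(_ i i) := fU; rewrite !mxE !eqxx => <-.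
by apply: eq_bigr => j _; rewrite !mxE.
Qed.

Lemma svd_det (R : realType) (n : nat) (X : 'M[R]_n) (a : 'rV[R]_n) :
  svd X a -> topprod n a = `|\det X|.
Proof.
case=> _ a0 [Q1 [Q2 [h1 h2 ->]]].
have det1 (Q : 'M[R]_n) : Q *m Q^T = 1%:M -> `|\det Q| = 1.
  move=> /(congr1 determinant); rewrite det_mulmx det_tr det1 -expr2 => h.
  by apply/eqP; rewrite -sqrp_eq1// real_normK ?num_real// h.
rewrite !det_mulmx !normrM (det1 _ h1) (det1 _ h2) mul1r mulr1 det_diag.
rewrite ger0_norm; last by apply: prodr_ge0 => i _; exact: ltW.
by rewrite /topprod; apply: eq_bigl => i; rewrite ltn_ord.
Qed.

Lemma spow_det (R : realType) (n : nat) (Q : 'M[R]_n) (l : 'rV[R]_n) (t : R) :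
  Q *m Q^T = 1%:M -> \det (spow Q l t) = expR (t * \sum_i l 0 i).
Proof.
move=> QQ; rewrite /spow !det_mulmx mulrAC -det_mulmx QQ det1 mul1r det_diag.
rewrite big_distrr /=.
elim/big_rec2 : _ => [|i x y _ ->]; first by rewrite expR0.
by rewrite mxE expRD.
Qed.

Lemma L1map_lip (R : realType) (n : nat) (v : posdefmx R n -> posrv R n) (c : R)
    (d : measure_display) (Omega : measurableType d) (P : probability Omega R)
    (phi : Omega -> borel (@dist_pd R n)) :
  0 <= c -> (forall A B, dist_pos (v A) (v B) <= c * dist_pd A B) ->
  L1map P phi -> L1map (dist := @dist_pos R n) P (fun w => v (phi w)).
Proof.
move=> c0 vc phiL; have [mphi [x xfin]] := phiL; have Q := dist_pd_quasi_metric R n.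
have [_ _ ds _] := Q; have [_ e0 es _] := dist_pos_quasi R n.
have mv : measurable_fun setT (fun w => v (phi w) : borel (@dist_pos R n)).
  exact: (measurableT_comp (lip_borel (dist' := @dist_pos R n) c0 vc) mphi).
split=> //; exists (v x).
apply: le_lt_trans (integrable_lty measurableT (L1Z c (L1_dist x Q phiL))) => //=.
apply: ge0_le_integral => //.
- by move=> w _; rewrite lee_fin.
- apply/measurable_EFinP.
  apply: (measurableT_comp (f := fun a : borel (@dist_pos R n) => dist_pos a (v x)) _ mv).
  have [k1 _ _ kq] := dist_pos_quasi R n.
  by apply: (lip_borel_real (c := n.+1%:R)) => //; rewrite ler0n.
- by apply/measurable_EFinP; exact: (L1_meas (L1Z c (L1_dist x Q phiL))).
- by move=> w _; rewrite lee_fin ds; exact: vc.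
Qed.

Lemma spectral_map_log_majorized (R : realType) (n : nat) (E : 'M[R]_n)
    (v : posdefmx R n -> posrv R n) (d : measure_display) (Omega : measurableType d)
    (P : probability Omega R) (phi : Omega -> borel (@dist_pd R n)) :
  spectral_map E v -> L1map P phi ->
  log_majorized (v (geom_integral P phi))
    (geom_integral (dist := @dist_pos R n) P (fun w => v (phi w))).
Proof.
move=> sv phiL; pose psi (w : Omega) : borel (@dist_pos R n) := v (phi w).
have psiL : L1map (dist := @dist_pos R n) P psi.
  by apply: (L1map_lip (c := kap R n)) phiL; [rewrite ler0n|move=> A B; exact: spectral_map_lip].
set Z := geom_integral P phi; set a := geom_integral P _.
have Zb : is_barycenter (pushforward P phi) Z.
  (* Existence rules out the default value of [get] in [barycenter]. *)
  exact: (xgetPex point (barycenter_pd_exists phiL)).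
have lna i : ln (a 0 i) = \int[P]_w ln (v (phi w) 0 i) by exact: (geom_integral_pos i psiL).
have lnL i : L1fun P (fun w => ln (v (phi w) 0 i)) by exact: (L1_ln_coord i psiL).
have v0 A i : 0 < v A 0 i by exact: posrv_gt0.
pose f k w := ln (topprod k (v (phi w))).
have fE k w : f k w = \sum_(i < n | (i < k)%N) ln (v (phi w) 0 i) by exact: ln_topprod.
have fL k : L1fun P (f k).
  have -> : f k = fun w => \sum_(i < n | (i < k)%N) ln (v (phi w) 0 i) by apply/funext => w.
  exact: L1_sum.
have fint k : \int[P]_w f k w = ln (topprod k a).
  rewrite ln_topprod; last exact: posrv_gt0.
  transitivity (\int[P]_w \sum_(i < n | (i < k)%N) ln (v (phi w) 0 i)).
    by apply: eq_Rintegral => w _.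
  by rewrite RI_sum//; apply: eq_bigr => i _; rewrite lna.
have [N [uN ZE sZ]] := sv Z.
have half w Q c : Q *m Q^T = 1%:M -> (forall i, 0 < (c : 'rV[R]_n) 0 i) ->
    posdefmx_val (phi w) = N^T *m (Q *m diag_mx c *m Q^T) *m N ->
    svd (spow Q (map_mx (@ln R) c) 2^-1 *m (N *m E *m N^T) *m
         spow Q (map_mx (@ln R) c) 2^-1) (v (phi w)).
  move=> QQ c0 AE; have [N' [uN' AE' sA]] := sv (phi w).
  exact: (svd_half uN uN' QQ c0 AE AE' sA).
have le k : (k <= n)%N -> ln (topprod k (v Z)) <= ln (topprod k a).
  move=> kn; have [U [V [fU fV KV UK dD]]] := svd_frames kn sZ.
  pose us := [seq col i U | i <- enum 'I_k] ++ [seq col i V | i <- enum 'I_k].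
  (* The factor 8 is the 4 of [karcher_jensen] times 2, which clears the 1/2 in
     [svd_subgradient]. *)
  have TL : L1fun P (fun w => 8 * (f k w - ln (topprod k (v Z)))).
    by apply: L1Z; apply: L1B; [exact: fL|exact: L1_cst].
  have := karcher_jensen (us := us) (sg := 1) phiL Zb uN ZE _ (normr1 R) TL.
  rewrite RintegralZl//; last by apply: L1B; [exact: fL|exact: L1_cst].
  rewrite RintegralB//; [|exact: fL|exact: L1_cst].
  rewrite RI_cst fint pmulr_rge0// subr_ge0; apply.
    by move=> u; rewrite mem_cat => /orP[]; exact: frame_cols.
  move=> w Q c QQ c0 AE.
  have := svd_subgradient kn QQ sZ (half w Q c QQ c0 AE) fU fV KV UK dD erefl.
  rewrite !mxtrace_frame_qavg -big_cat -/us mul1r -/(f k w); lra.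
(* For k = n the top product is |det|, and the increment of its logarithm is exactly tr (log C), the
   sum of [qavg] over the standard basis. Variations with negative s therefore give the reverse
   inequality. *)
have eq_n : ln (topprod n (v Z)) = ln (topprod n a).
  apply/le_anti; rewrite le//=.
  pose us := [seq col i (1%:M : 'M[R]_n) | i <- enum 'I_n].
  have TL : L1fun P (fun w => 4 * (ln (topprod n (v Z)) - f n w)).
    by apply: L1Z; apply: L1B; [exact: L1_cst|exact: fL].
  have := karcher_jensen (us := us) (sg := -1) phiL Zb uN ZE _ _ TL.
  rewrite RintegralZl//; last by apply: L1B; [exact: L1_cst|exact: fL].
  rewrite RintegralB//; [|exact: L1_cst|exact: fL].
  rewrite RI_cst fint pmulr_rge0// subr_ge0; apply.
  - by move=> u; apply: frame_cols; rewrite /frame trmx1 mulmx1.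
  - by rewrite normrN normr1.
  move=> w Q c QQ c0 AE; rewrite -mxtrace_frame_qavg trmx1 mul1mx mulmx1.
  have -> : \tr (Q *m diag_mx (map_mx (@ln R) c) *m Q^T) = \sum_i map_mx (@ln R) c 0 i.
    by rewrite -mulmxA mxtrace_mulC -mulmxA (mulmx1C QQ) mulmx1 mxtrace_diag.
  have := svd_det (half w Q c QQ c0 AE); rewrite 2!det_mulmx 2!normrM -(svd_det sZ).
  rewrite spow_det// ger0_norm ?expR_ge0// mulrAC -expRD => h.
  rewrite ler_wpM2l// /f h lnM ?posrE ?expR_gt0 ?topprod_gt0// expRK.
  set S := \sum_i _; set t := ln _; lra.
have a0 i : 0 < a 0 i by exact: posrv_gt0.
have t0 k : 0 < topprod k a by exact: topprod_gt0.
have tZ k : 0 < topprod k (v Z) by exact: topprod_gt0.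
split.
- by case: sZ.
- move=> i j ij; rewrite -ler_ln ?posrE// !lna; apply: le_Rintegral => //; [exact: lnL|exact: lnL|move=> w _].
  rewrite ler_ln ?posrE//; have [N' [_ _ [sA _ _]]] := sv (phi w); exact: sA.
- move=> k /andP[_ kn]; rewrite -!/(topprod k _) -ler_ln ?posrE//; exact: le.
- have h (x : posrv R n) : \prod_(i < n) x 0 i = topprod n x.
    by rewrite /topprod; apply: eq_bigl => i; rewrite ltn_ord.
  by rewrite !h; apply: (@ln_inj R); rewrite ?posrE.
Qed.

Local Close Scope ring_scope.
Local Close Scope classical_set_scope.

Theorem theorem1p1 (R : realType) (n : nat) :
  [/\ dist_lipschitz (@dist_pd R n) (@dist_pos R n) (@eigvals R n),
      dist_lipschitz (@dist_pd R (n + n)) (@dist_pos R (n + n))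
        (@ext_sympl_eigvals R n),
      forall (d : measure_display) (Omega : measurableType d)
        (P : probability Omega R) (phi : Omega -> borel (@dist_pd R n)),
        L1map P phi ->
        log_majorized
          (eigvals (geom_integral P phi))
          (geom_integral (dist := @dist_pos R n) P (fun w => eigvals (phi w)))
    & forall (d : measure_display) (Omega : measurableType d)
        (P : probability Omega R) (phi : Omega -> borel (@dist_pd R (n + n))),
        L1map P phi ->
        log_majorized
          (ext_sympl_eigvals (geom_integral P phi))
          (geom_integral (dist := @dist_pos R (n + n)) P
             (fun w => ext_sympl_eigvals (phi w)))].
Proof.
have lam : spectral_map (1%:M)%R (@eigvals R n) by exact: eigvals_svd.
have dhat : spectral_map (symplJ R n) (@ext_sympl_eigvals R n) by exact: ext_sympl_svd.
split.
- by exists (kap R n) => [|A B]; [rewrite ler0n|exact: spectral_map_lip lam].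
- by exists (kap R (n + n)) => [|A B]; [rewrite ler0n|exact: spectral_map_lip dhat].
- by move=> d Omega P phi; exact: spectral_map_log_majorized.
- by move=> d Omega P phi; exact: spectral_map_log_majorized.
Qed.
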